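(* Let $T>0$ and let $\mu$ be a stochastic measure on the Borel $\sigma$-algebra of $\mathbb{R}$ (a map into the real random variables on a complete probability space $(\Omega,\mathcal{F},\mathsf{P})$ that is $\sigma$-additive in probability). Assume the following. (1) $u_0(y)=u_0(y,\omega):\mathbb{R}\times\Omega\to\mathbb{R}$ is measurable, and there are a positive finite random constant $C(\omega)$ and a number $\beta(u_0)\ge 1/6$ such that $|u_0(y)|\le C(\omega)$ and $|u_0(y_1)-u_0(y_2)|\le C(\omega)|y_1-y_2|^{\beta(u_0)}$ for all $y,y_1,y_2\in\mathbb{R}$. (2) $f:\mathbb{R}^2\to\mathbb{R}$ is measurable and bounded, and there is a constant $L_f$ such that $|f(y_1,z_1)-f(y_2,z_2)|\le L_f(|y_1-y_2|+|z_1-z_2|)$ for all $y_1,y_2,z_1,z_2\in\mathbb{R}$. (3) $\sigma:\mathbb{R}_+\times\mathbb{R}\to\mathbb{R}$ is measurable and bounded, and there are constants $L_\sigma$ and $1/2<\beta(\sigma)<1$ such that $|\sigma(s,y_1)-\sigma(s,y_2)|\le L_\sigma|y_1-y_2|^{\beta(\sigma)}$ for all $s\in\mathbb{R}_+$, $y_1,y_2\in\mathbb{R}$. (4) For some $\tau>5/2$ the function $|y|^\tau$ is integrable with respect to $\mu$ on $\mathbb{R}$. (5) For every $y\in\mathbb{R}$ the limit $\bar\sigma(y)=\lim_{t\to\infty}\frac1t\int_0^t\sigma(s,y)\,ds$ exists, and the function $G_\sigma(r,y)=\int_0^r(\sigma(s,y)-\bar\sigma(y))\,ds$, $r\in\mathbb{R}_+$,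 $y\in\mathbb{R}$, is bounded. Let $p(t,x)=(2\sqrt{\pi t})^{-1}e^{-x^2/(4t)}$. For $\varepsilon>0$ let $u_\varepsilon$ be the solution on $[0,T]\times\mathbb{R}$ of $$u_\varepsilon(t,x)=\int_{\mathbb{R}}p(t,x-y)u_0(y)\,dy+\int_0^t ds\int_{\mathbb{R}}p(t-s,x-y)f(y,u_\varepsilon(s,y))\,dy+\int_{\mathbb{R}}d\mu(y)\int_0^t p(t-s,x-y)\sigma(s/\varepsilon,y)\,ds,$$ and let $\bar u$ be the solution on $[0,T]\times\mathbb{R}$ of $$\bar u(t,x)=\int_{\mathbb{R}}p(t,x-y)u_0(y)\,dy+\int_0^t ds\int_{\mathbb{R}}p(t-s,x-y)f(y,\bar u(s,y))\,dy+\int_{\mathbb{R}}d\mu(y)\int_0^t p(t-s,x-y)\bar\sigma(y)\,ds.$$ Then there exist versions of $u_\varepsilon$ ($\varepsilon>0$) and $\bar u$ such that for any $\gamma_1$ with $0\le\gamma_1<\frac12\left(1-\frac{1}{2\beta(\sigma)}\right)$, $$\sup_{\varepsilon>0,\ t\in[0,T],\ x\in\mathbb{R}}\varepsilon^{-\gamma_1}|u_\varepsilon(t,x)-\bar u(t,x)|<+\infty\quad\text{a.s.}$$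
   Context: Stochastic measure: let $\mathsf{L}_0=\mathsf{L}_0(\Omega,\mathcal{F},\mathsf{P})$ be the set of all real-valued random variables on the complete probability space $(\Omega,\mathcal{F},\mathsf{P})$, with convergence in probability, and let $\mathcal{B}$ be the Borel $\sigma$-algebra on $\mathbb{R}$. A stochastic measure is a $\sigma$-additive mapping $\mu:\mathcal{B}\to\mathsf{L}_0$, i.e. a vector measure with values in $\mathsf{L}_0$. No additional measurability, positivity or moment conditions are assumed. Integral with respect to $\mu$: for a deterministic simple function $g=\sum_{i=1}^n c_i\mathbf{1}_{A_i}$ ($A_i\in\mathcal{B}$) and $A\in\mathcal{B}$, $\int_A g\,d\mu=\sum_{i=1}^n c_i\mu(A\cap A_i)$. A deterministic measurable $g:\mathbb{R}\to\mathbb{R}$ is integrable with respect to $\mu$ if there are simple functions $g_n\to g$ $\mu$-almost everywhere (i.e. outside a Borel set all of whose Borel subsets have $\mu$-value $0$ a.s.) such that for each $A\in\mathcal{B}$ the sequence $\int_A g_n\,d\mu$ converges in probability; the limit is $\int_A g\,d\mu$. Every bounded measurable $g$ is integrable with respect to any stochastic measure. The notation $\int_{\mathbb{R}}d\mu(y)\int_0^t(\cdots)\,ds$ means that the inner deterministic integral over $s$ is taken first, giving a function of $y$ which is then integrated with respect to $\mu$. Solution: a solution $u(t,x)=u(t,x,\omega):[0,T]\times\mathbb{R}\times\Omega\to\mathbb{R}$ is a measurable random function such that for each $(t,x)$ the equation holds a.s. At $t=0$ the equations are read as the initial condition $u(0,x)=u_0(x)$. Under hypotheses (1)-(5), it is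 known that solutions of both equations exist, are unique (for each $(t,x)$, any two solutions coincide a.s.), and have versions continuous in $(t,x)$. A version of a random function is another random function that, for each fixed value of its parameters, coincides with the given one a.s. $\mathbb{R}_+=[0,\infty)$. *)

(* Defs.v *)
From HB Require Import structures.
From mathcomp Require Import all_boot all_order all_algebra.
From mathcomp Require Import all_classical all_reals all_analysis.
Set Implicit Arguments.
Unset Strict Implicit.
Unset Printing Implicit Defensive.
Import Order.TTheory GRing.Theory Num.Theory.
Import numFieldNormedType.Exports.
Local Open Scope classical_set_scope.
Local Open Scope ring_scope.

Section stochastic_measure.
Context {d : measure_display} {Omega : measurableType d} {R : realType}.
Variable P : probability Omega R.

Definition cvg_in_probability (X : nat -> Omega -> R) (Y : Omega -> R) : Prop :=
  forall e : R, 0 < e ->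
    P [set w | e <= `|X n w - Y w|] @[n --> \oo] --> 0%E.

(* Random variables are not quotiented by a.s. equality, and [mu] is a total
   function whose values on non-Borel sets are never used.  The constant
   sequence set0 gives mu set0 = 0 a.s., hence finite additivity a.s. *)
Definition stochastic_measure (mu : set R -> {RV P >-> R}) : Prop :=
  forall A : nat -> set R,
    (forall n, measurable (A n)) -> trivIset setT A ->
    cvg_in_probability (fun n w => \sum_(i < n) mu (A i) w)
                       (mu (\bigcup_n A n)).

(* A list of pairs (c_i, A_i) encodes the representation
   \sum_i c_i 1_{A_i}; the A_i need not be disjoint. *)
Definition simple_rep (s : seq (R * set R)) : Prop :=
  forall a, a \in s -> measurable (a.2 : set R).

Definition simple_fun (s : seq (R * set R)) (y : R) : R :=
  \sum_(a <- s) a.1 * \1_(a.2) y.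

Variable mu : set R -> {RV P >-> R}.

Definition simple_integral (s : seq (R * set R)) (A : set R) (w : Omega) : R :=
  \sum_(a <- s) a.1 * mu (A `&` a.2) w.

Definition mu_null (N : set R) : Prop :=
  measurable N /\
  forall B : set R, measurable B -> B `<=` N -> {ae P, forall w, mu B w = 0}.

Definition approximates (g : R -> R) (s : nat -> seq (R * set R)) : Prop :=
  [/\ forall n, simple_rep (s n),
      exists2 N, mu_null N &
        forall y, ~ N y -> simple_fun (s n) y @[n --> \oo] --> g y
    & forall A : set R, measurable A -> exists xi : {RV P >-> R},
        cvg_in_probability (fun n => simple_integral (s n) A) xi].

Definition mu_integrable (g : R -> R) : Prop :=
  measurable_fun setT g /\ exists s, approximates g s.

(* [xi] is (a version of) the integral of [g] over [A]; the integral is only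
   determined up to a.s. equality, hence a relation. *)
Definition is_mu_integral (g : R -> R) (A : set R) (xi : {RV P >-> R}) : Prop :=
  measurable_fun setT g /\
  exists2 s, approximates g s &
    cvg_in_probability (fun n => simple_integral (s n) A) xi.

(* The junk value at t = 0 is harmless: the kernel only occurs there on a
   Lebesgue-null set of times. *)
Definition heat_kernel (t x : R) : R :=
  (2 * Num.sqrt (pi * t))^-1 * expR (- (x ^+ 2 / (4 * t))).

(* [u] solves on [0, T] x R the mild equation with initial value [u0], drift [f]
   and noise coefficient [sg]; at t = 0 this is the initial condition. *)
Definition is_solution (T : R) (u0 : R -> Omega -> R) (f : R -> R -> R)
    (sg : R -> R -> R) (u : R -> R -> Omega -> R) : Prop :=
  [/\ measurable_fun (`[0, T] `*` setT `*` setT)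
        (fun z : R * R * Omega => u z.1.1 z.1.2 z.2),
      forall x, {ae P, forall w, u 0 x w = u0 x w}
    & forall t x : R, 0 < t <= T ->
      exists2 xi : {RV P >-> R},
        is_mu_integral
          (fun y => \int[lebesgue_measure]_(s in `[0, t])
                      (heat_kernel (t - s) (x - y) * sg s y)) setT xi
      & {ae P, forall w, u t x w =
          \int[lebesgue_measure]_(y in setT) (heat_kernel t (x - y) * u0 y w)
          + \int[lebesgue_measure]_(s in `[0, t])
              (\int[lebesgue_measure]_(y in setT)
                 (heat_kernel (t - s) (x - y) * f y (u s y w)))
          + xi w}].

End stochastic_measure.

(* Main.v *)
Require Import Defs.
From HB Require Import structures.
From mathcomp Require Import all_boot all_order all_algebra.
From mathcomp Require Import all_classical all_reals all_analysis.
From mathcomp Require Import measurable_realfun zify ring lra.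
Import Order.TTheory GRing.Theory Num.Theory.
Import numFieldNormedType.Exports.
Set Implicit Arguments.
Unset Strict Implicit.
Unset Printing Implicit Defensive.
Local Open Scope classical_set_scope.
Local Open Scope ring_scope.

(** For fixed (t, x) the two noise terms differ by the mu-integral of
    q(y) = \int_0^t p(t-s, x-y) (sigma(s/eps, y) - sigma_bar(y)) ds.
    Since p(., z) is quasiconcave in time and the primitive of
    s |-> sigma(s/eps, y) - sigma_bar(y) is O(eps), q = O(sqrt eps); q is also
    beta-Hoelder with a constant independent of eps. Interpolating, q is of size
    rho^(1-th) in the (beta th)-Hoelder norm, where rho = min(1, sqrt eps) and
    1/2 < beta th < beta.

    For al > 1/2 the mu-integral of a function of al-Hoelder norm at most b is
    a.s. at most b K, with one random variable K serving all functions: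
    telescoping along dyadic partitions bounds the integral by
    b \sum_n 2^(-n al) \sum_k |mu(I_nk)|, and this series converges a.s. because
    mu is bounded in probability on bounded simple functions (by random signs,
    the squares of the |mu(I_nk)| are then summable with suitable weights).

    Gronwall's lemma transfers the bound to u_eps - u_bar. Each estimate holds
    a.s. only for fixed (eps, t, x), but with an exceptional set that does not
    matter for the theorem: u_eps is replaced by u_bar wherever one of countably
    many such bounds fails, which yields a version satisfying all of them. *)

(** * Smallness in probability *)

Section pr.
Context {d : measure_display} {Omega : measurableType d} {R : realType}.
Variable P : probability Omega R.

(** The space of random variables with convergence in probability is not locally convex: a bounded
    set may have an unbounded convex hull. Boundedness of [mu] is therefore established
    combinatorially on sets, as in the theorem of Talagrand and of Kalton, Peck and Roberts, and
    only then carried over to simple functions with values in [-1, 1], whose coefficients are seen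
    as means of random signs. The line has infinitely many dyadic cells at each level, so bounded
    integrands do not suffice: the sums over cells need weights growing like 1 + |y|. Integrability
    of |y|^tau supplies them once its indefinite integral is known to be a vector measure. The
    definition of the integral gives convergence set by set only; Nikodym's theorem turns this into
    sigma-additivity. The range of [gamma1] comes from the interpolation: be * th must exceed 1/2,
    the rate is eps^((1 - th) / 2), and th decreasing to 1 / (2 be) yields every exponent below (1 -
    1 / (2 be)) / 2. *)

Definition pr (E : set Omega) : R := fine (P E).

Lemma EFin_pr E : measurable E -> (pr E)%:E = P E.
Proof. by move=> mE; rewrite fineK// fin_num_measure. Qed.

Lemma pr_ge0 E : 0 <= pr E.
Proof. by rewrite /pr fine_ge0. Qed.

Lemma pr_setT : pr setT = 1.
Proof. by rewrite /pr probability_setT. Qed.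

Lemma le_pr A B : measurable A -> measurable B -> A `<=` B -> pr A <= pr B.
Proof.
by move=> mA mB AB; rewrite -lee_fin !EFin_pr// le_measure// ?inE.
Qed.

Lemma pr_le1 E : measurable E -> pr E <= 1.
Proof. by move=> mE; rewrite -pr_setT le_pr. Qed.

Lemma pr_leU A B : measurable A -> measurable B -> pr (A `|` B) <= pr A + pr B.
Proof.
move=> mA mB; rewrite -lee_fin EFinD !EFin_pr//; last exact: measurableU.
exact: measureU2.
Qed.

Lemma pr_leU2 A B C : measurable A -> measurable B -> measurable C ->
  (forall w, A w -> B w \/ C w) -> pr A <= pr B + pr C.
Proof.
move=> mA mB mC h; apply: le_trans (pr_leU mB mC).
by apply: le_pr => //; exact: measurableU.
Qed.

Lemma le_pr_ae A B : measurable A -> measurable B ->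
  {ae P, forall w, A w -> B w} -> pr A <= pr B.
Proof.
move=> mA mB [N [mN N0 h]].
have : pr A <= pr B + pr N.
  apply: pr_leU2 => // w Aw; have [Bw|nBw] := pselect (B w); [by left|right].
  by apply: h => /=; tauto.
by rewrite {3}/pr N0 /= addr0.
Qed.

(** Counting inequalities that hold for almost every w become inequalities between probabilities on
    taking expectations. The weights may be negative, so lower bounds are obtained in the same
    way. *)
Lemma pr_indic_le (I : Type) (r : seq I) (p : I -> R) (E : I -> set Omega)
    (H : set Omega) (k c : R) :
  (forall i, measurable (E i)) -> measurable H ->
  {ae P, forall w, k * \1_H w <= \sum_(i <- r) p i * \1_(E i) w + c} ->
  k * pr H <= \sum_(i <- r) p i * pr (E i) + c.
Proof.
move=> mE mH h.
have iI A : measurable A -> P.-integrable setT (EFin \o (\1_A : Omega -> R)).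
  move=> mA; apply/integrable_indic => //.
have II A : measurable A -> \int[P]_w (\1_A w : R) = pr A.
  by move=> mA; rewrite /Rintegral integral_indic// setIT.
have ic a : P.-integrable setT (EFin \o (cst a : Omega -> R)).
  exact: finite_measure_integrable_cst.
have iZ A a : measurable A -> P.-integrable setT (EFin \o (fun w => a * \1_A w)).
  by move=> mA; apply: (integrableZl _ _ (iI _ mA)).
pose S w : R := \sum_(i <- r) p i * \1_(E i) w.
have [iS IS] : P.-integrable setT (EFin \o S) /\
    \int[P]_w S w = \sum_(i <- r) p i * pr (E i).
  rewrite /S; elim: r {h S} => [|i r [IH1 IH2]].
    rewrite big_nil; split.
      by under eq_fun do rewrite big_nil; exact: (ic 0).
    by under eq_Rintegral do rewrite big_nil; rewrite Rintegral_cst// mul0r.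
  split.
    have -> : EFin \o (fun w => \sum_(j <- i :: r) p j * \1_(E j) w) =
       (EFin \o (fun w => p i * \1_(E i) w)) \+
       (EFin \o (fun w => \sum_(j <- r) p j * \1_(E j) w)).
      by apply/funext => w /=; rewrite big_cons EFinD.
    by apply: integrableD => //; exact: iZ.
  under eq_Rintegral do rewrite big_cons.
  rewrite RintegralD//; last exact: iZ.
  by rewrite IH2 RintegralZl//; [rewrite II// big_cons|exact: iI].
have iSc : P.-integrable setT (EFin \o (fun w => S w + c)).
  have -> : EFin \o (fun w => S w + c) = (EFin \o S) \+ (EFin \o cst c).
    by apply/funext => w /=; rewrite EFinD.
  by apply: integrableD => //; exact: ic.
rewrite -II// -RintegralZl//; last exact: iI.
rewrite -IS -[X in _ <= _ + X](_ : \int[P]_w (cst c w) = _); last first.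
  by rewrite Rintegral_cst//= probability_setT /= mulr1.
rewrite -RintegralD//.
have h0 : {ae P, forall w, 0 <= S w + c - k * \1_H w}.
  by apply: filterS h => w; rewrite subr_ge0.
rewrite -subr_ge0 -RintegralB//; last exact: iZ.
have mD : measurable_fun setT (fun w => S w + c - k * \1_H w).
  apply/measurable_EFinP; apply: measurable_int.
  exact: (integrableB _ iSc (iZ _ _ mH)).
(* The integrand is nonnegative only almost everywhere; its positive part agrees with it there and
   has a nonnegative integral. *)
rewrite /Rintegral.
rewrite (@ae_eq_integral _ _ _ P setT (fun w => (Num.max 0 (S w + c - k * \1_H w))%:E) _)//.
- by apply: fine_ge0; apply: integral_ge0 => w _; rewrite lee_fin le_max lexx.
- exact/measurable_EFinP.
- apply/measurable_EFinP; apply: measurable_maxr => //.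
- by apply: filterS h0 => w w0 _; rewrite /= max_r.
Qed.

Lemma measurable_ge (X : Omega -> R) (a : R) : measurable_fun setT X ->
  measurable [set w | a <= X w].
Proof.
move=> mX; rewrite (_ : [set w | _] = setT `&` X @^-1` `[a, +oo[%classic).
  exact: mX.
by rewrite setTI; apply/seteqP; split => w /=; rewrite in_itv /= andbT.
Qed.

Lemma measurable_norm_ge (X : Omega -> R) (a : R) : measurable_fun setT X ->
  measurable [set w | a <= `|X w|].
Proof. by move=> mX; apply: measurable_ge; exact: measurableT_comp. Qed.

(* A Ky Fan style bound: smallness in probability. *)
Definition small (e : R) (X : Omega -> R) := pr [set w | e <= `|X w|] <= e.

Lemma small_ae e X Y : measurable_fun setT X -> measurable_fun setT Y ->
  {ae P, forall w, X w = Y w} -> small e X -> small e Y.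
Proof.
move=> mX mY h; apply: le_trans; apply: le_pr_ae; [exact: measurable_norm_ge..|].
by apply: filterS h => w /= ->.
Qed.

Lemma smallD e1 e2 X Y : measurable_fun setT X -> measurable_fun setT Y ->
  small e1 X -> small e2 Y -> small (e1 + e2) (fun w => X w + Y w).
Proof.
move=> mX mY h1 h2; apply: le_trans (lerD h1 h2).
apply: pr_leU2; [|exact: measurable_norm_ge..|].
  by apply: measurable_norm_ge; exact: measurable_funD.
move=> w /= h; have [?|h'] := leP e1 `|X w|; [by left|right].
by rewrite -(lerD2l e1); have := ler_normD (X w) (Y w); move: h h'; set a := `|_|; set b := `|_|; set c := `|_|; lra.
Qed.

Lemma smallN e X : small e X -> small e (fun w => - X w).
Proof.
rewrite /small (_ : [set w | e <= `|- X w|] = [set w | e <= `|X w|])//.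
by apply/eq_set => w; rewrite normrN.
Qed.

Lemma smallB e1 e2 X Y : measurable_fun setT X -> measurable_fun setT Y ->
  small e1 X -> small e2 Y -> small (e1 + e2) (fun w => X w - Y w).
Proof.
move=> mX mY h1 h2; apply: smallD => //; first exact: measurableT_comp.
exact: smallN.
Qed.

Lemma small_ae0 X : measurable_fun setT X -> (forall e, 0 < e -> small e X) ->
  {ae P, forall w, X w = 0}.
Proof.
move=> mX h.
have h0 n : {ae P, forall w, `|X w| < n.+1%:R^-1}.
  exists [set w | n.+1%:R^-1 <= `|X w|]; split.
  - exact: measurable_norm_ge.
  - rewrite -EFin_pr; last exact: measurable_norm_ge.
    congr EFin; apply/eqP; rewrite eq_le pr_ge0 andbT; apply/ler_addgt0Pr => e e0.
    rewrite add0r; apply: (@le_trans _ _ (Num.min e n.+1%:R^-1)); last by rewrite ge_min lexx.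
    apply: le_trans (h (Num.min e n.+1%:R^-1) _); last by rewrite lt_min e0 /= invr_gt0 ltr0n.
    by apply: le_pr; [exact: measurable_norm_ge..|] => w /=; apply: le_trans; rewrite ge_min lexx orbT.
  - by move=> w /= /negP; rewrite -leNgt.
have : {ae P, forall w, forall n : nat, `|X w| < n.+1%:R^-1} by apply/ae_foralln.
apply: filterS => w hw; apply/eqP; rewrite -normr_le0; apply/ler_addgt0Pr => e e0.
rewrite add0r; have [n ne] : exists n : nat, n.+1%:R^-1 < e.
  have [n _ hn] := near_infty_natSinv_lt (PosNum e0); by exists n; apply: hn => /=.
exact: ltW (lt_trans (hw n) ne).
Qed.

End pr.

(** * Vector measures with values in random variables *)

(** Dependent choice under an invariant: the step has to be possible only from points of [Q], in
    which the sequence stays. *)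
Lemma dep_choice (X : Type) (Q : X -> Prop) (E : X -> X -> Prop) :
  (forall x, Q x -> exists2 y, Q y & E x y) -> forall x0, Q x0 ->
  exists f : nat -> X, f 0%N = x0 /\ forall n, Q (f n) /\ E (f n) (f n.+1).
Proof.
move=> h x0 Q0.
have [|f [f0 fE]] := @dependent_choice {x | Q x}
    (fun a b => E (sval a) (sval b)) _ (exist _ x0 Q0).
  by move=> [x Qx]; have /cid2[y Qy Exy] := h _ Qx; exists (exist _ y Qy).
exists (sval \o f); split => [|n /=]; first by rewrite /= f0.
by split; [exact: svalP|exact: fE].
Qed.

Definition decr (T : Type) (C : nat -> set T) :=
  (forall i j, (i <= j)%N -> C j `<=` C i) /\ \bigcap_n C n = set0.

Lemma decrI (T : Type) (C : nat -> set T) B : decr C -> decr (fun n => B `&` C n).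
Proof.
move=> [h1 h2]; split => [i j ij x [Bx /(h1 _ _ ij)]//|].
by rewrite -subset0 => x hx; rewrite -h2 => n _; have [] := hx n I.
Qed.

Lemma decr_notin (T : Type) (C : nat -> set T) x : decr C -> exists n, ~ C n x.
Proof.
move=> [_ h]; apply: contrapT => hn; have : (\bigcap_n C n) x.
  by move=> n _; apply: contrapT => nC; apply: hn; exists n.
by rewrite h.
Qed.

Lemma decr_tail (T : Type) (D : nat -> set T) : trivIset setT D ->
  decr (fun i => \bigcup_(k in [set k | (i <= k)%N]) D k).
Proof.
move=> tD; split=> [i j ij x [k /= jk Dk]|]; first by exists k => //=; exact: leq_trans jk.
rewrite -subset0 => x hx; have [k _ Dk] := hx 0%N I.
have [l /= kl Dl] := hx k.+1 I.
have : k = l by apply: (tD k l) => //; exists x.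
by move=> kl'; rewrite kl' ltnn in kl.
Qed.

Section smeas.
Context {d : measure_display} {Omega : measurableType d} {R : realType}.
Variable P : probability Omega R.
Context {dT : measure_display} {T : measurableType dT}.
Implicit Types m : set T -> Omega -> R.

(* An L0-valued measure: finite additivity holds a.s., and sigma-additivity
   is expressed as continuity in probability at the empty set. *)
Definition smeas m := [/\ forall A, measurable A -> measurable_fun setT (m A),
  forall A B, measurable A -> measurable B -> A `&` B = set0 ->
    {ae P, forall w, m (A `|` B) w = m A w + m B w}
  & forall C, (forall n, measurable (C n)) -> decr C ->
    forall e, 0 < e -> exists j0, forall j, (j0 <= j)%N -> small P e (m (C j))].

Section basic.
Variable m : set T -> Omega -> R.
Hypothesis sm : smeas m.

Lemma smeas_meas A : measurable A -> measurable_fun setT (m A).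
Proof. by case: sm => h _ _; exact: h. Qed.

Lemma smeasU A B : measurable A -> measurable B -> A `&` B = set0 ->
  {ae P, forall w, m (A `|` B) w = m A w + m B w}.
Proof. by case: sm => _ h _; exact: h. Qed.

Lemma smeas_cont C e : (forall n, measurable (C n)) -> decr C -> 0 < e ->
  exists j0, forall j, (j0 <= j)%N -> small P e (m (C j)).
Proof. by case: sm => _ _ h mC dC; exact: h. Qed.

Lemma smeas0 : {ae P, forall w, m set0 w = 0}.
Proof.
have := smeasU measurable0 measurable0 (setI0 _); rewrite setU0.
by apply: filterS => w h; apply/eqP; rewrite -(inj_eq (addrI (m set0 w))) addr0 -h.
Qed.

Lemma smeasD A B : measurable A -> measurable B -> B `<=` A ->
  {ae P, forall w, m (A `\` B) w = m A w - m B w}.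
Proof.
move=> mA mB BA; have := smeasU mB (measurableD mA mB) (setDIK _ _).
by rewrite setDUK// => h; apply: filterS h => w ->; rewrite addrC addKr.
Qed.

Lemma smeas_bigsetU (I : choiceType) (r : seq I) (A : I -> set T) :
  uniq r -> (forall i, measurable (A i)) -> trivIset setT A ->
  {ae P, forall w, m (\big[setU/set0]_(i <- r) A i) w = \sum_(i <- r) m (A i) w}.
Proof.
move=> + mA tA; elim: r => [_|i r IH /= /andP[ir ur]].
  by apply: filterS smeas0 => w; rewrite !big_nil.
have := IH ur; have := @smeasU (A i) (\big[setU/set0]_(j <- r) A j) (mA i).
rewrite big_cons => h1 h2.
have {}h1 := h1 (big_ind _ measurable0 (@measurableU _ _) (fun j _ => mA j)).
apply: filterS2 h2 (h1 _) => [w h ->|].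
  by rewrite big_cons h.
rewrite -subset0 => x [Ai]; rewrite -bigcup_seq => -[j /= jr Aj].
have : i = j by apply: (tA i j) => //; exists x.
by move=> ij; rewrite ij jr in ir.
Qed.

(** A finite measurable partition is encoded by a map into a finite type. Its cells are the fibres,
    possibly empty, and pairing two maps gives the common refinement. *)
Definition measurable_fibers (I : finType) (f : T -> I) := forall i, measurable (f @^-1` [set i]).

Lemma measurable_fibers_pred (I : finType) (f : T -> I) (S : pred I) : measurable_fibers f ->
  measurable (f @^-1` [set i | S i]).
Proof.
move=> mf; rewrite (_ : _ @^-1` _ = \big[setU/set0]_(i <- enum S) f @^-1` [set i]).
  by apply: big_ind => //; exact: measurableU.
rewrite -bigcup_seq; apply/seteqP; split => x /=.
  by move=> Sx; exists (f x) => //=; rewrite mem_enum.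
by move=> [i /=]; rewrite mem_enum => iS ->.
Qed.

Lemma smeas_fin (I : finType) (f : T -> I) E (S : pred I) : measurable_fibers f -> measurable E ->
  {ae P, forall w, m (E `&` f @^-1` [set i | S i]) w =
    \sum_(i | S i) m (E `&` f @^-1` [set i]) w}.
Proof.
move=> mf mE.
have h := @smeas_bigsetU I (enum S) (fun i => E `&` f @^-1` [set i]) (enum_uniq _)
  (fun i => measurableI _ _ mE (mf i)).
rewrite (_ : E `&` _ = \big[setU/set0]_(i <- enum S) (E `&` f @^-1` [set i])).
  have {}h := h (_ : trivIset _ _).
  apply: filterS (h _) => [w ->|]; first by rewrite big_enum.
  by move=> i j _ _ [x /= [[_ <-] [_ <-]]].
rewrite -bigcup_seq; apply/seteqP; split => x /=.
  by move=> [Ex Sx]; exists (f x) => //=; rewrite mem_enum.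
by move=> [i /=]; rewrite mem_enum => iS [Ex ->].
Qed.

(** Each [D j] is the difference of two consecutive tails of the union, and the tails decrease to
    the empty set. *)
Lemma smeas_disj D e : (forall n, measurable (D n)) -> trivIset setT D -> 0 < e ->
  exists j0, forall j, (j0 <= j)%N -> small P e (m (D j)).
Proof.
move=> mD tD e0; pose C i := \bigcup_(k in [set k | (i <= k)%N]) D k.
have mC i : measurable (C i) by apply: bigcup_measurable => k _.
have dC : decr C by exact: decr_tail.
have [j0 hj0] := smeas_cont mC dC (divr_gt0 e0 (ltr0n _ 2)).
exists j0 => j jj; rewrite (splitr e).
have CS : C j.+1 `<=` C j by apply: dC.1.
have := smallB (smeas_meas (mC j)) (smeas_meas (mC j.+1)) (hj0 _ jj) (hj0 _ (leqW jj)).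
apply: small_ae; [by apply: measurable_funB; exact: smeas_meas|exact: smeas_meas|].
have := smeasD (mC j) (mC j.+1) CS; apply: filterS => w <-.
congr m; apply/seteqP; split => [x [[k /= jk Dk] nC]|x Dx].
  have [jk'|kj] := ltnP j k; first by exfalso; apply: nC; exists k.
  by have -> : j = k by apply/eqP; rewrite eqn_leq jk kj.
split; first by exists j => /=.
move=> [k /= jk Dk]; have : j = k by apply: (tD j k) => //; exists x.
by move=> e'; rewrite e' ltnn in jk.
Qed.

(** Continuity at the empty set is uniform over subsets. If every [C k] contained a [B] of large
    mass, cutting off the part of [B] in a far [C k'], which is small, would leave a piece of [C k]
    minus [C k'] that is not small at level e / 2. Iterating from k' gives disjoint pieces, against
    [smeas_disj]. *)
Lemma smeas_unif C e : (forall n, measurable (C n)) -> decr C -> 0 < e ->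
  exists j, forall B, measurable B -> B `<=` C j -> small P e (m B).
Proof.
move=> mC dC e0; apply: contrapT => hn.
have {}hn k : exists B, [/\ measurable B, B `<=` C k & ~ small P e (m B)].
  apply: contrapT => hk; apply: hn; exists k => B mB BC; apply: contrapT => ns.
  by apply: hk; exists B.
have step k : exists2 y : nat * set T, [/\ (k < y.1)%N, measurable y.2,
     y.2 `<=` C k `\` C y.1 & ~ small P (e / 2) (m y.2)] & True.
  have [B [mB BC nB]] := hn k.
  have [j0 hj0] := smeas_cont (fun n => measurableI _ _ mB (mC n)) (decrI B dC)
    (divr_gt0 e0 (ltr0n _ 2)).
  exists (maxn j0 k.+1, B `\` C (maxn j0 k.+1)) => //=.
  split; [exact: leq_maxr|exact: measurableD|by move=> x [/BC]|move=> hs].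
  apply: nB; rewrite (splitr e).
  have := smallD _ _ hs (hj0 _ (leq_maxl _ k.+1)).
  have mBC : measurable (B `&` C (maxn j0 k.+1)) by exact: measurableI.
  have mBD : measurable (B `\` C (maxn j0 k.+1)) by exact: measurableD.
  move=> /(_ (smeas_meas mBD) (smeas_meas mBC)).
  apply: small_ae; [by apply: measurable_funD; exact: smeas_meas|exact: smeas_meas|].
  have /(smeasU mBD mBC) : (B `\` C (maxn j0 k.+1)) `&` (B `&` C (maxn j0 k.+1)) = set0.
    by rewrite -subset0 => x [[_ ?] []].
  by rewrite setUC setUIDK; apply: filterS => w ->.
have [y0 hy0 _] := step 0%N.
have [||f [f0 hf]] := @dep_choice (nat * set T)
    (fun y => [/\ measurable y.2 & ~ small P (e / 2) (m y.2)])
    (fun y z => (y.1 < z.1)%N /\ z.2 `<=` C y.1 `\` C z.1) _ y0.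
- by move=> y _; have [z [? ? ? ?] _] := step y.1; exists z.
- by case: hy0.
have lt1 n k : ((f n).1 <= (f (n + k)%N).1)%N.
  elim: k => [|k IH]; first by rewrite addn0.
  by rewrite addnS; apply: leq_trans IH (ltnW _); case: (hf (n + k)%N) => _ [].
have tD : trivIset setT (fun n => (f n.+1).2).
  have key i j x : (i < j)%N -> (f i.+1).2 x -> (f j.+1).2 x -> False.
    move=> ij fi fj; have [_ [_ /(_ _ fi)[_ nC]]] := hf i.
    have [_ [_ /(_ _ fj)[Cj _]]] := hf j; apply: nC.
    by apply: dC.1 Cj; have := lt1 i.+1 (j - i.+1)%N; rewrite subnKC.
  move=> i j _ _ [x /= [fi fj]]; apply/eqP; rewrite eqn_leq; apply/andP; split;
    by rewrite leqNgt; apply/negP => /key; apply; eassumption.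
have mf n : measurable (f n.+1).2 by case: (hf n.+1) => -[].
have [j0 /(_ j0 (leqnn _))] := smeas_disj mf tD (divr_gt0 e0 (ltr0n _ 2)).
by case: (hf j0.+1) => -[].
Qed.

End basic.
End smeas.

(** * Boundedness in probability of the range *)

Section counting.
Variable R : realType.

Lemma row_big (J : finType) (N : nat) (y : J -> R) (t : R) : (#|J| <= N)%N -> 0 < t ->
  t * N.+1%:R <= `|\sum_j y j| -> exists j, t <= `|y j|.
Proof.
move=> JN t0 h; apply: contrapT => hn.
have {}hn j : `|y j| <= t.
  by rewrite leNgt; apply/negP => tj; apply: hn; exists j; exact: ltW.
have : `|\sum_j y j| <= t * N%:R.
  apply: le_trans (ler_norm_sum _ _ _) _.
  apply: le_trans (ler_sum _ (fun j _ => hn j)) _.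
  by rewrite sumr_const cardT -cardE -[leLHS]mulr_natr ler_pM2l// ler_nat.
apply/negP; rewrite -ltNge; apply: lt_le_trans h.
by rewrite ltr_pM2l// ltr_nat.
Qed.

Lemma sum_ge1 (J : finType) (b : pred J) j : b j -> (1 <= \sum_j b j)%N.
Proof. by move=> bj; rewrite (bigD1 j)//= bj. Qed.

(** Rows are old cells, split into at most N new ones. A row with a large sum keeps at least one
    large entry, since N entries below t cannot add up to t * (N + 1). When [b] holds, a row of
    moderate sum has a huge entry; the other entries must nearly cancel it, so a second one is large
    and the count goes up. *)
Lemma count_split (I J : finType) (N : nat) (y : I -> J -> R) (t s : R) (b : bool) :
  (#|J| <= N)%N -> 0 < t ->
  (b -> (forall i, `|\sum_j y i j| < s) /\
        exists i j, s + t * N.+1%:R <= `|y i j|) ->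
  (\sum_i (t * N.+1%:R <= `|\sum_j y i j|)%R + b <= \sum_i \sum_j (t <= `|y i j|)%R)%N.
Proof.
move=> JN t0 hb.
have row i : ((t * N.+1%:R <= `|\sum_j y i j|)%R <= \sum_j (t <= `|y i j|)%R)%N.
  by case: leP => // /(row_big JN t0)[j tj]; exact: (sum_ge1 (j := j)).
case: b hb => [/(_ isT)[hs [i0 [j0 h0]]]|_]; last by rewrite addn0; exact: leq_sum.
rewrite (bigD1 i0)//= [leqRHS](bigD1 i0)//= -addnA [X in (_ + X)%N]addnC addnA.
apply: leq_add; last exact: leq_sum.
apply: (@leq_trans 2); first by rewrite addn1 ltnS leq_b1.
have tN : t <= t * N.+1%:R by apply: ler_peMr; [exact: ltW|rewrite ler1n].
have hs0 := hs i0.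
rewrite (bigD1 j0)//= (_ : t <= `|y i0 j0|) ?addn1; last first.
  apply: le_trans h0; apply: le_trans tN _; rewrite lerDr.
  by apply: le_trans (ltW hs0).
(* The huge entry is replaced by 0, and pigeonhole is applied to what remains of the row. *)
have [j1] : exists j, t <= `|(fun j => if j != j0 then y i0 j else 0) j|.
  apply: (row_big JN t0).
  rewrite -big_mkcond/=.
  have := ler_normD (\sum_j y i0 j) (- (\sum_(j | j != j0) y i0 j)).
  rewrite {1}(bigD1 j0)//= addrK normrN => h.
  rewrite -(lerD2l s); apply: le_trans h0 _; apply: le_trans h _.
  by rewrite lerD2r ltW.
case: ifPn => [j1j0 h1|_]; last by rewrite normr0 leNgt t0.
by rewrite ltnS (bigD1 j1)//= h1.
Qed.

Lemma big_cell (I J : finType) (y : I -> J -> R) (M : R) :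
  (#|J| * #|I|)%:R * M < \sum_j `|\sum_i y i j| -> exists i j, M <= `|y i j|.
Proof.
move=> h; apply: contrapT => hn.
have {}hn i j : `|y i j| <= M.
  by rewrite leNgt; apply/negP => tj; apply: hn; exists i, j; exact: ltW.
move: h; apply/negP; rewrite -leNgt.
apply: (@le_trans _ _ (\sum_(j : J) \sum_(i : I) M)).
  apply: ler_sum => j _; apply: le_trans (ler_norm_sum _ _ _) _; exact: ler_sum.
by rewrite !sumr_const !cardT -!cardE mulr_natl -mulrnA mulnC.
Qed.

(** * Random colourings of the cells of a partition *)

Section colorings.
Variables (I : finType) (J : nat).
Hypothesis J0 : (0 < J)%N.
(** A uniform random colouring, probabilities being replaced by cardinals. Colour [ord0] is rare,
    with frequency 1 / (J + 1), and marks the cells to be taken out; the boolean is a fair coin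
    deciding which of these form the set of large mass. *)
Let colr := {ffun I -> 'I_J.+1 * bool}.

Lemma card_family_prod (T : finType) (F : I -> pred T) :
  #|family F| = (\prod_i #|F i|)%N.
Proof. by rewrite card_family foldrE big_map /index_enum -enumT. Qed.

Lemma card_colr : #|colr| = (\prod_(i : I) (J.+1 * 2))%N.
Proof.
by rewrite card_ffun card_prod card_ord card_bool prod_nat_const.
Qed.

(** This measures the loss: a given cell is taken out by one colouring in J + 1. *)
Lemma color_at i : (\sum_(x : colr) ((x i).1 == ord0) * J.+1 = #|colr|)%N.
Proof.
pose F k := [pred p : 'I_J.+1 * bool | (k == i) ==> (p.1 == ord0)].
rewrite -big_distrl/=.
have -> : (\sum_(x : colr) ((x i).1 == ord0) = #|family F|)%N.
  rewrite -sum1_card [RHS]big_mkcond/=; apply: eq_bigr => x _.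
  rewrite (_ : (x \in family F) = ((x i).1 == ord0)); first by case: eqP.
  apply/familyP/eqP => [/(_ i)|xi k]; first by rewrite inE /= eqxx => /eqP.
  by rewrite inE /=; apply/implyP => /eqP ->; exact/eqP.
rewrite card_family_prod card_colr (bigD1 i)//= [RHS](bigD1 i)//= mulnAC.
congr muln; last first.
  apply: eq_bigr => k ki; rewrite (_ : #|_| = #|{: 'I_J.+1 * bool}|).
    by rewrite card_prod card_ord card_bool.
  by apply: eq_card => p; rewrite !inE (negbTE ki).
rewrite mulnC; congr muln.
rewrite (_ : #|F i| = #|finset.setX [set (ord0 : 'I_J.+1)]%SET [set: bool]%SET|).
  by rewrite cardsX cards1 cardsT card_bool.
by apply: eq_card => p; rewrite !inE /= eqxx andbT.
Qed.

(** Bernoulli's inequality (1 + 1/J)^z >= 1 + z/J >= 2, cleared of denominators. *)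
Lemma bernoulli_expn z : (J <= z)%N -> (2 * J ^ z <= J.+1 ^ z)%N.
Proof.
move=> Jz; have h : (J ^ z * (J + z) <= J.+1 ^ z * J)%N.
  elim: z {Jz} => [|z IH]; first by rewrite !mul1n addn0.
  rewrite !expnS -!mulnA; apply: leq_trans (leq_mul (leqnn _) IH).
  by rewrite mulnCA [leqRHS]mulnCA leq_mul2l; nia.
rewrite -(leq_pmul2r J0); apply: leq_trans h.
by rewrite [(2 * _)%N]mulnC -mulnA leq_mul2l mul2n -addnn leq_add2l Jz orbT.
Qed.

(** Among J large entries one has colour [ord0] for at least half of the colourings. Flipping the
    coin of the first such entry is an involution that changes the sum by at least 1, so the sum is
    at least 1/2 in modulus before or after the flip; this leaves a quarter. *)
Lemma color_hit (x : I -> R) : (J <= \sum_i (1 <= `|x i|)%R)%N ->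
  (#|colr| <= 4 * \sum_(c : colr) (1 / 2 <= `|\sum_(i | c i == (ord0, true)) x i|)%R)%N.
Proof.
move=> hJ.
pose Z i := 1 <= `|x i|.
pose good (c : colr) := 1 / 2 <= `|\sum_(i | c i == (ord0, true)) x i|.
pose pk (c : colr) := [pick i | Z i && ((c i).1 == ord0)].
pose hit (c : colr) := [exists i, Z i && ((c i).1 == ord0)].
pose fl (c : colr) : colr := [ffun i => if pk c == Some i then ((c i).1, ~~ (c i).2) else c i].
have fl1 c i : ((fl c) i).1 = (c i).1 by rewrite ffunE; case: ifP.
have pkfl c : pk (fl c) = pk c by apply: eq_pick => i; rewrite fl1.
have flK : involutive fl.
  move=> c; apply/ffunP => i; rewrite ffunE pkfl ffunE.
  by case: (pk c == Some i) => //=; rewrite negbK; case: (c i).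
have gd c : (hit c <= good c + good (fl c))%N.
  case hc : (hit c) => //=.
  have [i0 pki0] : exists i0, pk c = Some i0.
    rewrite /pk; case: pickP => [i0 _|h]; first by exists i0.
    by move/existsP: hc => [i]; rewrite h.
  have /andP[Zi0 ci0] : Z i0 && ((c i0).1 == ord0).
    by move: pki0; rewrite /pk; case: pickP => // i hi [<-].
  have E (b : colr) : \sum_(i | b i == (ord0, true)) x i =
     (if (b i0).2 && ((b i0).1 == ord0) then x i0 else 0) +
       \sum_(i | (i != i0) && (b i == (ord0, true))) x i.
    rewrite [LHS]big_mkcond (bigD1 i0)//= [in RHS]big_mkcondr/=; congr (_ + _).
    by case: (b i0) => p q; rewrite xpair_eqE eqb_id andbC.
  have E2 : \sum_(i | (i != i0) && ((fl c) i == (ord0, true))) x i =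
            \sum_(i | (i != i0) && (c i == (ord0, true))) x i.
    apply: eq_bigl => i; rewrite ffunE pki0; case: (eqVneq i i0) => //= ii.
    by rewrite (_ : Some i0 == Some i = false)//; apply/negbTE; apply: contra ii => /eqP[->].
  rewrite /good (E c) (E (fl c)) E2 fl1 ci0 !andbT.
  rewrite (_ : (fl c i0).2 = ~~ (c i0).2); last by rewrite ffunE pki0 eqxx.
  move: Zi0; rewrite /Z; set s := \sum_(_ | _) _.
  have key : 1 <= `|x i0| -> (0 < (1 / 2 <= `|x i0 + s|)%R + (1 / 2 <= `|s|)%R)%N.
    move=> x1; case: leP => // h1; case: leP => // h2.
    have := ler_normB (x i0 + s) s; rewrite addrK => h3.
    have : `|x i0 + s| + `|s| < 1 / 2 + 1 / 2 by exact: ltrD.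
    by rewrite -splitr => /(le_lt_trans h3); rewrite ltNge x1.
  by case: (c i0).2 => /key; rewrite /= add0r // addnC.
have -> : (4 * \sum_(c : colr) good c = 2 * \sum_(c : colr) (good c + good (fl c)))%N.
  rewrite big_split/= [X in (_ + X)%N](_ : _ = \sum_c good c)%N; first by rewrite addnn -mul2n mulnA.
  by rewrite [RHS](reindex_inj (inv_inj flK)).
apply: (@leq_trans (2 * \sum_(c : colr) hit c)%N); last first.
  by rewrite leq_mul2l; apply/orP; right; exact: leq_sum.
pose F i := [pred p : 'I_J.+1 * bool | Z i ==> (p.1 != ord0)].
have hm : (\sum_(c : colr) hit c + #|family F| = #|colr|)%N.
  rewrite -[#|colr|]sum1_card -sum1_card [X in (_ + X)%N]big_mkcond -big_split/=.
  apply: eq_bigr => c _; rewrite (_ : (c \in family F) = ~~ hit c); first by case: (hit c).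
  apply/familyP/idP => [h|]; first apply/existsPn => i.
    by have := h i; rewrite inE /= negb_and; case: (Z i).
  by move/existsPn => h i; have := h i; rewrite inE /= negb_and; case: (Z i).
(* The colourings without any hit avoid colour [ord0] at all large entries; by [bernoulli_expn] they
   are at most half of all. *)
have mF : (2 * #|family F| <= #|colr|)%N.
  rewrite card_family_prod card_colr (bigID Z)/= [X in (_ <= X)%N](bigID Z)/= mulnA.
  apply: leq_mul; last first.
    apply: leq_prod => i nZ; apply: leq_trans (max_card _) _.
    by rewrite card_prod card_ord card_bool.
  rewrite (eq_bigr (fun=> (J * 2)%N)); last first.
    move=> i Zi; rewrite (_ : #|F i| = #|finset.setX [set~ (ord0 : 'I_J.+1)]%SET [set: bool]%SET|).
      by rewrite cardsX cardsC1 card_ord cardsT card_bool.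
    by apply: eq_card => p; rewrite !inE /= Zi andbT.
  rewrite !prod_nat_const !expnMn mulnA leq_mul2r; apply/orP; right; apply: bernoulli_expn.
  apply: leq_trans hJ _; rewrite -sum1_card [leqRHS]big_mkcond/=.
  by apply: leq_sum => i _; rewrite [X in (_ <= (if X then _ else _))%N](_ : _ = (1 <= `|x i|)%R)//; case: (1 <= `|x i|).
by move: hm mF; set a := \sum_c _; set b := #|family F|; set c := #|colr|; lia.
Qed.

End colorings.
End counting.

Section boundedness.
Context {d : measure_display} {Omega : measurableType d} {R : realType}.
Variable P : probability Omega R.
Context {dT : measure_display} {T : measurableType dT}.
Variable m : set T -> Omega -> R.
Hypothesis sm : smeas P m.

Lemma measurable_lt (X : Omega -> R) (a : R) : measurable_fun setT X ->
  measurable [set w | X w < a].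
Proof.
move=> mX; rewrite (_ : [set w | _] = ~` [set w | a <= X w]).
  exact: measurableC (measurable_ge _ mX).
by apply/seteqP; split => w /=; rewrite ltNge => /negP.
Qed.

Lemma pr_tail (X : Omega -> R) (k : R) : measurable_fun setT X -> 0 < k ->
  exists2 s, 0 < s & pr P [set w | s <= `|X w|] <= k.
Proof.
move=> mX k0; pose F n := [set w | n%:R <= `|X w|].
have mF n : measurable (F n) by exact: measurable_norm_ge.
have F0 : \bigcap_n F n = set0.
  rewrite -subset0 => w /(_ (Num.truncn `|X w|).+1 I) /=; rewrite /F /= leNgt => /negP; apply.
  exact: truncnS_gt.
have : (P \o F) n @[n --> \oo] --> P (\bigcap_n F n).
  apply: nonincreasing_cvg_mu => //.
  - by rewrite -ge0_fin_numE// fin_num_measure.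
  - by rewrite F0.
  - move=> i j ij; apply/subsetPset => w /=; apply: le_trans.
    by rewrite ler_nat.
rewrite F0 measure0 => /fine_cvgP[_ /cvgr_lt /(_ k k0)] [N _ hN].
exists N.+1%:R => //; apply: ltW; exact: (hN N.+1 (leqnSn N)).
Qed.

Definition partition_variation (I : finType) (f : T -> I) (E : set T) w :=
  \sum_i `|m (E `&` f @^-1` [set i]) w|.

Lemma measurable_partition_variation (I : finType) (f : T -> I) E : measurable E -> measurable_fibers f ->
  measurable_fun setT (partition_variation f E).
Proof.
move=> mE mf; apply: measurable_sum => i; apply: measurableT_comp => //.
by apply: (smeas_meas sm); exact: measurableI.
Qed.

(* Partitions of E of bounded cardinality have, with probability at least de,
   a variation exceeding any prescribed level. *)
Definition unbounded_variation (E : set T) (de : R) := exists N, forall a, exists (I : finType) (f : T -> I),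
  [/\ measurable_fibers f, (#|I| <= N)%N & de <= pr P [set w | a <= partition_variation f E w]].

(** A natural number, so that it can be added to the counts of large cells. *)
Definition nat_indic (A : set Omega) w : nat := `[< A w >].

Lemma nat_indicE (A : set Omega) w : (nat_indic A w)%:R = \1_A w :> R.
Proof. by rewrite indicE /nat_indic; case: asboolP => h; [rewrite mem_set|rewrite memNset]. Qed.

Lemma measurable_fibers_pair (I J : finType) (f : T -> I) (g : T -> J) : measurable_fibers f -> measurable_fibers g ->
  measurable_fibers (fun x => (f x, g x)).
Proof.
move=> mf mg [i j]; rewrite (_ : _ @^-1` _ = f @^-1` [set i] `&` g @^-1` [set j]).
  exact: measurableI.
by apply/seteqP; split => x /= [-> ->].
Qed.

Lemma smeas_row (I J : finType) (f : T -> I) (g : T -> J) E : measurable_fibers f -> measurable_fibers g ->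
  measurable E -> {ae P, forall w, forall i, m (E `&` f @^-1` [set i]) w =
    \sum_j m (E `&` (fun x => (f x, g x)) @^-1` [set (i, j)]) w}.
Proof.
move=> mf mg mE; apply: filter_forall => i.
have := @smeas_fin _ _ _ _ _ _ _ sm _ g _ predT mg (measurableI _ _ mE (mf i)).
apply: filterS => w.
rewrite (_ : _ `&` g @^-1` _ = E `&` f @^-1` [set i]); last first.
  by apply/seteqP; split => x //= [].
move=> ->; apply: eq_bigr => j _; congr (m _ w).
by rewrite -setIA; congr (_ `&` _); apply/seteqP; split => x /= [-> ->].
Qed.

Lemma smeas_col (I J : finType) (f : T -> I) (g : T -> J) E : measurable_fibers f -> measurable_fibers g ->
  measurable E -> {ae P, forall w, forall j, m (E `&` g @^-1` [set j]) w =
    \sum_i m (E `&` (fun x => (f x, g x)) @^-1` [set (i, j)]) w}.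
Proof.
move=> mf mg mE; apply: filterS (smeas_row mg mf mE) => w h j.
rewrite h; apply: eq_bigr => i _; congr (m (_ `&` _) w).
by apply/seteqP; split => x /= [-> ->].
Qed.

(* In a partition of huge variation into few cells some old cell, whose mass is
   moderate, must contain two new cells of large mass. *)
Lemma big_atoms E de N : measurable E ->
  (forall a, exists (I : finType) (f : T -> I),
    [/\ measurable_fibers f, (#|I| <= N)%N & de <= pr P [set w | a <= partition_variation f E w]]) ->
  forall (k : nat) (t ka : R), 0 < t -> 0 < ka ->
  exists (I : finType) (f : T -> I) (F : nat -> set Omega),
    [/\ measurable_fibers f, forall l, measurable (F l), forall l, (l < k)%N -> de - ka <= pr P (F l) &
     {ae P, forall w, (\sum_(l < k) nat_indic (F l) w <=
        \sum_i (t <= `|m (E `&` f @^-1` [set i]) w|)%R)%N}].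
Proof.
move=> mE hN; elim => [|k IH] t ka t0 ka0.
  exists unit, (fun=> tt), (fun=> set0); split => //.
  - move=> i; rewrite (_ : _ @^-1` _ = setT)//.
    by apply/seteqP; split => x //= _; case: i.
  - by apply: filterE => w; rewrite big_ord0.
have tN0 : 0 < t * N.+1%:R by rewrite mulr_gt0.
(* The next splitting lowers the guaranteed mass of a large cell by the factor N + 1, so the
   induction starts from a threshold that much higher. *)
have [I [f [F [mf mF prF cnt]]]] := IH (t * N.+1%:R) ka tN0 ka0.
have mV := measurable_partition_variation mE mf.
have [s s0 hs] := pr_tail mV ka0.
(* The common refinement has at most N * #|I| cells, so at this level of variation one of them has
   mass at least s + t * (N + 1); the summand 1 makes the inequality of [big_cell] strict. *)
have [J [g [mg JN prg]]] := hN (1 + (N * #|I|)%:R * (s + t * N.+1%:R)).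
pose a := 1 + (N * #|I|)%:R * (s + t * N.+1%:R).
pose G := [set w | a <= partition_variation g E w] `&` [set w | partition_variation f E w < s].
have mG : measurable G.
  by apply: measurableI; [apply: measurable_ge; exact: measurable_partition_variation|exact: measurable_lt].
exists (I * J)%type, (fun x => (f x, g x)), (fun l => if l == k then G else F l); split.
- exact: measurable_fibers_pair.
- by move=> l; case: ifP.
- move=> l; rewrite ltnS leq_eqVlt; case: eqP => [_ _|_ /= /prF//].
  rewrite lerBlDr; apply: le_trans prg _; apply: (le_trans _ (lerD (lexx _) hs)).
  apply: pr_leU2 => //; [|exact: measurable_norm_ge|].
    by apply: measurable_ge; exact: measurable_partition_variation.
  move=> w /= aw; have [?|sw] := ltP (partition_variation f E w) s; [by left|right].
  by rewrite ger0_norm// /partition_variation sumr_ge0.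
apply: filterS3 cnt (smeas_row mf mg mE) (smeas_col mf mg mE) => w c hr hc.
rewrite big_ord_recr/= eqxx.
rewrite (eq_bigr (fun l : 'I_k => nat_indic (F l) w)); last first.
  by move=> l _; rewrite ltn_eqF.
pose y i j := m (E `&` (fun x => (f x, g x)) @^-1` [set (i, j)]) w.
rewrite [leqRHS](_ : _ = \sum_i \sum_j (t <= `|y i j|)%R)%N; last first.
  by rewrite pair_bigA; apply: eq_bigr => -[i j] _.
have {}c : (\sum_(l < k) nat_indic (F l) w <=
   \sum_i (t * N.+1%:R <= `|\sum_j y i j|)%R)%N.
  apply: leq_trans c _; apply: leq_sum => i _; by rewrite -hr.
apply: leq_trans (leq_add c (leqnn _)) _.
apply: (count_split (N := N) (s := s)) => //.
move=> /asboolP[/= aw sw]; split.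
  move=> i; rewrite -hr; apply: le_lt_trans sw; rewrite /partition_variation (bigD1 i)//= lerDl.
  exact: sumr_ge0.
apply: big_cell; rewrite (eq_bigr (fun j => `|m (E `&` g @^-1` [set j]) w|)); last first.
  by move=> j _; rewrite -hc.
apply: lt_le_trans aw; rewrite /a -[ltLHS]add0r; apply: ltr_leD => //.
apply: ler_wpM2r; last by rewrite ler_nat leq_mul2r JN orbT.
by rewrite addr_ge0 ?ltW.
Qed.

(** A reverse Markov inequality: K events of probability at least de / 2 have expected count at
    least K * de / 2, and the count never exceeds K, so it reaches K * de / 4 >= J with probability
    at least de / 4. *)
Lemma big_atoms_event E de : measurable E -> 0 < de -> unbounded_variation E de -> forall J : nat,
  exists (I : finType) (f : T -> I) (H : set Omega),
   [/\ measurable_fibers f, measurable H, de / 4 <= pr P H &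
   {ae P, forall w, H w -> (J <= \sum_i (1 <= `|m (E `&` f @^-1` [set i]) w|)%R)%N}].
Proof.
move=> mE de0 [N hN] J.
pose K := (Num.truncn (J%:R * 4 / de)).+1.
have KJ : J%:R <= K%:R * de / 4.
  rewrite ler_pdivlMr// -ler_pdivrMr//; apply: ltW; exact: truncnS_gt.
have [I [f [F [mf mF prF cnt]]]] := big_atoms mE hN K ltr01 (divr_gt0 de0 (ltr0n _ 2)).
pose S w : R := \sum_(l < K) \1_(F l) w.
pose H := [set w | K%:R * de / 4 <= S w].
have mS : measurable_fun setT S.
  by apply: measurable_sum => l; exact: measurable_indic.
have mH : measurable H by exact: measurable_ge.
exists I, f, H; split => //.
  have := @pr_indic_le _ _ _ P _ (index_enum 'I_K) (fun=> -1) (F \o val) H (- K%:R)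
    (K%:R * de / 4) (fun l => mF _) mH.
  have -> : \sum_(l < K) -1 * pr P ((F \o val) l) = - \sum_(l < K) pr P (F l).
    by rewrite -sumrN; apply: eq_bigr => l _; rewrite mulN1r.
  have K0 : 0 < K%:R :> R by rewrite ltr0n.
  have lb : K%:R * (de / 2) <= \sum_(l < K) pr P (F l).
    rewrite mulr_natl -[X in _ *+ X]card_ord -sumr_const; apply: ler_sum => l _.
    by have := prF l (ltn_ord l); rewrite {1}(splitr de) addrK.
  have K4 : K%:R * de / 4 = K%:R * (de / 4) by rewrite mulrA.
  have K2 : K%:R * (de / 2) = K%:R * (de / 4) + K%:R * (de / 4) by field.
  move=> h; rewrite -(ler_pM2l K0); rewrite K4 in h; rewrite K2 in lb.
  have {}h : - K%:R * pr P H <= - \sum_(l < K) pr P (F l) + K%:R * (de / 4).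
    apply: h; apply: filterE => w.
    have -> : \sum_(l < K) -1 * \1_((F \o val) l) w = - S w.
      by rewrite -sumrN; apply: eq_bigr => l _; rewrite mulN1r.
    rewrite indicE; case: (boolP (w \in H)) => [_|].
      rewrite mulr1 -[leLHS]addr0; apply: lerD.
        rewrite lerN2 /S; apply: (@le_trans _ _ (\sum_(l < K) 1)).
          by apply: ler_sum => l _; rewrite indicE lern1 leq_b1.
        by rewrite sumr_const card_ord.
      by rewrite mulr_ge0// divr_ge0// ltW.
    rewrite notin_setE /H /= => /negP; rewrite -ltNge K4 mulr0 => /ltW.
    by rewrite -subr_ge0 addrC.
  lra.
apply: filterS cnt => w cnt Hw; apply: leq_trans cnt.
rewrite -(ler_nat R); apply: le_trans KJ _; rewrite natr_sum.
by under eq_bigr do rewrite nat_indicE.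
Qed.

(** Colour a partition having many large cells. The cells coloured [(ord0, true)] form [D], those of
    another first colour form [E']. A positive fraction of colourings gives [D] large mass, while
    colour [ord0] is too rare to destroy the variation of [E']. The bound for [D] refers to [de0],
    not to [de], so it does not deteriorate under iteration. *)
Lemma unbounded_variation_split E de0 de eta : measurable E -> 0 < de0 -> de0 <= de -> 0 < eta -> unbounded_variation E de ->
  exists E' D, [/\ measurable E', measurable D, E' `<=` E /\ D `<=` E `\` E',
    de0 / 32 <= pr P [set w | 1 / 2 <= `|m D w|] & unbounded_variation E' (de - eta)].
Proof.
move=> mE d00 dd eta0 uE.
pose c0 := de0 / 32; have c00 : 0 < c0 by rewrite divr_gt0.
(* A cell is lost with frequency 1 / (J + 1), which is then at most eta * c0: even within a fraction
   c0 of all colourings, some colouring fails with probability at most eta. *)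
pose J := (Num.truncn ((eta * c0)^-1)).+1.
have hJ : J%:R^-1 <= eta * c0.
  rewrite invf_ple ?posrE ?ltr0n ?mulr_gt0//; apply: ltW; exact: truncnS_gt.
have [I [f [H [mf mH prH cnt]]]] := big_atoms_event mE (lt_le_trans d00 dd) uE J.
pose colr := {ffun I -> 'I_J.+1 * bool}.
pose tot : R := #|colr|%:R.
have tot0 : 0 < tot.
  by rewrite ltr0n card_colr; apply: prodn_gt0 => i; rewrite muln_gt0.
pose D (c : colr) := E `&` f @^-1` [set i | c i == (ord0, true)].
pose E' (c : colr) := E `&` f @^-1` [set i | (c i).1 != ord0].
have mD c : measurable (D c).
  by apply: measurableI => //; exact: (measurable_fibers_pred (fun i => c i == (ord0, true))).
have mE' c : measurable (E' c).
  by apply: measurableI => //; exact: (measurable_fibers_pred (fun i => (c i).1 != ord0)).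
pose good c := [set w | 1 / 2 <= `|m (D c) w|].
have mgood c : measurable (good c) by apply: measurable_norm_ge; exact: (smeas_meas sm).
pose X := [set c | c0 <= pr P (good c)]%SET.
(* A quarter of the colourings is good on an event of probability at least de0 / 4, so the average
   of [pr P (good c)] is at least 2 * c0. Probabilities being at most 1, a proportion c0 of the
   colourings must reach c0. *)
have cX : tot * c0 <= #|X|%:R.
  have h1 : tot * (de0 / 16) <= \sum_c pr P (good c).
    have := @pr_indic_le _ _ _ P _ (index_enum colr) (fun=> 4) good H tot 0 mgood mH.
    rewrite addr0 => h; have {}h : tot * pr P H <= 4 * \sum_c pr P (good c).
      rewrite mulr_sumr; apply: h.
      have h2 : {ae P, forall w, forall c : colr, m (D c) w =
          \sum_(i | c i == (ord0, true)) m (E `&` f @^-1` [set i]) w}.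
        apply: filter_forall => c.
        exact: (smeas_fin sm (fun i => c i == (ord0, true)) mf mE).
      apply: filterS2 cnt h2 => w cw hD.
      rewrite addr0 indicE; case: (boolP (w \in H)); last first.
        by rewrite mulr0 => _; apply: sumr_ge0 => c _; rewrite mulr_ge0.
      rewrite inE mulr1 => /cw/(color_hit (ltn0Sn _)).
      rewrite -(ler_nat R) natrM natr_sum => /le_trans; apply.
      rewrite mulr_sumr; apply: ler_sum => c _; rewrite ler_pM2l// indicE ler_nat.
      rewrite -hD -/(D c); case: (boolP (_ <= _)) => // hh.
      by rewrite mem_set.
    rewrite -(ler_pM2l (ltr0n R 4)); apply: le_trans h.
    have -> : 4 * (tot * (de0 / 16)) = tot * (de0 / 4) by field.
    by rewrite ler_pM2l//; apply: le_trans prH; rewrite ler_pM2r.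
  have h2 : \sum_c pr P (good c) <= #|X|%:R + tot * c0.
    have -> : #|X|%:R + tot * c0 = \sum_c ((c \in X)%:R + c0).
      rewrite big_split/= sumr_const /tot mulr_natl; congr (_ + _).
      by rewrite -sum1_card natr_sum big_mkcond; apply: eq_bigr => c _; case: (c \in X).
    apply: ler_sum => c _; rewrite inE; case: (leP c0) => h; last by rewrite add0r ltW.
    by apply: le_trans (pr_le1 _ (mgood c)) _; rewrite lerDl ltW.
  have := le_trans h1 h2; rewrite (_ : tot * (de0 / 16) = tot * c0 + tot * c0).
    by rewrite lerD2r.
  by rewrite /c0; field.
have X0 : 0 < #|X|%:R :> R by apply: lt_le_trans cX; exact: mulr_gt0.
case: uE => N hN.
have key (a : R) : 0 <= a -> exists c, [/\ c \in X &
   exists (I' : finType) (g : T -> I'), [/\ measurable_fibers g, (#|I'| <= #|I| * N)%N &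
      de - eta <= pr P [set w | a <= partition_variation g (E' c) w]]].
  move=> a0; have [I' [g [mg I'N prg]]] := hN (1 + a * #|I|%:R).
  pose fg x := (f x, g x).
  have mfg : measurable_fibers fg by exact: measurable_fibers_pair.
  pose big := [set w | 1 + a * #|I|%:R <= partition_variation g E w].
  have mbig : measurable big by apply: measurable_ge; exact: measurable_partition_variation.
  pose fail c := big `&` [set w | partition_variation fg (E' c) w < a].
  have mfail c : measurable (fail c).
    by apply: measurableI => //; apply: measurable_lt; exact: measurable_partition_variation.
  have h1 : \sum_c pr P (fail c) <= tot / J.+1%:R.
    have := @pr_indic_le _ _ _ P _ (index_enum colr) (fun=> -1) fail set0 0
      (tot / J.+1%:R) mfail measurable0.
    rewrite mul0r -mulr_sumr mulN1r addrC subr_ge0; apply.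
    apply: filterS2 (smeas_row mf mg mE) (smeas_col mf mg mE) => w hr hc.
    rewrite mul0r -mulr_sumr mulN1r addrC subr_ge0.
    have [bw|nb] := pselect (big w); last first.
      rewrite big1; first by rewrite divr_ge0// ltW.
      by move=> c _; rewrite indicE memNset// => -[].
    pose y i j := m (E `&` fg @^-1` [set (i, j)]) w.
    (* By pigeonhole one cell of [f] carries variation a. Hence [E'] can have less than a only if
       that very cell has colour [ord0]. *)
    have [i0 hi0] : exists i0, a <= \sum_j `|y i0 j|.
      apply: contrapT => hn; move: bw; rewrite /big /=; apply/negP; rewrite -ltNge.
      apply: (@le_lt_trans _ _ (\sum_j \sum_i `|y i j|)).
        by apply: ler_sum => j _; rewrite hc; exact: ler_norm_sum.
      rewrite exchange_big/= -[ltLHS]add0r ltr_leD//.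
      rewrite mulr_natr -sumr_const; apply: ler_sum => i _.
      by rewrite leNgt; apply/negP => hh; apply: hn; exists i; exact: ltW.
    have hf c : \1_(fail c) w <= ((c i0).1 == ord0)%:R :> R.
      rewrite indicE; case: eqP => [_|/eqP ci]; first by rewrite lern1 leq_b1.
      rewrite memNset//= => -[_ /=]; rewrite ltNge => /negP; apply.
      apply: le_trans hi0 _; rewrite (_ : partition_variation fg (E' c) w = \sum_i \sum_j `|m (E' c `&` fg @^-1` [set (i, j)]) w|); last first.
        by rewrite pair_bigA; apply: eq_bigr => -[i j] _.
      rewrite (bigD1 i0)//= -[leLHS]addr0 lerD//; last first.
        by apply: sumr_ge0 => i _; apply: sumr_ge0.
      rewrite le_eqVlt; apply/orP; left; apply/eqP; apply: eq_bigr => j _.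
      congr (`| m _ w|); rewrite /E' -setIA; congr (_ `&` _).
      apply/seteqP; split => x /= => [fgx|[]//]; split => //.
      by case: fgx => -> _.
    apply: le_trans (ler_sum _ (fun c _ => hf c)) _.
    rewrite ler_pdivlMr ?ltr0n// -natr_sum -natrM ler_nat.
    by rewrite big_distrl/= color_at.
  have [c cX' hc] : exists2 c, c \in X & pr P (fail c) <= eta.
    apply: contrapT => hn.
    have : \sum_(c in X) eta < tot / J.+1%:R.
      apply: (@lt_le_trans _ _ (\sum_(c in X) pr P (fail c))).
        have /card_gt0P[c1 c1X] : (0 < #|X|)%N by rewrite -(ltr_nat R).
        apply: (ltr_sum (r := index_enum _)).
          by apply/hasP; exists c1 => //; rewrite mem_index_enum.
        by move=> c cx; rewrite ltNge; apply/negP => hh; apply: hn; exists c.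
      apply: le_trans h1; rewrite [leRHS](bigID (mem X))/= lerDl.
      by apply: sumr_ge0 => c _; exact: pr_ge0.
    rewrite sumr_const -[ltLHS]mulr_natl => h2.
    have h3 : #|X|%:R * eta < tot * (eta * c0).
      apply: lt_le_trans h2 _; rewrite ler_pM2l//; apply: le_trans hJ.
      by rewrite lef_pV2 ?posrE ?ltr0n// ler_nat.
    have : tot * c0 * eta <= #|X|%:R * eta by rewrite ler_pM2r.
    rewrite mulrAC -mulrA => /le_lt_trans/(_ h3).
    by rewrite mulrCA mulrA mulrAC -mulrA ltxx.
  exists c; split => //; exists (I * I')%type, fg; split => //.
    by rewrite card_prod leq_mul2l I'N orbT.
  rewrite lerBlDr; apply: le_trans prg _; apply: (le_trans _ (lerD (lexx _) hc)).
  apply: pr_leU2 => //; first by apply: measurable_ge; exact: measurable_partition_variation.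
  by move=> w bw; have [?|?] := leP a (partition_variation fg (E' c) w); [left|right].
(* The colouring given by [key] depends on the level. There are finitely many colourings, so one
   serves all levels: otherwise each would fail at a level of its own, and the sum of these levels
   would contradict [key]. *)
have [c cX'] : exists2 c, c \in X & unbounded_variation (E' c) (de - eta).
  apply: contrapT => hn.
  have {}hn c : exists a : R, c \in X -> ~ exists (I' : finType) (g : T -> I'),
     [/\ measurable_fibers g, (#|I'| <= #|I| * N)%N & de - eta <= pr P [set w | a <= partition_variation g (E' c) w]].
    apply: contrapT => h; apply: hn; exists c.
      by apply: contrapT => nc; apply: h; exists 0.
    exists (#|I| * N)%N => a; apply: contrapT => na; apply: h; exists a => _; exact: na.
  have [A hA] := boolp.choice hn.
  pose a := \sum_c `|A c|.
  have [|c [cX'' [I' [g [mg cI' h]]]]] := key a; first exact: sumr_ge0.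
  apply: (hA c cX''); exists I', g; split => //; apply: le_trans h _.
  apply: le_pr; [by apply: measurable_ge; exact: measurable_partition_variation..|].
  move=> w /=; apply: le_trans; apply: le_trans (ler_norm _) _.
  by rewrite /a (bigD1 c)//= lerDl sumr_ge0.
move=> uc; exists (E' c), (D c); split => //.
- split; first by move=> x [].
  move=> x [Ex /= /eqP hx]; split => // -[_ /=].
  by rewrite hx.
- by move: cX'; rewrite inE.
Qed.

(** The theorem of Talagrand and of Kalton, Peck and Roberts. If it failed, the partitions into [A]
    and its complement would give the whole space unbounded variation. Splitting again and again
    produces disjoint sets [D n] whose masses are not small, against [smeas_disj]. *)
Theorem smeas_bounded (e : R) : 0 < e -> exists2 a : R, 0 < a & forall A, measurable A ->
  pr P [set w | a <= `|m A w|] <= e.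
Proof.
move=> e0; apply: contrapT => hn.
have u0 : unbounded_variation setT e.
  exists 2%N => a; apply: contrapT => h; apply: hn.
  exists (Num.max a 1); first by rewrite lt_max ltr01 orbT.
  move=> A mA; rewrite leNgt; apply/negP => hA; apply: h.
  exists bool, (fun x => `[< A x >]); split.
  - have tA : (fun x => `[< A x >]) @^-1` [set true] = A.
      by apply/seteqP; split => x /= /asboolP.
    case; first by rewrite tA.
    rewrite (_ : _ @^-1` _ = ~` A); first exact: measurableC.
    by rewrite -{2}tA; apply/seteqP; split => x /=; case: asboolP.
  - by rewrite card_bool.
  - apply: le_trans (ltW hA) _; apply: le_pr_ae.
    + by apply: measurable_norm_ge; exact: (smeas_meas sm).
    + apply: measurable_ge; apply: measurable_sum => b; apply: measurableT_comp => //.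
      apply: (smeas_meas sm); rewrite setTI; case: b.
        rewrite (_ : _ @^-1` _ = A)//; by apply/seteqP; split => x /= /asboolP.
      rewrite (_ : _ @^-1` _ = ~` A); first exact: measurableC.
      by apply/seteqP; split => x /=; case: asboolP.
    apply: filterE => w /=; rewrite ge_max => /andP[aA _]; apply: le_trans aA _.
    rewrite /partition_variation big_bool/= setTI (_ : _ @^-1` [set true] = A) ?lerDl//.
    by apply/seteqP; split => x /= /asboolP.
(* The losses of all splittings add up to e / 2, so half of the initial probability survives. *)
pose de n : R := e / 2 * (1 + (1 / 2) ^+ n).
have de1 n : e / 2 <= de n.
  by rewrite /de ler_pMr ?divr_gt0// lerDl exprn_ge0.
have step n E : measurable E -> unbounded_variation E (de n) -> exists E' D,
   [/\ measurable E', measurable D, E' `<=` E /\ D `<=` E `\` E',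
    e / 2 / 32 <= pr P [set w | 1 / 2 <= `|m D w|] & unbounded_variation E' (de n.+1)].
  move=> mE uE.
  have := @unbounded_variation_split E (e / 2) (de n) (de n - de n.+1) mE _ (de1 n) _ uE.
  have -> : de n - (de n - de n.+1) = de n.+1 by rewrite opprB addrC subrK.
  apply; first by rewrite divr_gt0.
  rewrite subr_gt0 /de ltr_pM2l ?divr_gt0// ltrD2l exprS gtr_pMl ?exprn_gt0//; lra.
pose Q (x : nat * set T * set T) := measurable x.1.2 /\ unbounded_variation x.1.2 (de x.1.1).
pose Rl (x y : nat * set T * set T) := [/\ y.1.1 = x.1.1.+1, measurable y.2, y.1.2 `<=` x.1.2,
  y.2 `<=` x.1.2 `\` y.1.2 & e / 2 / 32 <= pr P [set w | 1 / 2 <= `|m y.2 w|]].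
have [||F [F0 hF]] := @dep_choice _ Q Rl _ (0%N, setT, set0).
- move=> [[n E] D0] [/= mE uE]; have [E' [D [? ? [? ?] ? ?]]] := step n E mE uE.
  by exists (n.+1, E', D).
- by split => //=; rewrite /de expr0 (_ : e / 2 * (1 + 1) = e)//; field.
pose D n := (F n.+1).2.
have mD n : measurable (D n) by have [_ []] := hF n.
have dE n k : (F (n + k)%N).1.2 `<=` (F n).1.2.
  elim: k => [|k IH]; first by rewrite addn0.
  by rewrite addnS; apply: subset_trans IH; have [_ []] := hF (n + k)%N.
have tD : trivIset setT D.
  have hlt i j x : (i < j)%N -> D i x -> D j x -> False.
    move=> ij; have [_ [_ _ _ h _]] := hF i; have [_ [_ _ _ h' _]] := hF j.
    move=> /h[_ ni] /h'[Fj _]; apply: ni.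
    by have := @dE i.+1 (j - i.+1)%N x; rewrite subnKC//; apply.
  move=> i j _ _ [x /= [Di Dj]]; apply/eqP; rewrite eqn_leq; apply/andP; split;
    by rewrite leqNgt; apply/negP => /hlt; apply; eassumption.
(* In [small] one number bounds both the size and the probability: 1/2 is the size of the masses,
   and e / 2 / 64 lies below their probability e / 2 / 32. *)
pose e1 := Num.min (1 / 2) (e / 2 / 64).
have e10 : 0 < e1 by rewrite lt_min !divr_gt0.
have [j0 /(_ j0 (leqnn _))] := smeas_disj sm mD tD e10.
have [_ [_ _ _ _ h]] := hF j0; rewrite /small => h2.
have : pr P [set w | 1 / 2 <= `|m (D j0) w|] <= e1.
  apply: le_trans h2; apply: le_pr; [apply: measurable_norm_ge; exact: (smeas_meas sm)..|].
  by move=> w /=; apply: le_trans; rewrite ge_min lexx.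
move=> /(le_trans h); rewrite le_min => /andP[_]; lra.
Qed.

End boundedness.

(** * Random signs and simple integrands *)

Section signs.
Variable R : realType.

(** Sign patterns are lists, so that moments can be computed by induction on the number of signs. *)
Fixpoint signs n : seq (seq bool) :=
  if n is k.+1 then map (cons true) (signs k) ++ map (cons false) (signs k)
  else [:: [::]].

Fixpoint dot (e : seq bool) (x : seq R) : R :=
  if (e, x) is (b :: e', a :: x') then (if b then a else - a) + dot e' x' else 0.

Fixpoint cdot (c x : seq R) : R :=
  if (c, x) is (b :: c', a :: x') then b * a + cdot c' x' else 0.

(* The law of independent signs with means [c]. *)
Fixpoint sign_weight (e : seq bool) (c : seq R) : R :=
  if (e, c) is (b :: e', a :: c') then (if b then 1 + a else 1 - a) / 2 * sign_weight e' c' else 1.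

Lemma big_signs n (F : seq bool -> R) :
  \sum_(e <- signs n.+1) F e = \sum_(e <- signs n) (F (true :: e) + F (false :: e)).
Proof. by rewrite /= big_cat !big_map big_split. Qed.

Lemma size_signs n e : e \in signs n -> size e = n.
Proof.
elim: n e => [|n IH] e /=; first by rewrite inE => /eqP ->.
by rewrite mem_cat => /orP[] /mapP[e' /IH <- ->].
Qed.

Lemma sum_sign_weight c : \sum_(e <- signs (size c)) sign_weight e c = 1.
Proof.
elim: c => [|a c IH]; first by rewrite big_seq1.
by rewrite big_signs /= -[RHS]IH; apply: eq_bigr => e _; field.
Qed.

Lemma sign_weight_ge0 e c : all (fun a => `|a| <= 1) c -> 0 <= sign_weight e c.
Proof.
elim: e c => [|b e IH] [|a c]//= /andP[]; rewrite ler_norml => /andP[a1 a2] /IH h.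
by apply: mulr_ge0 => //; apply: divr_ge0 => //; case: b; lra.
Qed.

(** The signed sum has mean [cdot c x], and by independence its variance is the sum of the (1 -
    c_i^2) x_i^2. The shift [y] collects the coordinates already treated in the induction. *)
Lemma sign_weight_variance (c x : seq R) (y : R) : size x = size c ->
  \sum_(e <- signs (size c)) sign_weight e c * (y + dot e x - cdot c x) ^+ 2 =
  y ^+ 2 + cdot (map (fun a => 1 - a ^+ 2) c) (map (fun b => b ^+ 2) x).
Proof.
elim: c x y => [|a c IH] [|b x]//= y; first by move=> _; rewrite big_seq1 /=; ring.
move=> [sx]; rewrite [LHS](big_signs (size c)) /=.
transitivity ((1 + a) / 2 * \sum_(e <- signs (size c)) sign_weight e c * ((y + b - a * b) + dot e x - cdot c x) ^+ 2
   + (1 - a) / 2 * \sum_(e <- signs (size c)) sign_weight e c * ((y - b - a * b) + dot e x - cdot c x) ^+ 2).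
  by rewrite !mulr_sumr -big_split/=; apply: eq_bigr => e _; field.
by rewrite !IH//; field.
Qed.

Let z (x : seq R) := nseq (size x) (0 : R).

Lemma cdotz x : cdot (z x) x = 0.
Proof. by elim: x => //= a x ->; rewrite mul0r addr0. Qed.

Lemma sum_sqE x : cdot (map (fun a => 1 - a ^+ 2) (z x)) (map (fun b => b ^+ 2) x) =
  \sum_(a <- x) a ^+ 2.
Proof.
elim: x => [|a x IH] /=; first by rewrite big_nil.
by rewrite big_cons IH; ring.
Qed.

Lemma sign_weight_moment2 x : \sum_(e <- signs (size x)) sign_weight e (z x) * (dot e x) ^+ 2 =
  \sum_(a <- x) a ^+ 2.
Proof.
have := @sign_weight_variance (z x) x 0; rewrite size_nseq => /(_ erefl).
by rewrite sum_sqE expr0n add0r => <-; apply: eq_bigr => e _; rewrite add0r cdotz subr0.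
Qed.

(** Khinchine's inequality with the Gaussian fourth moment 3 V^2; the shift [y] again makes the
    induction work, each coordinate a leaving a surplus 2 a^4. *)
Lemma sign_weight_moment4 (x : seq R) (y : R) : \sum_(e <- signs (size x)) sign_weight e (z x) * (y + dot e x) ^+ 4 <=
  y ^+ 4 + 6 * y ^+ 2 * (\sum_(a <- x) a ^+ 2) + 3 * (\sum_(a <- x) a ^+ 2) ^+ 2.
Proof.
elim: x y => [|a x IH] y /=; first by rewrite big_seq1 !big_nil /=; lra.
rewrite [leLHS](big_signs (size x)) big_cons.
set V := \sum_(_ <- _) _ in IH *.
have -> : \sum_(e <- signs (size x))
    (sign_weight (true :: e) (0 :: nseq (size x) 0) * (y + dot (true :: e) (a :: x)) ^+ 4 +
     sign_weight (false :: e) (0 :: nseq (size x) 0) * (y + dot (false :: e) (a :: x)) ^+ 4) =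
  1 / 2 * \sum_(e <- signs (size x)) sign_weight e (z x) * ((y + a) + dot e x) ^+ 4 +
  1 / 2 * \sum_(e <- signs (size x)) sign_weight e (z x) * ((y - a) + dot e x) ^+ 4.
  by rewrite !mulr_sumr -big_split/=; apply: eq_bigr => e _; rewrite /z; field.
have h1 := IH (y + a); have h2 := IH (y - a).
have V0 : 0 <= V by apply: sumr_ge0 => b _; exact: sqr_ge0.
have -> : y ^+ 4 + 6 * y ^+ 2 * (a ^+ 2 + V) + 3 * (a ^+ 2 + V) ^+ 2 =
  1 / 2 * ((y + a) ^+ 4 + 6 * (y + a) ^+ 2 * V + 3 * V ^+ 2) +
  1 / 2 * ((y - a) ^+ 4 + 6 * (y - a) ^+ 2 * V + 3 * V ^+ 2) + 2 * (a ^+ 2) ^+ 2.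
  by field.
have := sqr_ge0 (a ^+ 2); move: h1 h2; lra.
Qed.

(** With D the signed sum and V its variance, D^2 <= V / 4 where |D| < a, and D^2 <= 2 V + D^4 / (8
    V) everywhere. Expectations give V <= V / 4 + 2 V p + 3 V / 8, where p is the probability of |D|
    >= a. *)
Lemma sign_weight_paley_zygmund (x : seq R) (a : R) : 0 < a -> 4 * a ^+ 2 <= \sum_(b <- x) b ^+ 2 ->
  3 / 16 <= \sum_(e <- signs (size x)) sign_weight e (z x) * (a <= `|dot e x|)%R%:R.
Proof.
set V := \sum_(_ <- _) _ => a0 aV.
have V0 : 0 < V by apply: lt_le_trans aV; rewrite mulr_gt0// exprn_gt0.
have w0 e : 0 <= sign_weight e (z x).
  by apply: sign_weight_ge0; apply/allP => b /nseqP[-> _]; rewrite normr0.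
have hp e : (dot e x) ^+ 2 <= V / 4 + 2 * V * (a <= `|dot e x|)%R%:R + (8 * V)^-1 * (dot e x) ^+ 4.
  have d40 : 0 <= (8 * V)^-1 * dot e x ^+ 4.
    apply: mulr_ge0; first by rewrite invr_ge0 mulr_ge0// ltW.
    by rewrite (_ : dot e x ^+ 4 = (dot e x ^+ 2) ^+ 2) ?sqr_ge0//; ring.
  case: (leP a) => h /=.
    set D := dot e x in d40 *.
    have := sqr_ge0 (D ^+ 2 - 4 * V).
    have -> : (8 * V)^-1 * D ^+ 4 = (8 * V)^-1 * (D ^+ 2 - 4 * V) ^+ 2 + D ^+ 2 - 2 * V.
      by field; rewrite gt_eqF.
    have : 0 <= (8 * V)^-1 * (D ^+ 2 - 4 * V) ^+ 2.
      by rewrite mulr_ge0 ?sqr_ge0// invr_ge0 mulr_ge0// ltW.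
    move: V0; lra.
  have : (dot e x) ^+ 2 <= a ^+ 2.
    by rewrite -[leLHS]real_normK ?num_real// ler_sqr ?nnegrE ?normr_ge0 ?(ltW a0)// ltW.
  by move: d40 aV; set q := _^-1 * _; lra.
have h1 : V <= V / 4 + 2 * V * (\sum_(e <- signs (size x)) sign_weight e (z x) * (a <= `|dot e x|)%R%:R)
    + (8 * V)^-1 * (3 * V ^+ 2).
  rewrite {1}/V -sign_weight_moment2.
  apply: (@le_trans _ _ (\sum_(e <- signs (size x)) sign_weight e (z x) *
     (V / 4 + 2 * V * (a <= `|dot e x|)%R%:R + (8 * V)^-1 * (dot e x) ^+ 4))).
    by apply: ler_sum => e _; exact: ler_wpM2l.
  have -> : \sum_(e <- signs (size x)) sign_weight e (z x) *
     (V / 4 + 2 * V * (a <= `|dot e x|)%R%:R + (8 * V)^-1 * (dot e x) ^+ 4) =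
     V / 4 * (\sum_(e <- signs (size x)) sign_weight e (z x)) +
     2 * V * (\sum_(e <- signs (size x)) sign_weight e (z x) * (a <= `|dot e x|)%R%:R) +
     (8 * V)^-1 * (\sum_(e <- signs (size x)) sign_weight e (z x) * (0 + dot e x) ^+ 4).
    by rewrite !mulr_sumr -!big_split/=; apply: eq_bigr => e _; rewrite add0r; ring.
  have := sum_sign_weight (z x); rewrite size_nseq => ->; rewrite mulr1 lerD2l.
  apply: ler_wpM2l; first by rewrite invr_ge0 mulr_ge0// ltW.
  by have := sign_weight_moment4 x 0; rewrite -/V !expr0n/= mulr0 mul0r !add0r.
set p := \sum_(_ <- _) _ in h1 *.
have h2 : (8 * V)^-1 * (3 * V ^+ 2) = 3 / 8 * V by field; rewrite gt_eqF.
rewrite h2 in h1; rewrite -(ler_pM2l V0); lra.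
Qed.

(** Chebyshev's inequality at twice a bound [b] of the standard deviation. *)
Lemma sign_weight_chebyshev (c x : seq R) (b : R) : size x = size c -> all (fun a => `|a| <= 1) c -> 0 < b ->
  \sum_(a <- x) a ^+ 2 <= b ^+ 2 ->
  3 / 4 <= \sum_(e <- signs (size c)) sign_weight e c * (`|dot e x - cdot c x| <= 2 * b)%R%:R.
Proof.
move=> sx c1 b0 hV.
have w0 e : 0 <= sign_weight e c by exact: sign_weight_ge0.
have b2 : 0 < b ^+ 2 by rewrite exprn_gt0.
have hv : cdot (map (fun a => 1 - a ^+ 2) c) (map (fun b => b ^+ 2) x) <= b ^+ 2.
  apply: le_trans hV; elim: c x sx c1 {w0} => [|a c IH] [|u x]//=; first by rewrite big_nil.
  move=> [sx] /andP[a1 c1]; rewrite big_cons; apply: lerD; last exact: IH.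
  by rewrite ler_piMl ?sqr_ge0// gerBl sqr_ge0.
have := @sign_weight_variance c x 0 sx; rewrite expr0n add0r => hE.
have hp e : 4 * b ^+ 2 * (1 - (`|dot e x - cdot c x| <= 2 * b)%R%:R) <=
     (0 + dot e x - cdot c x) ^+ 2.
  rewrite add0r; case: (leP `|_ - _|) => h /=; first by rewrite subrr mulr0 sqr_ge0.
  rewrite subr0 mulr1 -[leRHS]real_normK ?num_real//.
  have -> : 4 * b ^+ 2 = (2 * b) ^+ 2 by ring.
  by rewrite ler_sqr ?nnegrE ?normr_ge0 ?mulr_ge0 ?(ltW b0)// ltW.
have : 4 * b ^+ 2 * (1 - \sum_(e <- signs (size c)) sign_weight e c * (`|dot e x - cdot c x| <= 2 * b)%R%:R) <= b ^+ 2.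
  apply: le_trans hv; rewrite -hE -[X in _ * (X - _)](sum_sign_weight c) -sumrB mulr_sumr.
  apply: ler_sum => e _; rewrite -{1}[sign_weight e c]mulr1 -mulrBr mulrCA.
  exact: ler_wpM2l.
set p := \sum_(_ <- _) _; rewrite mulrAC => h.
by have : 4 * (1 - p) <= 1; [rewrite -(ler_pM2r b2) mul1r|lra].
Qed.

Lemma dot_map (I : eqType) (r : seq I) (y : I -> R) e : uniq r -> size e = size r ->
  dot e (map y r) = \sum_(i <- r) (if nth false e (index i r) then y i else - y i).
Proof.
elim: r e => [|i r IH] [|b e]//=; first by rewrite big_nil.
move=> /andP[ir ur] [se]; rewrite big_cons eqxx /= IH//; congr (_ + _).
apply: eq_big_seq => j jr; case: eqP => //= ij; by rewrite ij jr in ir.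
Qed.

Lemma cdot_map (I : eqType) (r : seq I) (c y : I -> R) :
  cdot (map c r) (map y r) = \sum_(i <- r) c i * y i.
Proof. by elim: r => [|i r IH] /=; rewrite ?big_nil ?big_cons ?IH. Qed.

End signs.

Section random_signs.
Context {d : measure_display} {Omega : measurableType d} {R : realType}.
Variable P : probability Omega R.

Definition eval_seq (X : seq (Omega -> R)) w : seq R := [seq x w | x <- X].
Definition meas_seq (X : seq (Omega -> R)) := forall i, (i < size X)%N ->
  measurable_fun setT (nth (fun=> 0) X i).

Lemma measurable_dot X e : meas_seq X -> measurable_fun setT (fun w => dot e (eval_seq X w)).
Proof.
elim: X e => [|x X IH] [|b e] mX //=.
apply: measurable_funD; last by apply: IH => i ?; exact: (mX i.+1).
by case: b; [exact: (mX 0%N)|apply: measurableT_comp => //; exact: (mX 0%N)].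
Qed.

Lemma measurable_cdot X c : meas_seq X -> measurable_fun setT (fun w => cdot c (eval_seq X w)).
Proof.
elim: X c => [|x X IH] [|b c] mX //=.
apply: measurable_funD; last by apply: IH => i ?; exact: (mX i.+1).
by apply: measurable_funM => //; exact: (mX 0%N).
Qed.

Lemma measurable_sqsum X : meas_seq X ->
  measurable_fun setT (fun w => \sum_(a <- eval_seq X w) a ^+ 2).
Proof.
elim: X => [|x X IH] mX.
  by rewrite (_ : (fun w => _) = cst 0)//; apply/funext => w; rewrite big_nil.
rewrite (_ : (fun w => _) = (fun w => x w ^+ 2 + \sum_(a <- eval_seq X w) a ^+ 2)).
  apply: measurable_funD; last by apply: IH => i ?; exact: (mX i.+1).
  by apply: measurable_funX; exact: (mX 0%N).
by apply/funext => w; rewrite /= big_cons.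
Qed.

Variables (X : seq (Omega -> R)) (a de : R).
Hypothesis mX : meas_seq X.
Hypothesis a0 : 0 < a.
Hypothesis hX : forall e, size e = size X -> pr P [set w | a <= `|dot e (eval_seq X w)|] <= de.

(** Fubini for the product of the law of the signs with [P]: each single pattern is large with
    probability at most [de], hence so is a random one, whereas on [H] it is large with probability
    at least [k]. *)
Lemma pr_signs c k (H : set Omega) : size c = size X -> all (fun a => `|a| <= 1) c ->
  measurable H ->
  {ae P, forall w, H w -> k <= \sum_(e <- signs (size c)) sign_weight e c * (a <= `|dot e (eval_seq X w)|)%R%:R} ->
  k * pr P H <= de.
Proof.
move=> sc c1 mH h.
have w0 e : 0 <= sign_weight e c by exact: sign_weight_ge0.
pose E e := [set w | a <= `|dot e (eval_seq X w)|].
have mE e : measurable (E e) by apply: measurable_norm_ge; exact: measurable_dot.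
have := @pr_indic_le _ _ _ P _ (signs (size c)) (fun e => sign_weight e c) E H k 0 mE mH.
rewrite addr0 => hh; have {}hh : k * pr P H <= \sum_(e <- signs (size c)) sign_weight e c * pr P (E e).
  apply: hh; apply: filterS h => w hw; rewrite addr0 indicE.
  have eqE : \sum_(e <- signs (size c)) sign_weight e c * \1_(E e) w =
      \sum_(e <- signs (size c)) sign_weight e c * (a <= `|dot e (eval_seq X w)|)%R%:R.
    apply: eq_bigr => e _; rewrite indicE; congr (_ * _%:R).
    by case: (leP a) => h; [rewrite mem_set//|rewrite memNset// /E /=; apply/negP; rewrite -ltNge].
  rewrite eqE; case: (boolP (w \in H)); first by rewrite inE mulr1 => /hw.
  by rewrite mulr0 => _; apply: sumr_ge0 => e _; rewrite mulr_ge0.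
apply: le_trans hh _.
rewrite -[leRHS]mulr1 -(sum_sign_weight c) mulr_sumr !big_seq; apply: ler_sum => e he.
by rewrite mulrC ler_wpM2r// hX// (size_signs he).
Qed.

Lemma pr_square_sum : 3 / 16 * pr P [set w | 4 * a ^+ 2 <= \sum_(b <- eval_seq X w) b ^+ 2] <= de.
Proof.
apply: (@pr_signs (nseq (size X) 0)); first by rewrite size_nseq.
- by apply/allP => b /nseqP[-> _]; rewrite normr0.
- by apply: measurable_ge; exact: measurable_sqsum.
- apply: filterE => w /= h; have := sign_weight_paley_zygmund a0 h.
  by rewrite size_nseq size_map.
Qed.

(** The passage to the convex hull. Coefficients in [-1, 1] are the means of independent signs.
    Where the square sum is below (2a)^2, a random signed sum is within 4a of its mean with
    probability 3/4, so a mean of size 5a forces a signed sum of size a. Both exceptional events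
    together cost (4/3 + 16/3) * de. *)
Lemma pr_convex c : size c = size X -> all (fun a => `|a| <= 1) c ->
  pr P [set w | 5 * a <= `|cdot c (eval_seq X w)|] <= 7 * de.
Proof.
move=> sc c1.
have mC := measurable_cdot c mX; have mS := measurable_sqsum mX.
pose H := [set w | 5 * a <= `|cdot c (eval_seq X w)|] `&`
   [set w | \sum_(b <- eval_seq X w) b ^+ 2 < 4 * a ^+ 2].
have mH : measurable H.
  by apply: measurableI; [exact: measurable_norm_ge|exact: measurable_lt].
have h1 : 3 / 4 * pr P H <= de.
  apply: (pr_signs sc c1 mH); apply: filterE => w [/= h5 h4].
  have := @sign_weight_chebyshev _ c (eval_seq X w) (2 * a) _ c1 (mulr_gt0 (ltr0n _ 2) a0).
  rewrite size_map => /(_ (esym sc)); have -> : (2 * a) ^+ 2 = 4 * a ^+ 2 by ring.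
  move=> /(_ (ltW h4)) /le_trans; apply; apply: ler_sum => e _.
  apply: ler_wpM2l; first exact: sign_weight_ge0.
  rewrite ler_nat; case: (leP `|_ - _|) => //= h.
  suff -> : a <= `|dot e (eval_seq X w)| by [].
  have := ler_normB (dot e (eval_seq X w)) (dot e (eval_seq X w) - cdot c (eval_seq X w)).
  by rewrite subKr; move: h h5; lra.
have h2 := pr_square_sum.
have : pr P [set w | 5 * a <= `|cdot c (eval_seq X w)|] <=
    pr P H + pr P [set w | 4 * a ^+ 2 <= \sum_(b <- eval_seq X w) b ^+ 2].
  apply: pr_leU2 => //; [exact: measurable_norm_ge|exact: measurable_ge|].
  move=> w /= h; have [?|?] := leP (4 * a ^+ 2) (\sum_(b <- eval_seq X w) b ^+ 2); first by right.
  by left.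
have p0 := pr_ge0 P H.
by move: h1 h2; lra.
Qed.

End random_signs.

(** * Boundedness on bounded simple functions *)

Section simple_integral.
Context {d : measure_display} {Omega : measurableType d} {R : realType}.
Variable P : probability Omega R.
Context {dT : measure_display} {T : measurableType dT}.
Variable m : set T -> Omega -> R.

(** This and the next two definitions restate the simple integrals of the theorem for an arbitrary
    random set function [m], since they are also applied to indefinite integrals. *)
Definition srep (s : seq (R * set T)) := forall i, (i < size s)%N ->
  measurable (nth (0, set0) s i).2.
Definition sfun (s : seq (R * set T)) y : R := \sum_(a <- s) a.1 * \1_(a.2) y.
Definition sint (s : seq (R * set T)) (A : set T) w : R :=
  \sum_(a <- s) a.1 * m (A `&` a.2) w.

Lemma srep_cons a s : srep (a :: s) -> measurable a.2 /\ srep s.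
Proof. by move=> h; split=> [|i ?]; [exact: (h 0%N)|exact: (h i.+1)]. Qed.

Lemma srepI a s : measurable a.2 -> srep s -> srep (a :: s).
Proof. by move=> ma ms [|i] //=; exact: ms. Qed.

Lemma srep_cat s1 s2 : srep s1 -> srep s2 -> srep (s1 ++ s2).
Proof.
elim: s1 => //= a s1 IH /srep_cons[ma /IH h] /h; exact: srepI.
Qed.

Lemma sfun_cat s1 s2 y : sfun (s1 ++ s2) y = sfun s1 y + sfun s2 y.
Proof. by rewrite /sfun big_cat. Qed.

Lemma sint_cat s1 s2 A w : sint (s1 ++ s2) A w = sint s1 A w + sint s2 A w.
Proof. by rewrite /sint big_cat. Qed.

Definition sscale (c : R) (s : seq (R * set T)) := [seq (c * a.1, a.2) | a <- s].

Lemma srep_scale c s : srep s -> srep (sscale c s).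
Proof.
by elim: s => //= a s IH /srep_cons[ma /IH h]; exact: srepI.
Qed.

Lemma sfun_scale c s y : sfun (sscale c s) y = c * sfun s y.
Proof. by rewrite /sfun big_map mulr_sumr; apply: eq_bigr => a _; rewrite mulrA. Qed.

Lemma sint_scale c s A w : sint (sscale c s) A w = c * sint s A w.
Proof. by rewrite /sint big_map mulr_sumr; apply: eq_bigr => a _; rewrite mulrA. Qed.

Hypothesis sm : smeas P m.

Lemma measurable_sint s A : srep s -> measurable A -> measurable_fun setT (sint s A).
Proof.
move=> + mA; elim: s => [|a s IH] ms.
  by rewrite (_ : sint _ _ = cst 0)//; apply/funext => w; rewrite /sint big_nil.
rewrite (_ : sint _ _ = (fun w => a.1 * m (A `&` a.2) w + sint s A w)); last first.
  by apply/funext => w; rewrite /sint big_cons.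
have [ma /IH h] := srep_cons ms; apply: measurable_funD => //.
by apply: measurable_funM => //; apply: (smeas_meas sm); exact: measurableI.
Qed.

(** The sets of a representation may overlap. On the partition that they generate the coefficients
    become values of the function, which is what pointwise bounds control. *)
Lemma sint_atoms s : srep s -> exists (I : finType) (f : T -> I) (v : I -> R),
  [/\ measurable_fibers f, forall y, sfun s y = v (f y) &
   forall B, measurable B -> {ae P, forall w, sint s B w =
      \sum_i v i * m (B `&` f @^-1` [set i]) w}].
Proof.
elim: s => [_|[c A] s IH /srep_cons[/= mA /IH[I [f [v [mf fv iv]]]]]].
  exists unit, (fun=> tt), (fun=> 0); split.
  - move=> i; rewrite (_ : _ @^-1` _ = setT)//.
    by apply/seteqP; split => x //= _; case: i.
  - by move=> y; rewrite /sfun big_nil.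
  - move=> B mB; apply: filterE => w; rewrite /sint big_nil big1// => i _.
    by rewrite mul0r.
pose g y := `[< A y >].
have mg : measurable_fibers g.
  have tA : g @^-1` [set true] = A by apply/seteqP; split => x /= /asboolP.
  case; first by rewrite tA.
  rewrite (_ : _ @^-1` _ = ~` A); first exact: measurableC.
  by apply/seteqP; split => x /=; rewrite /g; case: asboolP.
exists (I * bool)%type, (fun x => (f x, g x)), (fun p : I * bool => c * (p.2 : nat)%:R + v p.1); split.
- exact: measurable_fibers_pair.
- by move=> y; rewrite /sfun big_cons -/(sfun s y) fv /= indicE (_ : (y \in A) = g y).

move=> B mB.
have hA := smeas_fin sm (fun p : I * bool => p.2) (measurable_fibers_pair mf mg) mB.
apply: filterS3 hA (iv B mB) (smeas_row sm mf mg mB) => w hA hs hr.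
rewrite /sint big_cons -/(sint s B w) hs /=.
rewrite (_ : B `&` A = B `&` (fun x => (f x, g x)) @^-1` [set p : I * bool | p.2]); last first.
  by congr (_ `&` _); apply/seteqP; split => x /asboolP.
rewrite hA big_mkcond mulr_sumr.
under [in X in _ + X]eq_bigr do rewrite hr mulr_sumr.
rewrite (pair_bigA _ (fun i j => v i * m (B `&` (fun x => (f x, g x)) @^-1` [set (i, j)]) w))/=.
rewrite -big_split/=; apply: eq_bigr => -[i b] _ /=.
by case: b; rewrite ?mulr1 ?mulr0 mulrDl ?mul0r.
Qed.

(** A signed sum over the cells is m U - m V for two unions of cells, so [smeas_bounded] applies to
    it at level 2 * a0 with probability 2 * (e / 14). Then [pr_convex] costs the factors 5 and 7. *)
Lemma smeas_convex_bounded (e : R) : 0 < e -> exists2 a : R, 0 < a &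
  forall s B (c : R), srep s -> measurable B -> 0 < c -> (forall y, B y -> `|sfun s y| <= c) ->
  pr P [set w | c * a <= `|sint s B w|] <= e.
Proof.
move=> e0; have [a0 a00 ha] := smeas_bounded sm (divr_gt0 e0 (ltr0n R 14)).
exists (10 * a0); first by rewrite mulr_gt0.
move=> s B c ms mB c0 hs; have [I [f [v [mf fv iv]]]] := sint_atoms ms.
pose A i := B `&` f @^-1` [set i].
have mA i : measurable (A i) by exact: measurableI.
(* On an empty cell the value [v i] is unconstrained, and the mass vanishes almost surely. *)
pose cc i := if `[< A i !=set0 >] then v i / c else 0.
have cc1 i : `|cc i| <= 1.
  rewrite /cc; case: asboolP => [[y [By fy]]|]; last by rewrite normr0.
  rewrite normrM normfV (gtr0_norm c0) ler_pdivrMr// mul1r.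
  by have := hs y By; rewrite fv fy.
have h0 := smeas0 sm.
have E : {ae P, forall w, sint s B w = c * cdot [seq cc i | i <- enum I]
    (eval_seq [seq m (A i) | i <- enum I] w)}.
  apply: filterS2 (iv B mB) h0 => w -> w0.
  rewrite /eval_seq -map_comp cdot_map big_enum/= mulr_sumr; apply: eq_bigr => i _.
  rewrite /cc; case: asboolP => [_|nA]; first by rewrite mulrA mulrCA divff ?mulr1// gt_eqF.
  have /= -> : m (A i) w = 0.
    rewrite (_ : A i = set0)//; apply: contrapT => /eqP/set0P; exact: nA.
  by rewrite !mulr0.
have mXs : meas_seq [seq m (A i) | i <- enum I].
  move=> k; rewrite size_map => hk; case: (enum I) hk => [//|i0 r] hk.
  by rewrite (nth_map i0)//; exact: (smeas_meas sm).
have key := @pr_convex _ _ _ P [seq m (A i) | i <- enum I] (2 * a0) (2 * (e / 14)) mXs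
  (mulr_gt0 (ltr0n _ 2) a00) _ [seq cc i | i <- enum I] _ _.
have -> : e = 7 * (2 * (e / 14)) by field.
apply: le_trans (key _ _ _); rewrite ?size_map//; first last.
- by apply/allP => x /mapP[i _ ->].
- move=> b; rewrite ?size_map => sb.
  pose S i := nth false b (index i (enum I)).
  have hS := smeas_fin sm S mf mB.
  have hN := smeas_fin sm (predC S) mf mB.
  set U := B `&` _ in hS; set V := B `&` _ in hN.
  have mU : measurable U by apply: measurableI => //; exact: (measurable_fibers_pred S mf).
  have mV : measurable V by apply: measurableI => //; exact: (measurable_fibers_pred (predC S) mf).
  have dE : {ae P, forall w, dot b (eval_seq [seq m (A i) | i <- enum I] w) = m U w - m V w}.
    apply: filterS2 hS hN => w -> ->.
    rewrite /eval_seq -map_comp dot_map ?enum_uniq//; last by rewrite sb enumT.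
    rewrite big_enum/= (bigID S)/=; congr (_ + _).
      by apply: eq_bigr => i Si; rewrite -/(S i) Si.
    by rewrite -sumrN; apply: eq_bigr => i /negbTE Si; rewrite -/(S i) Si.
  apply: (@le_trans _ _ (pr P [set w | a0 <= `|m U w|] + pr P [set w | a0 <= `|m V w|])).
    have mUV : measurable [set w | 2 * a0 <= `|m U w - m V w|].
      by apply: measurable_norm_ge; apply: measurable_funB; exact: (smeas_meas sm).
    apply: (@le_trans _ _ (pr P [set w | 2 * a0 <= `|m U w - m V w|])).
      apply: le_pr_ae => //; first by apply: measurable_norm_ge; exact: measurable_dot.
      by apply: filterS dE => w /= ->.
    apply: pr_leU2 => //; [by apply: measurable_norm_ge; exact: (smeas_meas sm)..|].
    move=> w /= h; have [?|h1] := leP a0 `|m U w|; [by left|right].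
    by have := ler_normB (m U w) (m V w); move: h h1; lra.
  by rewrite mulr_natl mulr2n lerD// ha.
apply: le_pr_ae.
- by apply: measurable_norm_ge; exact: measurable_sint.
- by apply: measurable_norm_ge; exact: measurable_cdot.
apply: filterS E => w /= ->; rewrite normrM (gtr0_norm c0) ler_pM2l//.
by rewrite mulrA -natrM.
Qed.

End simple_integral.

(** * Limits of vector measures *)

Section cvg_prob.
Context {d : measure_display} {Omega : measurableType d} {R : realType}.
Variable P : probability Omega R.

Definition cvg_prob (X : nat -> Omega -> R) Y := forall e, 0 < e -> exists N : nat,
  forall n, (N <= n)%N -> small P e (fun w => X n w - Y w).

Lemma cvg_in_probability_cvg_prob X Y : cvg_in_probability P X Y -> cvg_prob X Y.
Proof.
move=> h e e0; have := h e e0; move=> /fine_cvgP[_ /cvgr_lt /(_ e e0)] [N _ hN].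
by exists N => n Nn; exact: ltW (hN n Nn).
Qed.

Lemma small0 e : 0 < e -> small P e (cst 0).
Proof.
move=> e0; have E : [set w : Omega | e <= `|0 : R|] = set0.
  by rewrite -subset0 => w /=; rewrite normr0 leNgt e0.
by rewrite /small /= E /pr measure0 ltW.
Qed.

Lemma small_scale (X : Omega -> R) (c e : R) : measurable_fun setT X -> 0 < e ->
  small P (e / (`|c| + 1)) X -> small P e (fun w => c * X w).
Proof.
move=> mX e0 h.
have c0 : 0 < `|c| + 1 by rewrite ltr_wpDl.
apply: le_trans (_ : e / (`|c| + 1) <= e); last first.
  by rewrite ler_pdivrMr// ler_peMr ?lerDr// ltW.
apply: le_trans h; apply: le_pr.
- by apply: measurable_norm_ge; exact: measurable_funM.
- exact: measurable_norm_ge.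
- move=> w /=; rewrite normrM ler_pdivrMr// => /le_trans; apply.
  by rewrite mulrC ler_wpM2l// lerDl.
Qed.

Lemma cvg_prob_ae_uniq X Y Z : (forall n, measurable_fun setT (X n)) -> measurable_fun setT Y ->
  measurable_fun setT Z -> cvg_prob X Y -> cvg_prob X Z -> {ae P, forall w, Y w = Z w}.
Proof.
move=> mX mY mZ hY hZ.
have : {ae P, forall w, Y w - Z w = 0}.
  apply: small_ae0; first exact: measurable_funB.
  move=> e e0; have e20 : 0 < e / 2 by rewrite divr_gt0.
  have [N1 h1] := hY _ e20; have [N2 h2] := hZ _ e20.
  rewrite (splitr e).
  have := smallB _ _ (h2 _ (leq_maxr N1 N2)) (h1 _ (leq_maxl N1 N2)).
  set n := maxn _ _ => /(_ (measurable_funB (mX n) mZ) (measurable_funB (mX n) mY)).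
  apply: small_ae; [by do 2 apply: measurable_funB => //|exact: measurable_funB|].
  by apply: filterE => w; ring.
by apply: filterS => w /eqP; rewrite subr_eq0 => /eqP.
Qed.

End cvg_prob.

Section closure.
Context {d : measure_display} {Omega : measurableType d} {R : realType}.
Variable P : probability Omega R.
Context {dT : measure_display} {T : measurableType dT}.
Implicit Types m : set T -> Omega -> R.

Lemma smeas_zero : smeas P (fun (_ : set T) _ => 0).
Proof.
split => [A mA|A B _ _ _|C _ _ e e0]; first exact: measurable_cst.
  by apply: filterE => w; rewrite addr0.
by exists 0%N => j _; exact: small0.
Qed.

Lemma smeas_add m1 m2 : smeas P m1 -> smeas P m2 -> smeas P (fun A w => m1 A w + m2 A w).
Proof.
move=> s1 s2; split => [A mA|A B mA mB AB|C mC dC e e0].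
- by apply: measurable_funD; [exact: (smeas_meas s1)|exact: (smeas_meas s2)].
- by apply: filterS2 (smeasU s1 mA mB AB) (smeasU s2 mA mB AB) => w -> ->; ring.
have [j1 h1] := smeas_cont s1 mC dC (divr_gt0 e0 (ltr0n _ 2)).
have [j2 h2] := smeas_cont s2 mC dC (divr_gt0 e0 (ltr0n _ 2)).
exists (maxn j1 j2) => j; rewrite geq_max => /andP[j1j j2j]; rewrite (splitr e).
by apply: smallD; [exact: (smeas_meas s1)|exact: (smeas_meas s2)|exact: h1|exact: h2].
Qed.

Lemma smeas_restr m (c : R) B : measurable B -> smeas P m ->
  smeas P (fun A w => c * m (A `&` B) w).
Proof.
move=> mB s; split => [A mA|A A' mA mA' AA'|C mC dC e e0].
- by apply: measurable_funM => //; apply: (smeas_meas s); exact: measurableI.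
- have := smeasU s (measurableI _ _ mA mB) (measurableI _ _ mA' mB).
  rewrite setIACA AA' set0I => /(_ erefl); rewrite setIUl.
  by apply: filterS => w ->; rewrite mulrDr.
have ce : 0 < e / (`|c| + 1) by rewrite divr_gt0// ltr_wpDl.
have dC' : decr (fun n => C n `&` B).
  have := decrI B dC; rewrite (_ : (fun n => B `&` C n) = (fun n => C n `&` B))//.
  by apply/funext => n; rewrite setIC.
have [j0 h] := smeas_cont s (fun n => measurableI _ _ (mC n) mB) dC' ce.
exists j0 => j /h; apply: small_scale => //.
by apply: (smeas_meas s); exact: measurableI.
Qed.

Lemma smeas_sint m s : srep s -> smeas P m -> smeas P (sint m s).
Proof.
move=> + sm; elim: s => [_|a s IH /srep_cons[ma /IH h]].
  rewrite (_ : sint _ _ = (fun _ _ => 0)); first exact: smeas_zero.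
  by apply/funext => A; apply/funext => w; rewrite /sint big_nil.
rewrite (_ : sint _ _ = (fun A w => a.1 * m (A `&` a.2) w + sint m s A w)).
  by apply: smeas_add => //; exact: smeas_restr.
by apply/funext => A; apply/funext => w; rewrite /sint big_cons.
Qed.

Variable (nu : nat -> set T -> Omega -> R) (m : set T -> Omega -> R).
Hypothesis snu : forall n, smeas P (nu n).
Hypothesis mm : forall A, measurable A -> measurable_fun setT (m A).
Hypothesis lim : forall A, measurable A -> cvg_prob P (nu ^~ A) (m A).

Let mnu n A : measurable A -> measurable_fun setT (nu n A).
Proof. by move=> mA; exact: (smeas_meas (snu n)). Qed.

Lemma lim_additive A B : measurable A -> measurable B -> A `&` B = set0 ->
  {ae P, forall w, m (A `|` B) w = m A w + m B w}.
Proof.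
move=> mA mB AB; have mAB : measurable (A `|` B) by exact: measurableU.
apply: (@cvg_prob_ae_uniq _ _ _ P (fun n => nu n (A `|` B))) => //.
- by move=> n; exact: mnu.
- exact: mm.
- by apply: measurable_funD; exact: mm.
- exact: lim.
move=> e e0; have e20 : 0 < e / 2 by rewrite divr_gt0.
have [N1 h1] := lim mA e20; have [N2 h2] := lim mB e20.
exists (maxn N1 N2) => n; rewrite geq_max => /andP[/h1 a1 /h2 a2]; rewrite (splitr e).
have mBf C : measurable C -> measurable_fun setT (fun w => nu n C w - m C w).
  by move=> mC; apply: measurable_funB; [exact: mnu|exact: mm].
have := smallD (mBf _ mA) (mBf _ mB) a1 a2; apply: small_ae.
- by apply: measurable_funD; exact: mBf.
- by apply: measurable_funB; [exact: mnu|apply: measurable_funD; exact: mm].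
by apply: filterS (smeasU (snu n) mA mB AB) => w ->; ring.
Qed.

(* Gliding hump: off C k' the limiting set A agrees with a set U' already fixed,
   and two members of the sequence, chosen late, differ on A. *)
Let hump (C : nat -> set T) (e : R) (x y : set T * nat) :=
  [/\ (x.2 < y.2)%N, y.1 `\` C x.2 = x.1 &
    exists p q, [/\ (x.2 <= p)%N, (x.2 <= q)%N & forall A, measurable A ->
      A `\` C y.2 = y.1 -> ~ small P (e / 2) (fun w => nu q A w - nu p A w)]].

(** If A agrees with U' off [C k'], then nu q A - nu p A is (nu q U - nu p U) + nu q (C j), up to
    the values of nu q and nu p on subsets of [C k'] and [C j]. The bracket is small because p and q
    are late; the values on subsets are small by [smeas_unif]; and nu q (C j) is close to m (C j),
    which is not small. *)
Lemma hump_step C e : (forall n, measurable (C n)) -> decr C -> 0 < e ->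
  (forall j0, exists2 j, (j0 <= j)%N & ~ small P e (m (C j))) ->
  forall x, measurable x.1 /\ x.1 `&` C x.2 = set0 ->
  exists2 y, measurable y.1 /\ y.1 `&` C y.2 = set0 & hump C e x y.
Proof.
move=> mC dC e0 hn [U k] /= [mU UC].
(* Six errors of size t, added to the e / 2 in [hump], make e. *)
pose t := e / 12; have t0 : 0 < t by rewrite divr_gt0.
have [m0 hm0] := lim mU t0.
pose p := maxn m0 k.
have [j1 hj1] := smeas_unif (snu p) mC dC t0.
have [j jj nj] := hn (maxn j1 k).
have [n0 hn0] := lim (mC j) t0.
pose q := maxn (maxn m0 n0) k.
have [j2 hj2] := smeas_unif (snu q) mC dC t0.
pose k' := maxn (maxn j2 j) k.+1.
have [jj1 kj] : (j1 <= j)%N /\ (k <= j)%N by move: jj; rewrite geq_max => /andP.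
have [kj2 kjj kk] : [/\ (j2 <= k')%N, (j <= k')%N & (k < k')%N] by rewrite /k'; split; lia.
have CC : C k' `<=` C j by exact: dC.1.
pose U' := U `|` (C j `\` C k').
have mE : measurable (C j `\` C k') by exact: measurableD.
have mU' : measurable U' by exact: measurableU.
have UCk : U `&` C k' = set0.
  rewrite -subset0 => x [Ux Cx]; rewrite -UC; split => //; apply: dC.1 Cx; exact: ltnW.
have UCj : U `&` C j = set0.
  rewrite -subset0 => x [Ux Cx]; rewrite -UC; split => //; exact: dC.1 Cx.
exists (U', k').
  split => //=; rewrite -subset0 => x [[Ux Cx|[_ //]]].
  by rewrite -UCk.
split => //=.
  apply/seteqP; split => x.
    by move=> [[//|[Cj _]]] nC; exfalso; apply: nC; exact: dC.1 Cj.
  by move=> Ux; split; [left|move=> Cx; have : (U `&` C k) x by []; rewrite UC].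
exists p, q; split; [exact: leq_maxr|exact: leq_maxr|].
move=> A mA AU hs; apply: nj.
have mBf r D : measurable D -> measurable_fun setT (fun w => nu r D w - m D w).
  by move=> mD; apply: measurable_funB; [exact: mnu|exact: mm].
have mACk : measurable (A `&` C k') by exact: measurableI.
have mACj : measurable (A `&` C j) by exact: measurableI.
have s1 : small P t (fun w => nu q U w - m U w) by apply: hm0; rewrite /q; lia.
have s2 : small P t (fun w => nu p U w - m U w) by apply: hm0; rewrite /p; lia.
have s3 : small P t (fun w => nu q (C j) w - m (C j) w) by apply: hn0; rewrite /q; lia.
have s4 : small P t (nu q (C k')) by apply: hj2 => //; exact: dC.1.
have s5 : small P t (nu q (A `&` C k')).
  by apply: hj2 => // x [_]; exact: dC.1.
have s6 : small P t (nu p (A `&` C j)).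
  by apply: hj1 => // x [_]; exact: dC.1.
have mD : measurable_fun setT (fun w => nu q A w - nu p A w).
  by apply: measurable_funB; exact: mnu.
have r1 := smallB mD (mBf q _ mU) hs s1.
have mr1 := measurable_funB mD (mBf q _ mU).
have r2 := smallD mr1 (mBf p _ mU) r1 s2.
have mr2 := measurable_funD mr1 (mBf p _ mU).
have r3 := smallB mr2 (mBf q _ (mC j)) r2 s3.
have mr3 := measurable_funB mr2 (mBf q _ (mC j)).
have r4 := smallD mr3 (mnu q (mC k')) r3 s4.
have mr4 := measurable_funD mr3 (mnu q (mC k')).
have r5 := smallB mr4 (mnu q mACk) r4 s5.
have mr5 := measurable_funB mr4 (mnu q mACk).
have r6 := smallD mr5 (mnu p mACj) r5 s6.
have mr6 := measurable_funD mr5 (mnu p mACj).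
rewrite (_ : e / 2 + t + t + t + t + t + t = e) in r6; last by rewrite /t; field.
move: r6; apply: small_ae; [exact: mr6|exact: mm|].
have EA : A = U' `|` (A `&` C k').
  by rewrite -AU; apply/seteqP; split=> x; [move=> Ax; have [?|?] := pselect (C k' x); [right|left]|move=> [[]|[]]].
have EA2 : A = U `|` (A `&` C j).
  rewrite {1}EA; apply/seteqP; split => x.
    move=> [[?|[Cj nC]]|[Ax /CC ?]]; [by left| |by right].
    by right; split => //; rewrite EA; left; right.
  by move=> [Ux|[Ax Cj]]; [left; left|rewrite -EA].
have d1 : U `&` (C j `\` C k') = set0.
  by rewrite -subset0 => x [Ux [Cx _]]; rewrite -UCj.
have d2 : U' `&` (A `&` C k') = set0.
  rewrite -subset0 => x [[Ux|[_ nC]] [_ Cx]] //; by rewrite -UCk.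
have d3 : U `&` (A `&` C j) = set0.
  by rewrite -subset0 => x [Ux [_ Cx]]; rewrite -UCj.
have a1 := smeasU (snu q) mU mE d1.
have a2 := smeasU (snu q) mU' mACk d2.
have a3 := smeasU (snu p) mU mACj d3.
have a4 := smeasD (snu q) (mC j) (mC k') CC.
rewrite -EA in a2; rewrite -EA2 in a3.
by apply: filterS2 (filterI a1 a2) (filterI a3 a4) => w [b1 b2] [b3 b4] /=; rewrite b2 b3 b1 b4; ring.
Qed.

(* Nikodym's convergence theorem. *)
Theorem smeas_lim : smeas P m.
Proof.
split; [exact: mm|exact: lim_additive|move=> C mC dC e e0].
apply: contrapT => hn.
have {}hn j0 : exists2 j, (j0 <= j)%N & ~ small P e (m (C j)).
  apply: contrapT => h; apply: hn; exists j0 => j jj; apply: contrapT => ns.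
  by apply: h; exists j.
have [|f [f0 hf]] := dep_choice (hump_step mC dC e0 hn) (_ : measurable (set0 : set T, 0%N).1 /\ _).
  by split => //=; rewrite set0I.
(* The union agrees with the n-th set off the n-th [C], so every hump occurs on this single set,
   where the sequence converges and is therefore Cauchy. *)
pose A := \bigcup_n (f n).1.
have mA : measurable A by apply: bigcup_measurable => n _; case: (hf n) => -[].
have lek n l : ((f n).2 <= (f (n + l)%N).2)%N.
  elim: l => [|l IH]; first by rewrite addn0.
  by rewrite addnS; apply: leq_trans IH (ltnW _); case: (hf (n + l)%N) => _ [].
have nk n : (n <= (f n).2)%N.
  by elim: n => // n IH; apply: leq_ltn_trans IH _; case: (hf n) => _ [].
have sub n l : (f n).1 `<=` (f (n + l)%N).1.
  elim: l => [|l IH]; first by rewrite addn0.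
  rewrite addnS; apply: subset_trans IH _; case: (hf (n + l)%N) => _ [_ <- _].
  by move=> x [].
have sub2 n l : (f (n + l)%N).1 `\` C (f n).2 `<=` (f n).1.
  elim: l => [|l IH]; first by rewrite addn0 => x [].
  rewrite addnS => x [fx nC]; apply: IH; split => //.
  case: (hf (n + l)%N) => _ [_ <- _]; split => //.
  by move=> Cx; apply: nC; apply: dC.1 Cx.
have AU n : A `\` C (f n).2 = (f n).1.
  apply/seteqP; split => x.
    move=> [[k _ fk] nC]; have [nk'|kn] := leqP n k.
      by apply: (sub2 n (k - n)%N); split => //; rewrite subnKC.
    by rewrite -(subnKC (ltnW kn)); exact: sub.
  move=> fx; split; first by exists n.
  by move=> Cx; have : ((f n).1 `&` C (f n).2) x by []; case: (hf n) => -[_ ->].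
have e40 : 0 < e / 4 by rewrite divr_gt0.
have [N hN] := lim mA e40.
have [_ [_ _ [p [q [Np Nq /(_ A mA (AU _))]]]]] := hf N; apply.
have := smallB _ _ (hN q (leq_trans (nk N) Nq)) (hN p (leq_trans (nk N) Np)).
rewrite (_ : e / 4 + e / 4 = e / 2); last by field.
have mB n : measurable_fun setT (fun w => nu n A w - m A w).
  by apply: measurable_funB; [exact: mnu|exact: mm].
move=> /(_ (mB q) (mB p)); apply: small_ae.
- by apply: measurable_funB; exact: mB.
- by apply: measurable_funB; exact: mnu.
by apply: filterE => w; ring.
Qed.

End closure.

(** * The given stochastic measure as a vector measure *)

Section stochastic.
Context {d : measure_display} {Omega : measurableType d} {R : realType}.
Variable P : probability Omega R.
Variable mu : set R -> {RV P >-> R}.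
Hypothesis mu_sm : stochastic_measure mu.

Let mmu A : measurable_fun setT (mu A : Omega -> R).
Proof. exact: measurable_funPT. Qed.

(** Constant empty sets give mass 0, and padding two sets with empty ones gives additivity. A
    sequence decreasing to the empty set is treated through its consecutive differences, whose
    partial sums telescope to mu (C 0) - mu (C n). *)
Lemma stochastic_smeas : smeas P (fun A w => mu A w).
Proof.
have mu0 : {ae P, forall w, mu set0 w = 0}.
  apply: small_ae0 => // e e0.
  have t0 : trivIset setT (fun _ : nat => set0 : set R) by move=> i j _ _ [x []].
  have [N hN] := cvg_in_probability_cvg_prob (mu_sm (fun=> measurable0) t0)
    (divr_gt0 e0 (ltr0n _ 2)).
  have mS n : measurable_fun setT (fun w => \sum_(i < n) mu set0 w - mu (\bigcup_(_ in [set: nat]) set0) w).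
    by apply: measurable_funB => //; apply: measurable_sum.
  have := smallB (mS N.+1) (mS N) (hN _ (leqnSn N)) (hN N (leqnn _)).
  rewrite -splitr; apply: small_ae => //; first exact: measurable_funB.
  by apply: filterE => w; rewrite big_ord_recr/=; ring.
have add A B : measurable A -> measurable B -> A `&` B = set0 ->
    {ae P, forall w, mu (A `|` B) w = mu A w + mu B w}.
  move=> mA mB AB.
  pose S n := if n is 0%N then A else if n is 1%N then B else set0.
  have mS n : measurable (S n) by case: n => [|[|n]] /=; [exact: mA|exact: mB|exact: measurable0].
  have tS : trivIset setT S.
    apply/trivIsetP => -[|[|i]] [|[|j]] _ _ // _; rewrite /S ?setI0 ?set0I//.
    by rewrite setIC.
  have ES : \bigcup_n S n = A `|` B.
    apply/seteqP; split => x; first by move=> [[|[|n]] _ //=]; [left|right].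
    by move=> [Ax|Bx]; [exists 0%N|exists 1%N].
  have := cvg_in_probability_cvg_prob (mu_sm mS tS); rewrite ES => h.
  have : {ae P, forall w, mu A w + mu B w - mu (A `|` B) w = 0}.
    apply: small_ae0; first by apply: measurable_funB => //; exact: measurable_funD.
    move=> e e0; have [N hN] := h e e0; have := hN N.+2 (leqW (leqnSn N)).
    apply: small_ae.
    - by apply: measurable_funB => //; apply: measurable_sum.
    - by apply: measurable_funB => //; exact: measurable_funD.
    apply: filterS mu0 => w w0; rewrite !big_ord_recl/= big1 ?addr0//.
  by apply: filterS => w /eqP; rewrite subr_eq0 => /eqP.
split => // C mC dC e e0.
pose D n := C n `\` C n.+1.
have mD n : measurable (D n) by exact: measurableD.
have tD : trivIset setT D.
  have hlt i j x : (i < j)%N -> D i x -> D j x -> False.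
    by move=> ij [_ nC] [Cj _]; apply: nC; exact: dC.1 Cj.
  move=> i j _ _ [x [Di Dj]]; apply/eqP; rewrite eqn_leq; apply/andP; split;
    by rewrite leqNgt; apply/negP => /hlt; apply; eassumption.
have ED : \bigcup_n D n = C 0%N.
  apply/seteqP; split => x; first by move=> [n _ [Cn _]]; exact: dC.1 Cn.
  move=> C0; have [n nC] := decr_notin x dC.
  elim: n nC => // n IH nC; have [Cn|/IH//] := pselect (C n x).
  by exists n.
have SD n : {ae P, forall w, \sum_(i < n) mu (D i) w = mu (C 0%N) w - mu (C n) w}.
  elim: n => [|n IH]; first by apply: filterE => w; rewrite big_ord0 subrr.
  have hC : C n.+1 `<=` C n by exact: dC.1.
  have := add _ _ (mD n) (mC n.+1).
  have -> : D n `|` C n.+1 = C n by rewrite /D setUC setDUK.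
  have dd : D n `&` C n.+1 = set0 by rewrite -subset0 => x [[]].
  move=> /(_ dd); apply: filterS2 IH => w {}IH h.
  by rewrite big_ord_recr/= IH h; ring.
have [N hN] := cvg_in_probability_cvg_prob (mu_sm mD tD) e0.
exists N => n /hN; rewrite ED => /smallN; apply: small_ae => //.
  by apply: measurableT_comp => //; apply: measurable_funB => //; apply: measurable_sum.
by apply: filterS (SD n) => w ->; ring.
Qed.

End stochastic.

(** * Integrands dominated by an integrable function *)

Section integral.
Context {d : measure_display} {Omega : measurableType d} {R : realType}.
Variable P : probability Omega R.
Context {dT : measure_display} {T : measurableType dT}.
Implicit Types m : set T -> Omega -> R.

Definition null_set m (N : set T) := measurable N /\
  forall B, measurable B -> B `<=` N -> {ae P, forall w, m B w = 0}.

Lemma null_set_sint m s N : srep s -> null_set m N -> null_set (sint m s) N.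
Proof.
move=> + [mN hN]; elim: s => [_|a s IH /srep_cons[ma /IH[_ h]]]; split => // B mB BN.
  by apply: filterE => w; rewrite /sint big_nil.
have ha : {ae P, forall w, m (B `&` a.2) w = 0}.
  by apply: hN; [exact: measurableI|move=> x [/BN]].
apply: filterS2 ha (h B mB BN) => w h1 h2.
by rewrite /sint big_cons -/(sint m s B w) h1 h2 mulr0 addr0.
Qed.

Lemma smeas_cont_null m C N e : smeas P m -> (forall n, measurable (C n)) ->
  (forall i j, (i <= j)%N -> C j `<=` C i) -> null_set m N -> \bigcap_n C n `<=` N ->
  0 < e -> exists j0, forall j, (j0 <= j)%N -> small P e (m (C j)).
Proof.
move=> sm mC dC [mN hN] CN e0.
have mD n : measurable (C n `\` N) by exact: measurableD.
have dD : decr (fun n => C n `\` N).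
  split => [i j ij x [Cx nN]|]; first by split => //; exact: dC Cx.
  rewrite -subset0 => x hx; have [_ nN] := hx 0%N I; apply: nN; apply: CN => n _.
  by have [] := hx n I.
have [j0 h] := smeas_cont sm mD dD e0.
exists j0 => j /h; apply: small_ae; [exact: (smeas_meas sm)..|].
have mI : measurable (C j `&` N) by exact: measurableI.
have dd : (C j `\` N) `&` (C j `&` N) = set0 by rewrite -subset0 => x [[_ ?] []].
have h0 := hN _ mI (@subIsetr _ _ _).
have := smeasU sm (mD j) mI dd; rewrite setUC setUIDK.
by apply: filterS2 h0 => w -> ->; rewrite addr0.
Qed.

Lemma measurable_sfun (s : seq (R * set T)) : srep s -> measurable_fun setT (sfun s).
Proof.
elim: s => [_|a s IH /srep_cons[ma /IH h]].
  by rewrite (_ : sfun _ = cst 0)//; apply/funext => y; rewrite /sfun big_nil.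
rewrite (_ : sfun _ = (fun y => a.1 * \1_(a.2) y + sfun s y)).
  by apply: measurable_funD => //; apply: measurable_funM => //; exact: measurable_indic.
by apply/funext => y; rewrite /sfun big_cons.
Qed.

(** Represents a product of simple functions. Integrating it against [m] amounts to integrating [h]
    against the indefinite integral of [s]. *)
Definition sprod (h s : seq (R * set T)) := [seq (a.1 * b.1, a.2 `&` b.2) | a <- h, b <- s].

Lemma srep_prod h s : srep h -> srep s -> srep (sprod h s).
Proof.
move=> + ms; elim: h => [//|a h IH /srep_cons[ma /IH mh]].
rewrite /sprod allpairs_cons; apply: srep_cat => //.
elim: s ms {IH mh} => [//|b s IH /srep_cons[mb /IH h1]] /=.
by apply: srepI => //=; exact: measurableI.
Qed.

Lemma sfun_prod h s y : sfun (sprod h s) y = sfun h y * sfun s y.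
Proof.
rewrite /sfun /sprod big_allpairs_dep mulr_suml; apply: eq_bigr => a _.
rewrite mulr_sumr; apply: eq_bigr => b _ /=.
by rewrite indicI /=; ring.
Qed.

Lemma sint_prod m h s B w :
  sint m (sprod h s) B w = \sum_(a <- h) a.1 * sint m s (B `&` a.2) w.
Proof.
rewrite /sint /sprod big_allpairs_dep; apply: eq_bigr => a _.
by rewrite mulr_sumr; apply: eq_bigr => b _ /=; rewrite mulrA setIA.
Qed.

Lemma sfun_comp m (F : R -> R -> R) (s1 s2 : seq (R * set T)) : smeas P m -> srep s1 -> srep s2 ->
  exists2 h, srep h & forall y, sfun h y = F (sfun s1 y) (sfun s2 y).
Proof.
move=> sm /(sint_atoms sm)[I [f [v [mf fv _]]]] /(sint_atoms sm)[J [g [u [mg gu _]]]].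
have mfg := measurable_fibers_pair mf mg.
pose fg x := (f x, g x).
exists [seq (F (v p.1) (u p.2), fg @^-1` [set p]) | p <- enum {: I * J}].
  elim: (enum _) => //= p r IH; apply: srepI => //; exact: mfg.
move=> y; rewrite {1}/sfun big_map big_enum/= (bigD1 (fg y))//= big1 ?addr0.
  by rewrite indicE mem_set// mulr1 fv gu.
move=> p /eqP pf; rewrite indicE memNset ?mulr0//= => fp; exact: pf.
Qed.

Section limit.
Variables (m nu : set T -> Omega -> R) (s : nat -> seq (R * set T)) (N : set T) (g : T -> R).
Hypothesis sm : smeas P m.
Hypothesis rs : forall n, srep (s n).
Hypothesis nN : null_set m N.
Hypothesis mg : measurable_fun setT g.
Hypothesis cs : forall y, ~ N y -> sfun (s n) y @[n --> \oo] --> g y.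
Hypothesis mnu : forall A, measurable A -> measurable_fun setT (nu A).
Hypothesis hnu : forall A, measurable A -> cvg_prob P (fun n => sint m (s n) A) (nu A).

Lemma smeas_lim_sint : smeas P nu.
Proof.
apply: (@smeas_lim _ _ _ P _ _ (fun n => sint m (s n))) => // n; exact: smeas_sint.
Qed.

(** The sets of Egorov's theorem: their complements decrease to a null set, and on them the
    approximation is uniform. *)
Definition near_set (de : R) j := [set y | forall n, (j <= n)%N -> `|sfun (s n) y - g y| <= de].

Lemma measurable_near de j : measurable (near_set de j).
Proof.
have mX n : measurable_fun setT (fun y => `|sfun (s n) y - g y|).
  by apply: measurableT_comp => //; apply: measurable_funB => //; exact: measurable_sfun.
rewrite (_ : near_set _ _ = \bigcap_(n in [set n | (j <= n)%N])
    (setT `&` (fun y => `|sfun (s n) y - g y|) @^-1` `]-oo, de])).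
  by apply: bigcap_measurable => [|n _]; [exists j => /=|exact: mX].
apply/seteqP; split => y h n; last by move=> jn; have [_ /=] := h n jn; rewrite in_itv.
by move=> jn; split => //=; rewrite in_itv /= h.
Qed.

Lemma near_decr de : forall i j, (i <= j)%N -> ~` near_set de j `<=` ~` near_set de i.
Proof. by move=> i j ij x h h2; apply: h => n jn; apply: h2; exact: leq_trans jn. Qed.

Lemma near_null de : 0 < de -> \bigcap_n ~` near_set de n `<=` N.
Proof.
move=> de0 y hy; apply: contrapT => nNy.
have /cvgr_dist_le /(_ _ de0) [j _ hj] := cs nNy.
by apply: (hy j I) => n jn; rewrite distrC; exact: hj.
Qed.

Lemma cvg_prob_sint_prod h B : srep h -> measurable B ->
  cvg_prob P (fun n => sint m (sprod h (s n)) B) (sint nu h B).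
Proof.
move=> + mB; elim: h => [_|a h IH /srep_cons[ma rh]] e e0.
  exists 0%N => n _; apply: (@small_ae _ _ _ P _ (cst 0)) => //.
  - apply: measurable_funB; first by apply: (measurable_sint sm) => //.
    by apply: (measurable_sint smeas_lim_sint).
  - apply: filterE => w /=; by rewrite /sint !big_nil subrr.
  exact: small0.
have e20 : 0 < e / 2 by rewrite divr_gt0.
have ce : 0 < (e / 2) / (`|a.1| + 1) by rewrite divr_gt0// ltr_wpDl.
have mBa : measurable (B `&` a.2) by exact: measurableI.
have [N1 h1] := hnu mBa ce; have [N2 h2] := IH rh _ e20.
exists (maxn N1 N2) => n; rewrite geq_max => /andP[/h1 b1 /h2 b2].
have m1 : measurable_fun setT (fun w => sint m (s n) (B `&` a.2) w - nu (B `&` a.2) w).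
  by apply: measurable_funB; [exact: (measurable_sint sm)|exact: mnu].
have m2 : measurable_fun setT (fun w => sint m (sprod h (s n)) B w - sint nu h B w).
  apply: measurable_funB; last exact: (measurable_sint smeas_lim_sint).
  by apply: (measurable_sint sm) => //; exact: srep_prod.
have := smallD (measurable_funM (measurable_cst a.1) m1) m2 (small_scale m1 e20 b1) b2.
rewrite -splitr; congr (small _ _ _); apply/funext => w /=.
rewrite !sint_prod big_cons /sint !big_cons -/(sint nu h B w); ring.
Qed.

(** Off an Egorov set B, chosen depending on f, the integral of f is small. On B, with h = f / (s_j
    + 2) and n large, f is the sum of h s_n and of h (s_j + 2 - s_n). The latter is bounded by 4, so
    its integral is controlled by the boundedness of [m]; the integral of h s_n is close to that of
    h against [nu], controlled by the boundedness of [nu]. The two bounds do not depend on f. *)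
Lemma simple_dominated (e : R) : (forall y, 0 <= g y) -> 0 < e ->
  exists2 a : R, 0 < a & forall f, srep f -> (forall y, `|sfun f y| <= 1 + g y) ->
    pr P [set w | a <= `|sint m f setT w|] <= e.
Proof.
move=> g0 e0; have e40 : 0 < e / 4 by rewrite divr_gt0.
have [a1 a10 h1] := smeas_convex_bounded sm e40.
have [a2 a20 h2] := smeas_convex_bounded smeas_lim_sint e40.
pose t := Num.min 1 (e / 4); have t0 : 0 < t by rewrite lt_min ltr01.
have small1 (X : Omega -> R) : measurable_fun setT X -> small P t X ->
    pr P [set w | 1 <= `|X w|] <= e / 4.
  move=> mX h; apply: (@le_trans _ _ t); last by rewrite ge_min lexx orbT.
  apply: le_trans h; apply: le_pr; [exact: measurable_norm_ge..|].
  by move=> w /=; apply: le_trans; rewrite ge_min lexx.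
exists (4 * a1 + a2 + 2); first by rewrite !addr_gt0// mulr_gt0.
move=> f rf hf.
have mB j : measurable (near_set 1 j) by exact: measurable_near.
have [j /(_ j (leqnn _)) hj] := smeas_cont_null (smeas_sint rf sm)
  (fun j => measurableC (mB j)) (near_decr (de := 1)) (null_set_sint rf nN)
  (near_null ltr01) t0.
set B := near_set 1 j in hj; have mB1 : measurable B by exact: mB.
(* On B the function s_j is at least g - 1, so the denominator is at least 1 + g, which dominates
   |f|. *)
have [h rh hE] := sfun_comp (fun x y => x / (y + 2)) sm rf (@rs j).
have [n0 hn0] := cvg_prob_sint_prod rh (mB j) t0.
pose n := maxn n0 j; have {}hn0 := hn0 n (leq_maxl _ _).
have rhn : srep (sprod h (s n)) by exact: srep_prod.
pose psi := f ++ sscale (- 1) (sprod h (s n)).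
have rpsi : srep psi by apply: srep_cat => //; exact: srep_scale.
have hB1 y : B y -> 1 + g y <= sfun (s j) y + 2.
  by move=> /(_ j (leqnn _)); rewrite ler_norml => /andP[+ _]; lra.
have hh y : B y -> `|sfun h y| <= 1.
  move=> By; have := hB1 y By; have := g0 y; have := hf y => ? ? ?.
  have p0 : 0 < sfun (s j) y + 2 by lra.
  by rewrite hE normrM normfV (gtr0_norm p0) ler_pdivrMr// mul1r; lra.
have hpsi y : B y -> `|sfun psi y| <= 4.
  move=> By; rewrite sfun_cat sfun_scale sfun_prod.
  have p0 : 0 < sfun (s j) y + 2 by have := hB1 y By; have := g0 y; lra.
  have -> : sfun f y + -1 * (sfun h y * sfun (s n) y) =
     sfun h y * (sfun (s j) y + 2 - sfun (s n) y).
    by rewrite hE; field; rewrite gt_eqF.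
  rewrite normrM -[leRHS]mul1r; apply: ler_pM => //; first exact: hh.
  have := By j (leqnn _); have := By n (leq_maxr _ _); rewrite !ler_norml.
  by move=> /andP[? ?] /andP[? ?]; apply/andP; split; lra.
pose X1 := sint m f (~` B); pose X2 := sint m psi B.
pose X3 w := sint m (sprod h (s n)) B w - sint nu h B w; pose X4 := sint nu h B.
have mX1 : measurable_fun setT X1 by apply: (measurable_sint sm) => //; exact: measurableC.
have mX2 : measurable_fun setT X2 by exact: (measurable_sint sm).
have mX4 : measurable_fun setT X4 by exact: (measurable_sint smeas_lim_sint).
have mX3 : measurable_fun setT X3 by apply: measurable_funB => //; exact: (measurable_sint sm).
have E : {ae P, forall w, sint m f setT w = X1 w + (X2 w + (X3 w + X4 w))}.
  have := smeasU (smeas_sint rf sm) (measurableC (mB j)) (mB j) (setICl _).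
  rewrite setUC setUv; apply: filterS => w ->; congr (_ + _).
  by rewrite /X2 /X3 /X4 sint_cat sint_scale; ring.
apply: (@le_trans _ _ (pr P [set w | 4 * a1 + a2 + 2 <= `|X1 w + (X2 w + (X3 w + X4 w))|])).
  apply: le_pr_ae; [apply: measurable_norm_ge; exact: (measurable_sint sm)| |].
    by apply: measurable_norm_ge; do 3 apply: measurable_funD => //.
  by apply: filterS E => w /= ->.
have mX34 : measurable_fun setT (fun w => X3 w + X4 w) by exact: measurable_funD.
have mX234 : measurable_fun setT (fun w => X2 w + (X3 w + X4 w)) by exact: measurable_funD.
have q1 : pr P [set w | 1 <= `|X1 w|] <= e / 4 by exact: small1.
have q2 : pr P [set w | 4 * a1 <= `|X2 w|] <= e / 4 by exact: h1.
have q3 : pr P [set w | 1 <= `|X3 w|] <= e / 4 by exact: small1.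
have q4 : pr P [set w | 1 * a2 <= `|X4 w|] <= e / 4 by apply: h2 => //; exact: hh.
rewrite mul1r in q4.
have r1 : pr P [set w | 1 + a2 <= `|X3 w + X4 w|] <=
    pr P [set w | 1 <= `|X3 w|] + pr P [set w | a2 <= `|X4 w|].
  apply: pr_leU2; [exact: measurable_norm_ge..|] => w /= hw.
  have [?|?] := leP 1 `|X3 w|; [by left|right].
  have := ler_normD (X3 w) (X4 w); lra.
have r2 : pr P [set w | 4 * a1 + (1 + a2) <= `|X2 w + (X3 w + X4 w)|] <=
    pr P [set w | 4 * a1 <= `|X2 w|] + pr P [set w | 1 + a2 <= `|X3 w + X4 w|].
  apply: pr_leU2; [exact: measurable_norm_ge..|] => w /= hw.
  have [?|?] := leP (4 * a1) `|X2 w|; [by left|right].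
  have := ler_normD (X2 w) (X3 w + X4 w); lra.
have : pr P [set w | 4 * a1 + a2 + 2 <= `|X1 w + (X2 w + (X3 w + X4 w))|] <=
    pr P [set w | 1 <= `|X1 w|] + pr P [set w | 4 * a1 + (1 + a2) <= `|X2 w + (X3 w + X4 w)|].
  apply: pr_leU2; [apply: measurable_norm_ge; exact: measurable_funD|exact: measurable_norm_ge..|].
  move=> w /= hw.
  have [?|?] := leP 1 `|X1 w|; [by left|right].
  have := ler_normD (X1 w) (X2 w + (X3 w + X4 w)); lra.
by move: q1 q2 q3 q4 r1 r2; lra.
Qed.

(** The integral was defined through the sequence [s]; it may be computed with any simple functions
    [psi k] that are uniformly close to g on sets [D k] exhausting the space. On an Egorov set
    inside [D k], psi_k and a late s_n differ by at most 2 * de k, so [smeas_convex_bounded]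
    compares their integrals. *)
Lemma integral_approx (psi : nat -> seq (R * set T)) (D : nat -> set T) (de : nat -> R) e :
  (forall k, srep (psi k)) -> (forall k, measurable (D k)) -> decr (fun k => ~` D k) ->
  (forall k, 0 < de k) -> de k @[k --> \oo] --> 0 ->
  (forall k y, D k y -> `|sfun (psi k) y - g y| <= de k) -> 0 < e ->
  exists k0, forall k, (k0 <= k)%N -> small P e (fun w => nu setT w - sint m (psi k) (D k) w).
Proof.
(* Five errors: [nu] off [D k]; [nu] and the integral of psi_k on the part of [D k] off the Egorov
   set; the convergence of s_n on the rest; and the integral of s_n - psi_k there. *)
move=> rp mD dD de0 de_lim hp e0; pose t := e / 5; have t0 : 0 < t by rewrite divr_gt0.
have snu := smeas_lim_sint.
have [a a0 ha] := smeas_convex_bounded sm t0.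
have [k1 hk1] := smeas_cont snu (fun k => measurableC (mD k)) dD t0.
have at0 : 0 < t / (2 * a) by rewrite divr_gt0// mulr_gt0.
have /cvgr_lt /(_ _ at0) [k2 _ hk2] := de_lim.
exists (maxn k1 k2) => k; rewrite geq_max => /andP[/hk1 s1 k2k].
have dek : 2 * de k * a <= t.
  have := hk2 k k2k; rewrite ltr_pdivlMr ?mulr_gt0// => /ltW.
  by rewrite mulrA [_ * 2]mulrC.
have mN j : measurable (near_set (de k) j) by exact: measurable_near.
have mC j : measurable (~` near_set (de k) j) by exact: measurableC.
have mDC j : measurable (D k `\` near_set (de k) j) by exact: measurableD.
have dDC i j : (i <= j)%N -> D k `\` near_set (de k) j `<=` D k `\` near_set (de k) i.
  by move=> ij x [Dx nx]; split => //; exact: near_decr ij _ nx.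
have DCN : \bigcap_j (D k `\` near_set (de k) j) `<=` N.
  apply: subset_trans (near_null (de0 k)); by move=> x hx j _; have [] := hx j I.
have nnu : null_set nu N.
  case: nN => mN' hN; split => // B mB BN.
  apply: (@cvg_prob_ae_uniq _ _ _ P (fun n => sint m (s n) B)) => //.
  - by move=> n; exact: (measurable_sint sm).
  - exact: mnu.
  - exact: hnu.
  move=> e' e'0; exists 0%N => n _.
  have [_ /(_ B mB BN) h0] := null_set_sint (@rs n) nN.
  have := @small0 _ _ _ P _ e'0; apply: small_ae => //.
    by apply: measurable_funB => //; exact: (measurable_sint sm).
  by apply: filterS h0 => w ->; rewrite subr0.
have [j1 hj1] := smeas_cont_null snu mDC dDC nnu DCN t0.
have [j2 hj2] := smeas_cont_null (smeas_sint (rp k) sm) mDC dDC (null_set_sint (rp k) nN) DCN t0.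
pose j := maxn j1 j2.
have s2 := hj1 j (leq_maxl _ _); have s3 := hj2 j (leq_maxr _ _).
pose E := D k `&` near_set (de k) j.
have mE : measurable E by exact: measurableI.
have [n1 hn1] := hnu mE t0; pose n := maxn n1 j.
have s4 := hn1 n (leq_maxl _ _).
pose r := s n ++ sscale (- 1) (psi k).
have rr : srep r by apply: srep_cat => //; exact: srep_scale.
have s5 : small P t (sint m r E).
  have h2 : pr P [set w | 2 * de k * a <= `|sint m r E w|] <= t.
    apply: ha => //; first by rewrite mulr_gt0.
    move=> y [Dy Ny]; rewrite sfun_cat sfun_scale mulN1r.
    have := hp k y Dy; have := Ny n (leq_maxr _ _); rewrite !ler_norml.
    by move=> /andP[? ?] /andP[? ?]; apply/andP; split; lra.
  apply: le_trans h2; apply: le_pr; [by apply: measurable_norm_ge; exact: (measurable_sint sm)..|].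
  by move=> w /=; exact: le_trans.
have mm A f : measurable A -> srep f -> measurable_fun setT (sint m f A).
  by move=> mA rf; exact: (measurable_sint sm).
have m1 : measurable_fun setT (nu (~` D k)) by apply: mnu; exact: measurableC.
have m2 : measurable_fun setT (nu (D k `\` near_set (de k) j)) by exact: mnu.
have m3 := mm _ _ (mDC j) (rp k).
have m4 : measurable_fun setT (fun w => sint m (s n) E w - nu E w).
  by apply: measurable_funB; [exact: mm|exact: mnu].
have m5 := mm _ _ mE rr.
have u12 := smallD m1 m2 s1 s2; have n12 := measurable_funD m1 m2.
have u3 := smallB n12 m3 u12 s3; have n3 := measurable_funB n12 m3.
have u4 := smallB n3 m4 u3 s4; have n4 := measurable_funB n3 m4.
have u5 := smallD n4 m5 u4 s5; have n5 := measurable_funD n4 m5.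
rewrite (_ : t + t + t + t + t = e) in u5; last by rewrite /t; field.
move: u5; apply: small_ae => //.
  by apply: measurable_funB; [exact: mnu|exact: mm].
have b1 := smeasU snu (measurableC (mD k)) (mD k) (setICl _).
have dd : (D k `\` near_set (de k) j) `&` E = set0.
  by rewrite -subset0 => x [[_ ?] []].
have EE : (D k `\` near_set (de k) j) `|` E = D k by rewrite /E setUC setUIDK.
have b2 := smeasU snu (mDC j) mE dd; have b3 := smeasU (smeas_sint (rp k) sm) (mDC j) mE dd.
rewrite EE in b2 b3; rewrite setUC setUv in b1.
apply: filterS3 b1 b2 b3 => w c1 c2 c3 /=; rewrite c1 c2 c3 /r sint_cat sint_scale; ring.
Qed.

End limit.
End integral.

(** * Hoelder integrands *)

Section dyadic_sets.
Variable R : realType.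
Implicit Types y : R.

(** Cells open on the left and closed on the right, indexed by a side of the origin and a distance
    from it. The parent of cell k is then [k./2] on both sides, and k / 2^n is a lower bound for
    |y|. *)
Definition dyadic (b : bool) (n k : nat) : set R :=
  if b then [set y | k%:R < y * 2 ^+ n <= k.+1%:R]
  else [set y | k%:R <= - (y * 2 ^+ n) < k.+1%:R].

(** The end of the cell nearest to the origin, a point of the cell only when [b] is false. A cell
    and its parent have the same point or adjacent ones of the finer grid. *)
Definition dyadic_pt (b : bool) (n k : nat) : R := (if b then k%:R else - k%:R) / 2 ^+ n.

Lemma pow2_gt0 n : 0 < 2 ^+ n :> R. Proof. exact: exprn_gt0. Qed.
Hint Resolve pow2_gt0 : core.

Lemma measurable_dyadic b n k : measurable (dyadic b n k).
Proof.
have mz : measurable_fun setT (fun y : R => y * 2 ^+ n) by exact: measurable_funM.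
case: b; rewrite /dyadic.
  rewrite (_ : [set y | _] = setT `&` (fun y : R => y * 2 ^+ n) @^-1` `]k%:R, k.+1%:R]).
    exact: mz.
  by apply/seteqP; split => y /=; rewrite in_itv //= => -[].
have mNz : measurable_fun setT (fun y : R => - (y * 2 ^+ n)) by exact: measurableT_comp.
rewrite (_ : [set y | _] = setT `&` (fun y : R => - (y * 2 ^+ n)) @^-1` `[k%:R, k.+1%:R[).
  exact: mNz.
by apply/seteqP; split => y /=; rewrite in_itv //= => -[].
Qed.

Lemma nat_sandwich (a b : nat) (x : R) : a%:R <= x -> x < b.+1%:R -> (a <= b)%N.
Proof. by move=> h1 h2; rewrite -ltnS -(ltr_nat R); exact: le_lt_trans h2. Qed.

Lemma nat_sandwich' (a b : nat) (x : R) : a%:R < x -> x <= b.+1%:R -> (a <= b)%N.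
Proof. by move=> h1 h2; rewrite -ltnS -(ltr_nat R); exact: lt_le_trans h2. Qed.

Lemma dyadic_uniq n b k b' k' y : dyadic b n k y -> dyadic b' n k' y -> b = b' /\ k = k'.
Proof.
have cross k1 k2 : dyadic true n k1 y -> dyadic false n k2 y -> False.
  rewrite /dyadic /= => /andP[h1 _] /andP[h2 _].
  by have : 0 <= k1%:R :> R by []; have : 0 <= k2%:R :> R by []; lra.
case: b; case: b' => h h'; try by case: (cross _ _ h h').
- split => //; move: h h'; rewrite /dyadic /= => /andP[h1 h2] /andP[h3 h4].
  by apply/eqP; rewrite eqn_leq (nat_sandwich' h1 h4) (nat_sandwich' h3 h2).
- by case: (cross _ _ h' h).
- split => //; move: h h'; rewrite /dyadic /= => /andP[h1 h2] /andP[h3 h4].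
  by apply/eqP; rewrite eqn_leq (nat_sandwich h1 h4) (nat_sandwich h3 h2).
Qed.

Lemma dyadic_split b n k : dyadic b n k = dyadic b n.+1 k.*2 `|` dyadic b n.+1 k.*2.+1.
Proof.
have e1 : k.*2%:R = 2 * k%:R :> R by rewrite -mul2n natrM.
have e2 : k.*2.+1%:R = 2 * k%:R + 1 :> R by rewrite -natr1 e1.
have e3 : k.*2.+2%:R = 2 * k%:R + 2 :> R by rewrite -natr1 e2; ring.
have e4 : k.+1%:R = k%:R + 1 :> R by rewrite natr1.
case: b; rewrite /dyadic; apply/seteqP; split => y /=; rewrite exprSr mulrA e1 e2 e3 e4;
  set z := y * 2 ^+ n; set x := k%:R.
- move=> /andP[? ?]; have [?|?] := leP (z * 2) (2 * x + 1).
    by left; apply/andP; split; lra.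
  by right; apply/andP; split; lra.
- by move=> [] /andP[? ?]; apply/andP; split; lra.
- move=> /andP[? ?]; have [?|?] := ltP (- (z * 2)) (2 * x + 1).
    by left; apply/andP; split; lra.
  by right; apply/andP; split; lra.
- by move=> [] /andP[? ?]; apply/andP; split; lra.
Qed.

Lemma dyadic_dist b n k y : dyadic b n k y -> `|y - dyadic_pt b n k| <= (2 ^+ n)^-1.
Proof.
have -> : y - dyadic_pt b n k = (y * 2 ^+ n - (if b then k%:R else - k%:R)) / 2 ^+ n.
  by rewrite /dyadic_pt mulrBl mulfK ?gt_eqF.
have e4 : k.+1%:R = k%:R + 1 :> R by rewrite natr1.
move=> h; rewrite normrM normfV (gtr0_norm (pow2_gt0 n)) -[leRHS]mul1r ler_pM2r ?invr_gt0//.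
by case: b h; rewrite /dyadic /= e4 ler_norml => /andP[? ?]; apply/andP; split; lra.
Qed.

Lemma dyadic_norm b n k y : dyadic b n k y -> k%:R / 2 ^+ n <= `|y|.
Proof.
move=> h; rewrite ler_pdivrMr// -[2 ^+ n]gtr0_norm// -normrM.
case: b h; rewrite /dyadic /= => /andP[h1 h2].
  by apply: le_trans (ler_norm _); exact: ltW.
by apply: le_trans h1 _; rewrite -normrN ler_norm.
Qed.

Lemma dyadic_pt_parent b n k : `|dyadic_pt b n.+1 k - dyadic_pt b n k./2| <= (2 ^+ n.+1)^-1.
Proof.
have ek : k%:R = (odd k)%:R + 2 * (k./2)%:R :> R.
  by rewrite -natrM mul2n -natrD odd_double_half.
have -> : dyadic_pt b n.+1 k - dyadic_pt b n k./2 = (if b then (odd k)%:R else - (odd k)%:R) / 2 ^+ n.+1.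
  rewrite /dyadic_pt exprSr; case: b; rewrite ek; field; by rewrite gt_eqF.
rewrite normrM normfV (gtr0_norm (pow2_gt0 n.+1)) -[leRHS]mul1r ler_pM2r ?invr_gt0//.
by case: b; rewrite ?normrN; case: (odd k); rewrite ?normr0 ?normr1.
Qed.

Definition box (m : nat) : set R := [set y | - m%:R < y <= m%:R].

Lemma measurable_box m : measurable (box m).
Proof.
by rewrite (_ : box m = `](- m%:R), m%:R]%classic).
Qed.

Lemma decr_box : decr (fun m => ~` box m).
Proof.
split => [i j ij y nb ib|].
  apply: nb; move: ib; rewrite /box /= => /andP[? ?].
  have : i%:R <= j%:R :> R by rewrite ler_nat.
  by move=> ?; apply/andP; split; lra.
rewrite -subset0 => y /(_ (Num.trunc `|y|).+1 I); apply.
have := truncnS_gt `|y|; rewrite ltr_norml /box /= => /andP[-> /ltW ->] //.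
Qed.

Lemma dyadic_box m n b k : (k < m * 2 ^ n)%N -> dyadic b n k `<=` box m.
Proof.
move=> km y; have : k.+1%:R <= m%:R * 2 ^+ n :> R.
  by rewrite -natrX -natrM ler_nat.
have k0 : 0 <= k%:R :> R by [].
have hp := pow2_gt0 n; have m0 : 0 <= m%:R :> R by [].
rewrite /dyadic /box => h; case: b => /= /andP[h1 h2]; apply/andP; split.
- by apply: (@le_lt_trans _ _ 0); [rewrite oppr_le0|rewrite -(pmulr_lgt0 _ hp); exact: le_lt_trans h1].
- by rewrite -(ler_pM2r hp); exact: le_trans h.
- by rewrite -(ltr_pM2r hp) mulNr ltrNl; exact: lt_le_trans h.
- apply: (@le_trans _ _ 0) => //; rewrite -(pmulr_lle0 _ hp) -oppr_ge0; exact: le_trans h1.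
Qed.

Lemma box_dyadic m n y : box m y -> exists b k, (k < m * 2 ^ n)%N /\ dyadic b n k y.
Proof.
rewrite /box /= => /andP[h1 h2]; have hp := pow2_gt0 n; pose z := y * 2 ^+ n.
have mE : (m * 2 ^ n)%:R = m%:R * 2 ^+ n :> R by rewrite natrM natrX.
have [z0|z0] := ltP 0 z.
  have zm : z <= (m * 2 ^ n)%:R by rewrite mE ler_pM2r.
  have ex : exists k, z <= k.+1%:R.
    by exists (Num.trunc z); exact: ltW (truncnS_gt z).
  case: (ex_minnP ex) => k hk kmin; exists true, k.
  have kz : k%:R < z.
    case: k hk kmin => // k hk kmin; rewrite ltNge; apply/negP => zk.
    by have := kmin k zk; rewrite ltnn.
  split; last by rewrite /dyadic /= kz hk.
  by rewrite -(ltr_nat R); exact: lt_le_trans zm.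
have z0' : 0 <= - z by rewrite oppr_ge0.
have := truncn_itv z0'; set k := Num.trunc (- z) => /andP[k1 k2].
exists false, k; split; last by rewrite /dyadic /= k1 k2.
rewrite -(ltr_nat R); apply: le_lt_trans k1 _; rewrite mE ltrNl -mulNr ltr_pM2r//.
Qed.

Lemma sum_double (V : zmodType) N (F : nat -> V) :
  \sum_(k <- iota 0 N.*2) F k = \sum_(k <- iota 0 N) (F k.*2 + F k.*2.+1).
Proof.
elim: N => [|N IH]; first by rewrite !big_nil.
rewrite -[in iota 0 N.+1]addn1 iotaD big_cat doubleS -[N.*2.+2]addn2 iotaD big_cat IH /=.
by rewrite !big_cons !big_nil ?add0n ?addr0.
Qed.

Definition dyadic_level m n := [seq (b, k) | b <- [:: true; false], k <- iota 0 (m * 2 ^ n)].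

Lemma mem_dyadic_level m n b k : ((b, k) \in dyadic_level m n) = (k < m * 2 ^ n)%N.
Proof.
apply/allpairsP/idP => [[[b' k'] /= [_ + [_ ->]]]|km]; first by rewrite mem_iota.
by exists (b, k); split => //=; [case: b|rewrite mem_iota].
Qed.

Lemma uniq_dyadic_level m n : uniq (dyadic_level m n).
Proof. by apply: allpairs_uniq => //; [exact: iota_uniq|move=> [? ?] [? ?] _ _ /=]. Qed.

Lemma sum_lev1 m n (F : bool * nat -> R) y b k : (k < m * 2 ^ n)%N -> dyadic b n k y ->
  \sum_(p <- dyadic_level m n) F p * \1_(dyadic p.1 n p.2) y = F (b, k).
Proof.
move=> km dk; rewrite (bigD1_seq (b, k)) ?mem_dyadic_level ?uniq_dyadic_level//= indicE mem_set// mulr1.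
rewrite big1 ?addr0// => -[b' k'] /eqP ne; rewrite indicE memNset ?mulr0// => dk'.
by have [e1 e2] := dyadic_uniq dk dk'; apply: ne; rewrite e1 e2.
Qed.

Lemma sum_lev_le m n y :
  \sum_(p <- dyadic_level m n) (1 + p.2%:R / 2 ^+ n) * \1_(dyadic p.1 n p.2) y <= 1 + `|y|.
Proof.
have [[b [k [km dk]]]|hn] := pselect (exists b k, (k < m * 2 ^ n)%N /\ dyadic b n k y).
  by rewrite (sum_lev1 (fun p => 1 + p.2%:R / 2 ^+ n) km dk)/= lerD2l (dyadic_norm dk).
rewrite big1_seq ?addr_ge0// => -[b k] /=; rewrite mem_dyadic_level => km.
by rewrite indicE memNset ?mulr0// => dk; apply: hn; exists b, k.
Qed.

(** Comparison with a telescoping series. For c = 2^-n the bound is 1 + 2^n: the weights make the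
    sum over a whole level behave as if only the cells of a bounded region counted. *)
Lemma sum_inv_sq N (c : R) : 0 < c ->
  \sum_(k <- iota 0 N) ((1 + k%:R * c) ^+ 2)^-1 <= 1 + c^-1.
Proof.
move=> c0; case: N => [|N]; first by rewrite big_nil addr_ge0// invr_ge0 ltW.
suff : \sum_(k <- iota 0 N.+1) ((1 + k%:R * c) ^+ 2)^-1 <= 1 + c^-1 - (c * (1 + N%:R * c))^-1.
  move/le_trans; apply; rewrite gerBl invr_ge0 mulr_ge0 ?addr_ge0 ?mulr_ge0// ltW//.
elim: N => [|N IH].
  rewrite big_seq1 !mul0r !addr0 mulr1 expr1n invr1; lra.
rewrite -[N.+2]addn1 iotaD big_cat big_seq1 add0n.
apply: le_trans (lerD IH (lexx _)) _.
rewrite -natr1; set x := N%:R; have x0 : 0 <= x by [].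
have p1 : 0 < 1 + x * c by rewrite ltr_pwDl// mulr_ge0// ltW.
have p2 : 0 < 1 + (x + 1) * c by rewrite ltr_pwDl// mulr_ge0 ?addr_ge0// ltW.
rewrite -subr_ge0.
have -> : 1 + c^-1 - (c * (1 + (x + 1) * c))^-1 -
     (1 + c^-1 - (c * (1 + x * c))^-1 + ((1 + (x + 1) * c) ^+ 2)^-1) =
     c / ((1 + x * c) * (1 + (x + 1) * c) ^+ 2).
  by field; rewrite !gt_eqF.
by rewrite divr_ge0 ?mulr_ge0 ?exprn_ge0// ltW.
Qed.

Lemma sum_iotaS (F : nat -> R) n :
  \sum_(k <- iota 0 n.+1) F k = \sum_(k <- iota 0 n) F k + F n.
Proof. by rewrite -[in iota 0 n.+1]addn1 iotaD big_cat big_seq1. Qed.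

Lemma sum_geom_le N (c : R) : 0 <= c -> c < 1 -> \sum_(n <- iota 0 N) c ^+ n <= (1 - c)^-1.
Proof.
move=> c0 c1; have p : 0 < 1 - c by rewrite subr_gt0.
rewrite -[leRHS]mul1r ler_pdivlMr//.
suff -> : (\sum_(n <- iota 0 N) c ^+ n) * (1 - c) = 1 - c ^+ N by rewrite gerBl exprn_ge0.
elim: N => [|N IH]; first by rewrite big_nil mul0r expr0 subrr.
by rewrite sum_iotaS mulrDl IH exprSr; ring.
Qed.

(** One number limits both the fineness and the box, so the sums over these cells increase along a
    single index. *)
Definition dyadic_levels m := [seq (n, p) | n <- iota 0 m.+1, p <- dyadic_level m n].

Lemma big_dyadic_levels (F : nat * (bool * nat) -> R) m :
  \sum_(l <- dyadic_levels m) F l = \sum_(n <- iota 0 m.+1) \sum_(p <- dyadic_level m n) F (n, p).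
Proof. by rewrite big_allpairs_dep. Qed.

Lemma big_lev (F : bool * nat -> R) m n : \sum_(p <- dyadic_level m n) F p =
  \sum_(k <- iota 0 (m * 2 ^ n)) F (true, k) + \sum_(k <- iota 0 (m * 2 ^ n)) F (false, k).
Proof. by rewrite big_allpairs_dep big_cons big_seq1. Qed.

Lemma sum_iota_le (F : nat -> R) N N' : (forall k, 0 <= F k) -> (N <= N')%N ->
  \sum_(k <- iota 0 N) F k <= \sum_(k <- iota 0 N') F k.
Proof.
by move=> F0 /subnKC <-; rewrite iotaD big_cat /= lerDl sumr_ge0.
Qed.

Lemma big_levs_le (F : nat * (bool * nat) -> R) m m' : (forall l, 0 <= F l) ->
  (m <= m')%N -> \sum_(l <- dyadic_levels m) F l <= \sum_(l <- dyadic_levels m') F l.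
Proof.
move=> F0 mm; rewrite !big_dyadic_levels.
apply: (@le_trans _ _ (\sum_(n <- iota 0 m.+1) \sum_(p <- dyadic_level m' n) F (n, p))).
  apply: ler_sum => n _; rewrite !big_lev.
  by apply: lerD; apply: sum_iota_le => //; rewrite leq_mul2r mm orbT.
by apply: sum_iota_le => // n; apply: sumr_ge0.
Qed.

End dyadic_sets.
Arguments pow2_gt0 {R}.
Arguments dyadic : simpl never.
Arguments dyadic_pt : simpl never.

Section dyadic_bound.
Context {d : measure_display} {Omega : measurableType d} {R : realType}.
Variable P : probability Omega R.
Variables (m : set R -> Omega -> R) (g : R -> R) (r : R).
Hypothesis sm : smeas P m.
Hypothesis r0 : 0 < r.
Hypothesis r1 : 2 * r ^+ 2 < 1.
Hypothesis g1 : forall y, 1 + `|y| <= 2 * (1 + g y).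
Hypothesis dom : forall e : R, 0 < e -> exists2 a : R, 0 < a & forall f, srep f ->
  (forall y, `|sfun f y| <= 1 + g y) -> pr P [set w | a <= `|sint m f setT w|] <= e.

Definition dyadic_sum (M : nat) w : R := \sum_(l <- dyadic_levels M) r ^+ l.1 * `|m (dyadic l.2.1 l.1 l.2.2) w|.

Lemma measurable_dyadic_sum M : measurable_fun setT (dyadic_sum M).
Proof.
apply: measurable_sum => l; apply: measurable_funM => //; apply: measurableT_comp => //.
apply: (smeas_meas sm); exact: measurable_dyadic.
Qed.

Fixpoint signed (e : seq bool) (s : seq (R * set R)) : seq (R * set R) :=
  if (e, s) is (b :: e', a :: s') then ((if b then a.1 else - a.1), a.2) :: signed e' s' else [::].

Lemma srep_signed e s : srep s -> srep (signed e s).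
Proof.
elim: e s => [|b e IH] [|a s]//= /srep_cons[ma /IH h]; exact: srepI.
Qed.

Lemma sint_signed e s w : sint m (signed e s) setT w =
  dot e (eval_seq [seq (fun w => a.1 * m a.2 w) | a <- s] w).
Proof.
elim: e s => [|b e IH] [|a s]/=; rewrite /sint ?big_nil// big_cons -/(sint _ _ _ _) IH setTI.
by case: b; rewrite ?mulNr.
Qed.

Lemma sfun_signed e s y : all (fun a => 0 <= a.1) s -> `|sfun (signed e s) y| <= sfun s y.
Proof.
elim: e s => [|b e IH] [|a s]//=; rewrite /sfun ?big_nil ?normr0//.
  move=> /andP[a0 s0]; rewrite big_seq; apply: sumr_ge0 => c.
  by rewrite inE => /orP[/eqP ->|/(allP s0) c0]; rewrite mulr_ge0.
move=> /andP[a0 /IH h]; rewrite !big_cons -!/(sfun _ _).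
apply: le_trans (ler_normD _ _) _; apply: lerD => //.
by rewrite normrM (ger0_norm (_ : 0 <= \1__ _))// ler_wpM2r//; case: b; rewrite ?normrN ger0_norm.
Qed.

(* Cauchy-Schwarz between the deterministic factor [r^n / c] and the almost
   surely summable squares of the increments [c m(I)]. *)
Lemma dyadic_sum_tail (e : R) : 0 < e -> exists A, forall M, pr P [set w | A <= dyadic_sum M w] <= e.
Proof.
move=> e0.
(* Any number strictly between 2 r^2 and 1 would serve: th < 1 makes the weights st^n summable over
   the levels, and 2 r^2 < th makes the dual series of (2 r^2 / th)^n converge. *)
pose th := (1 + 2 * r ^+ 2) / 2.
have th1 : th < 1 by rewrite /th; move: r1; lra.
have r20 : 0 < r ^+ 2 by rewrite exprn_gt0.
have th0 : 0 < th by rewrite /th divr_gt0// addr_gt0// mulr_gt0.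
have th2 : 2 * r ^+ 2 < th by rewrite /th; move: r1; lra.
pose st := Num.sqrt th.
have st2 : st ^+ 2 = th by rewrite sqr_sqrtr// ltW.
have st0 : 0 < st by rewrite sqrtr_gt0.
have st1 : st < 1.
  by rewrite -(@ltr_sqr _ st 1) ?nnegrE ?(ltW st0)// expr1n st2.
pose ro := r ^+ 2 / th.
have ro0 : 0 <= ro by rewrite divr_ge0 ?ltW.
have ro1 : 2 * ro < 1 by rewrite /ro mulrA ltr_pdivrMr// mul1r.
(* With this factor the weights of all levels add up to at most (1 + |y|) / 2 at y, which is at most
   1 + g y by [g1]. *)
pose ka := (1 - st) / 2; have ka0 : 0 < ka by rewrite divr_gt0// subr_gt0.
pose c (l : nat * (bool * nat)) := ka * st ^+ l.1 * (1 + l.2.2%:R / 2 ^+ l.1).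
have w1 n k : 0 < 1 + k%:R / 2 ^+ n :> R by rewrite ltr_pwDl// divr_ge0// exprn_ge0.
have c0 l : 0 < c l.
  by apply: mulr_gt0; [apply: mulr_gt0 => //; exact: exprn_gt0|exact: w1].
pose s M := [seq (c l, @dyadic R l.2.1 l.1 l.2.2) | l <- dyadic_levels M].
have rs M : srep (s M).
  rewrite /s; elim: (dyadic_levels M) => //= l ls IH; apply: srepI => //; exact: measurable_dyadic.
have sM M y : sfun (s M) y <= 1 + g y.
  rewrite /sfun big_map big_dyadic_levels.
  have h n : \sum_(p <- dyadic_level M n) c (n, p) * \1_(dyadic p.1 n p.2) y <= ka * st ^+ n * (1 + `|y|).
    rewrite (eq_bigr (fun p => ka * st ^+ n * ((1 + p.2%:R / 2 ^+ n) * \1_(dyadic p.1 n p.2) y))).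
      rewrite -mulr_sumr; apply: ler_wpM2l; last exact: sum_lev_le.
      by apply: mulr_ge0; [exact: ltW|rewrite exprn_ge0// ltW].
    by move=> p _; rewrite mulrA.
  apply: le_trans (ler_sum _ (fun n _ => h n)) _.
  rewrite -mulr_suml -mulr_sumr.
  have := sum_geom_le M.+1 (ltW st0) st1; set S := \sum_(_ <- _) _ => hS.
  have h2 : ka * S <= 1 / 2.
    have -> : 1 / 2 = ka * (1 - st)^-1.
      by rewrite /ka; field; rewrite gt_eqF// subr_gt0.
    by rewrite ler_pM2l.
  have y0 : 0 <= 1 + `|y| by rewrite addr_ge0.
  by apply: le_trans (ler_wpM2r y0 h2) _; have := g1 y; lra.
have e30 : 0 < e * (3 / 16) by apply: mulr_gt0 => //; apply: divr_gt0.
have [a a0 ha] := dom e30.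
pose B := (ka ^+ 2)^-1 * (4 * (1 - 2 * ro)^-1).
have hB M : \sum_(l <- dyadic_levels M) (r ^+ l.1 / c l) ^+ 2 <= B.
  rewrite big_dyadic_levels.
  have h n : \sum_(p <- dyadic_level M n) (r ^+ n / c (n, p)) ^+ 2 <= (ka ^+ 2)^-1 * (4 * (2 * ro) ^+ n).
    have E p : (r ^+ n / c (n, p)) ^+ 2 =
        (ka ^+ 2)^-1 * ro ^+ n * ((1 + p.2%:R * (2 ^+ n)^-1) ^+ 2)^-1.
      have -> : ro ^+ n = (r ^+ n) ^+ 2 / (st ^+ n) ^+ 2.
        by rewrite /ro expr_div_n -!exprM mulnC [(n * 2)%N]mulnC !exprM st2.
      have sn0 : 0 < st ^+ n by exact: exprn_gt0.
      rewrite /c /=; move: (w1 n p.2) sn0; move: (1 + _) (st ^+ n) (r ^+ n) => x y z x0 y0.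
      by field; rewrite !gt_eqF.
    rewrite (eq_bigr _ (fun p _ => E p)) -mulr_sumr -mulrA ler_pM2l ?invr_gt0 ?exprn_gt0//.
    have -> : 4 * (2 * ro) ^+ n = ro ^+ n * (4 * 2 ^+ n) by rewrite exprMn; ring.
    apply: ler_wpM2l; first by rewrite exprn_ge0.
    rewrite big_lev; have c2 : 0 < (2 ^+ n)^-1 :> R by rewrite invr_gt0.
    have := @sum_inv_sq R (M * 2 ^ n) _ c2; rewrite invrK => h1.
    have p2 : 1 <= 2 ^+ n :> R by rewrite exprn_ege1// ler1n.
    by apply: le_trans (lerD h1 h1) _; lra.
  apply: le_trans (ler_sum _ (fun n _ => h n)) _.
  rewrite -!mulr_sumr /B ler_pM2l ?invr_gt0 ?exprn_gt0// ler_pM2l//.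
  by apply: sum_geom_le => //; rewrite mulr_ge0.
pose X M := [seq (fun w => a.1 * m a.2 w) | a <- s M].
have mX M : meas_seq (X M).
  move=> i; rewrite size_map => hi; rewrite (nth_map (0, set0))//.
  by apply: measurable_funM => //; apply: (smeas_meas sm); exact: rs.
(* Since 2xy <= x^2 + y^2, a value of [dyadic_sum] above this level pushes the square sum above 4
   a^2, the threshold of [pr_square_sum]. *)
exists (B / 2 + 2 * a ^+ 2) => M.
have h3 := @pr_square_sum _ _ _ P (X M) a (e * (3 / 16)) (mX M) a0 _.
have {}h3 : 3 / 16 * pr P [set w | 4 * a ^+ 2 <= \sum_(b <- eval_seq (X M) w) b ^+ 2] <= e * (3 / 16).
  apply: h3 => e' _; apply: (le_trans _ (ha (signed e' (s M)) _ _)).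
  - apply: le_pr; [by apply: measurable_norm_ge; exact: measurable_dot| |].
      by apply: measurable_norm_ge; apply: (measurable_sint sm) => //; exact: srep_signed.
    by move=> w /=; rewrite sint_signed.
  - exact: srep_signed.
  - move=> y; apply: le_trans (sM M y); apply: sfun_signed.
    by apply/allP => x /mapP[l _ ->]; exact: ltW (c0 l).
apply: (@le_trans _ _ (pr P [set w | 4 * a ^+ 2 <= \sum_(b <- eval_seq (X M) w) b ^+ 2])).
  apply: le_pr; [by apply: measurable_ge; exact: measurable_dyadic_sum|by apply: measurable_ge; exact: measurable_sqsum|].
  move=> w /= hw.
  have hd : dyadic_sum M w <= 1 / 2 * (\sum_(l <- dyadic_levels M) (r ^+ l.1 / c l) ^+ 2) +
      1 / 2 * (\sum_(b <- eval_seq (X M) w) b ^+ 2).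
    rewrite /eval_seq /X /s !big_map !mulr_sumr -big_split /=; apply: ler_sum => l _.
    set u := `|_|; set v := r ^+ l.1 / c l.
    have -> : r ^+ l.1 * u = v * (c l * u) by rewrite /v; field; rewrite gt_eqF.
    have -> : (c l * m (dyadic l.2.1 l.1 l.2.2) w) ^+ 2 = (c l * u) ^+ 2.
      by rewrite !exprMn /u real_normK// num_real.
    by have := sqr_ge0 (v - c l * u); lra.
  have := hB M; move: hw hd; lra.
by move: h3; lra.
Qed.

Lemma dyadic_sum_mono M M' w : (M <= M')%N -> dyadic_sum M w <= dyadic_sum M' w.
Proof.
by move=> MM; apply: big_levs_le => // l; rewrite mulr_ge0// exprn_ge0// ltW.
Qed.

(** The sums increase with M, so by continuity from below the tail bound, uniform in M, passes to
    the event that some sum exceeds A. *)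
Lemma dyadic_sum_bounded : {ae P, forall w, exists A, forall M, dyadic_sum M w <= A}.
Proof.
pose U (A : nat) := \bigcup_M [set w | A%:R <= dyadic_sum M w].
have mS (A : R) M : measurable [set w | A <= dyadic_sum M w].
  by apply: measurable_ge; exact: measurable_dyadic_sum.
have mU A : measurable (U A) by apply: bigcup_measurable => M _; exact: mS.
have hU (e : R) : 0 < e -> exists A : nat, pr P (U A) <= e.
  move=> e0; have [A hA] := dyadic_sum_tail e0; exists (Num.trunc A).+1.
  have : (P \o (fun M => [set w | (Num.trunc A).+1%:R <= dyadic_sum M w])) M @[M --> \oo]
      --> P (U (Num.trunc A).+1).
    apply: nondecreasing_cvg_mu => //; first exact: mU.
    move=> i j ij; apply/subsetPset => w /= /le_trans; apply; exact: dyadic_sum_mono.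
  move=> cv; rewrite -lee_fin EFin_pr//.
  rewrite -(cvg_lim _ cv)//; apply: lime_le; first by apply/cvg_ex; eexists; exact: cv.
  apply: nearW => M /=; rewrite -EFin_pr// lee_fin; apply: le_trans (hA M).
  apply: le_pr => // w /=; apply: le_trans; exact: ltW (truncnS_gt A).
exists (\bigcap_A U A); split.
- exact: bigcap_measurable.
- have mI : measurable (\bigcap_A U A) by exact: bigcap_measurable.
  rewrite -EFin_pr//; congr EFin; apply/eqP; rewrite eq_le pr_ge0 andbT.
  apply/ler_addgt0Pr => e /hU[A hA]; rewrite add0r; apply: le_trans hA.
  by apply: le_pr => // w; apply.
- move=> w /= hn A _; apply: contrapT => nU; apply: hn; exists A%:R => M.
  by rewrite leNgt; apply/negP => /ltW h; apply: nU; exists M.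
Qed.

(** The only exceptional sets come from additivity of [m] on the countably many dyadic cells, so one
    null set serves all functions q. Passing from level n to n + 1 changes the Riemann sum by the
    increments of q between a cell and its parent. *)
Lemma dyadic_telescope : {ae P, forall w, forall (q : R -> R) bd M, 
  (forall y, `|q y| <= bd) ->
  (forall b n k, `|q (dyadic_pt R b n.+1 k) - q (dyadic_pt R b n k./2)| <= bd * r ^+ n.+1) ->
  `|\sum_(p <- dyadic_level M M) q (dyadic_pt R p.1 M p.2) * m (dyadic p.1 M p.2) w| <= bd * dyadic_sum M w}.
Proof.
have : {ae P, forall w, forall b n k, m (dyadic b n k) w = m (dyadic b n.+1 k.*2) w + m (dyadic b n.+1 k.*2.+1) w}.
  apply: filter_forall => b; apply/ae_foralln => n; apply/ae_foralln => k.
  have := smeasU sm (@measurable_dyadic R b n.+1 k.*2) (measurable_dyadic b n.+1 k.*2.+1) _.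
  rewrite -dyadic_split; apply; rewrite -subset0 => y [h1 h2].
  by have [_ /eqP] := dyadic_uniq h1 h2; rewrite -[X in _ == X]addn1 -[X in X == _]addn0 eqn_add2l.
apply: filterS => w hm q bd M hq hh.
pose S n := \sum_(p <- dyadic_level M n) q (dyadic_pt R p.1 n p.2) * m (dyadic p.1 n p.2) w.
suff h n : `|S n| <= bd * \sum_(i <- iota 0 n.+1) \sum_(p <- dyadic_level M i) r ^+ i * `|m (dyadic p.1 i p.2) w|.
  by rewrite /dyadic_sum big_dyadic_levels; exact: h.
elim: n => [|n IH].
  rewrite /= big_cons big_nil addr0 mulr_sumr; apply: le_trans (ler_norm_sum _ _ _) _.
  by apply: ler_sum => p _; rewrite expr0 mul1r normrM ler_wpM2r.
have E : S n.+1 - S n =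
  \sum_(p <- dyadic_level M n.+1) (q (dyadic_pt R p.1 n.+1 p.2) - q (dyadic_pt R p.1 n p.2./2)) * m (dyadic p.1 n.+1 p.2) w.
  rewrite /S !big_lev expnS mulnCA mul2n !sum_double opprD addrACA -!sumrB.
  congr (_ + _); apply: eq_bigr => k _ /=; rewrite (hm _ n k) doubleK uphalf_double; ring.
rewrite -[S n.+1](subrK (S n)) E addrC.
rewrite sum_iotaS mulrDr.
apply: le_trans (ler_normD _ _) _; apply: lerD => //.
rewrite mulr_sumr; apply: le_trans (ler_norm_sum _ _ _) _.
by apply: ler_sum => p _; rewrite normrM mulrA ler_wpM2r.
Qed.

End dyadic_bound.

(** * The uniform bound for integrals of Hoelder functions *)

Section integral_bound.
Context {d : measure_display} {Omega : measurableType d} {R : realType}.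
Variable P : probability Omega R.

(** The integral as a function of the domain of integration, which is what Nikodym's theorem needs;
    [nu] collects the limits over all Borel sets. *)
Definition measure_integral (m : set R -> Omega -> R) (g : R -> R) (nu : set R -> Omega -> R) :=
  exists s N, [/\ forall n, srep (s n), null_set P m N,
    forall y, ~ N y -> sfun (s n) y @[n --> \oo] --> g y,
    forall A, measurable A -> measurable_fun setT (nu A) &
    forall A, measurable A -> cvg_prob P (fun n => sint m (s n) A) (nu A)].

Lemma measure_integralB m g1 g2 nu1 nu2 : smeas P m -> measure_integral m g1 nu1 -> measure_integral m g2 nu2 ->
  measure_integral m (fun y => g1 y - g2 y) (fun A w => nu1 A w - nu2 A w).
Proof.
move=> sm [s1 [N1 [r1 [mN1 n1] c1 m1 h1]]] [s2 [N2 [r2 [mN2 n2] c2 m2 h2]]].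
exists (fun n => s1 n ++ sscale (- 1) (s2 n)), (N1 `|` N2); split.
- by move=> n; apply: srep_cat => //; exact: srep_scale.
- split; first exact: measurableU.
  move=> B mB BN.
  have mB1 : measurable (B `&` N1) by exact: measurableI.
  have mB2 : measurable (B `\` N1) by exact: measurableD.
  have z1 := n1 _ mB1 (@subIsetr _ _ _).
  have z2 : {ae P, forall w, m (B `\` N1) w = 0}.
    by apply: n2 => // x [/BN []].
  have dd : (B `&` N1) `&` (B `\` N1) = set0 by rewrite -subset0 => x [[_ ?] []].
  have := smeasU sm mB1 mB2 dd; rewrite setUIDK.
  by apply: filterS3 z1 z2 => w -> -> ->; rewrite addr0.
- move=> y ny; have [ny1 ny2] : ~ N1 y /\ ~ N2 y by split=> h; apply: ny; [left|right].
  rewrite (_ : (fun n => _) = (fun n => sfun (s1 n) y - sfun (s2 n) y)).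
    by apply: cvgB; [exact: c1|exact: c2].
  by apply/funext => n; rewrite sfun_cat sfun_scale mulN1r.
- by move=> A mA; apply: measurable_funB; [exact: m1|exact: m2].
move=> A mA e e0; have e20 : 0 < e / 2 by rewrite divr_gt0.
have [k1 hk1] := h1 A mA _ e20; have [k2 hk2] := h2 A mA _ e20.
exists (maxn k1 k2) => n; rewrite geq_max => /andP[/hk1 a1 /hk2 a2]; rewrite (splitr e).
have q1 : measurable_fun setT (fun w => sint m (s1 n) A w - nu1 A w).
  by apply: measurable_funB; [exact: (measurable_sint sm)|exact: m1].
have q2 : measurable_fun setT (fun w => sint m (s2 n) A w - nu2 A w).
  by apply: measurable_funB; [exact: (measurable_sint sm)|exact: m2].
have := smallB q1 q2 a1 a2; congr (small _ _ _); apply/funext => w.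
by rewrite sint_cat sint_scale; ring.
Qed.

Variable mu : set R -> {RV P >-> R}.

Lemma approximates_measure_integral g s : approximates mu g s ->
  exists nu, [/\ measure_integral (fun A => mu A) g nu &
    forall A, measurable A -> cvg_prob P (fun n => sint (fun A => mu A) (s n) A) (nu A)].
Proof.
move=> [rs [N [mN nN] cN] hA].
have {}hA A : exists xi : {RV P >-> R}, measurable A ->
    cvg_prob P (fun n => sint (fun A => mu A) (s n) A) xi.
  have [mA|nA] := pselect (measurable A); last by exists (mu set0) => /nA.
  by have [xi h] := hA A mA; exists xi => _; exact: (cvg_in_probability_cvg_prob h).
have [nu hnu] := boolp.choice hA.
exists (fun A => nu A); split => //.
exists s, N; split => //.
by move=> n i hi; apply: (rs n); rewrite mem_nth.
Qed.

Lemma is_mu_integral_measure_integral g xi : stochastic_measure mu -> is_mu_integral mu g setT xi ->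
  measurable_fun setT g /\ exists nu, measure_integral (fun A => mu A) g nu /\
    {ae P, forall w, nu setT w = xi w}.
Proof.
move=> mu_sm [mg [s hs /cvg_in_probability_cvg_prob cx]]; split => //.
have sm := stochastic_smeas mu_sm.
have [nu [hnu c]] := approximates_measure_integral hs; exists nu; split => //.
have [s' [N [_ _ _ mnu _]]] := hnu.
apply: (cvg_prob_ae_uniq _ (mnu _ measurableT) _ (c _ measurableT) cx) => // n.
apply: (measurable_sint sm) => // i hi; case: hs => rs _ _.
by apply: (rs n); rewrite mem_nth.
Qed.

Lemma pow2_powR (al : R) n : ((2 ^+ n)^-1) `^ al = (2 `^ (- al)) ^+ n.
Proof.
rewrite -powR_mulrn ?powR_ge0// -powRrM -[2 ^+ n]powR_mulrn// -powRN -powRrM.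
by congr (_ `^ _); ring.
Qed.

(** [K] depends only on the dyadic sums of [mu]. The integrals of [g1] and [g2] come with unrelated
    approximating sequences; their difference is approximated afresh by step functions with values
    at dyadic points on growing boxes, to which the telescoping bound applies. *)
Theorem mu_integral_bound (tau al : R) : stochastic_measure mu -> 1 <= tau ->
  mu_integrable mu (fun y => `|y| `^ tau) -> 1 / 2 < al ->
  exists2 K : Omega -> R, measurable_fun setT K /\ (forall w, 0 <= K w) &
  forall g1 g2 (xi1 xi2 : {RV P >-> R}) bd, is_mu_integral mu g1 setT xi1 ->
    is_mu_integral mu g2 setT xi2 -> 0 <= bd ->
    (forall y, `|g1 y - g2 y| <= bd) ->
    (forall y z, `|(g1 y - g2 y) - (g1 z - g2 z)| <= bd * `|y - z| `^ al) ->
    {ae P, forall w, `|xi1 w - xi2 w| <= bd * K w}.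
Proof.
move=> mu_sm tau1 [mtau [s hs]] al12.
have sm := stochastic_smeas mu_sm.
pose r := 2 `^ (- al); have r0 : 0 < r by exact: powR_gt0.
have r1 : 2 * r ^+ 2 < 1.
  have -> : r ^+ 2 = 2 `^ (- (2 * al)).
    by rewrite -powR_mulrn ?powR_ge0// -powRrM; congr (_ `^ _); ring.
  rewrite powRN ltr_pdivrMr ?powR_gt0// mul1r -{1}(@powRr1 _ 2)//.
  by rewrite /powR !gt_eqF// ltr_expR ltr_pM2r ?ln_gt0 ?ltr1n//; lra.
have r11 : r < 1.
  have h : r ^+ 2 < 1 by have : 0 < r ^+ 2 by [rewrite exprn_gt0]; move: r1; lra.
  by rewrite -(@ltr_sqr _ r 1) ?nnegrE ?(ltW r0)// expr1n.
have [nu [[s' [N [rs' nN cs mnu hnu]]] _]] := approximates_measure_integral hs.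
pose g (y : R) : R := `|y| `^ tau.
have g0 y : 0 <= g y by exact: powR_ge0.
have g1 y : 1 + `|y| <= 2 * (1 + g y).
  have [y1|y1] := leP 1 `|y|; last by have := g0 y; lra.
  have : `|y| <= g y by rewrite -{1}(@powRr1 _ `|y|)// ler_powR.
  have := normr_ge0 y; lra.
have dom := fun e e0 => @simple_dominated _ _ _ P _ _ _ nu s' N g sm rs' nN mtau cs mnu hnu e g0 e0.
have bdd := dyadic_sum_bounded sm r0 r1 g1 dom.
have tel := dyadic_telescope r sm.
pose ds := dyadic_sum (fun A => mu A) r.
have mds M : measurable_fun setT (ds M) by exact: (measurable_dyadic_sum r sm M).
(* An upper limit is measurable without exceptional sets. The sums increase, so it is almost surely
   their finite supremum; on the remaining null set [fine] may return the default 0. *)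
pose K w := fine (limn_esup (fun M => (ds M w)%:E)).
have mK : measurable_fun setT K.
  apply: (measurableT_comp (f := fine)); first exact: fine_measurable.
  apply: measurable_fun_limn_esup => M.
  exact/measurable_EFinP.
have ds0 M w : 0 <= ds M w by apply: sumr_ge0 => l _; rewrite mulr_ge0// exprn_ge0// ltW.
exists (fun w => Num.max 0 (K w)).
  by split => [|w]; [exact: measurable_maxr|rewrite le_max lexx].
have {bdd} dK : {ae P, forall w, forall M, ds M w <= K w}.
  apply: filterS bdd => w [A hA] M.
  have nd : nondecreasing_seq (fun M => (ds M w)%:E).
    by move=> i j ij; rewrite lee_fin; exact: dyadic_sum_mono.
  have cv := ereal_nondecreasing_cvgn nd.
  have E : limn_esup (fun M => (ds M w)%:E) = ereal_sup (range (fun M => (ds M w)%:E)).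
    rewrite (is_cvg_limn_esupE (_ : cvg _)); first exact: cvg_lim cv.
    by apply/cvg_ex; eexists; exact: cv.
  have up : ((ds M w)%:E <= ereal_sup (range (fun M => (ds M w)%:E)))%E.
    by apply: ereal_sup_ubound; exists M.
  have dn : (ereal_sup (range (fun M => (ds M w)%:E)) <= A%:E)%E.
    by apply: ge_ereal_sup => _ [k _ <-]; rewrite lee_fin.
  rewrite -lee_fin /K E fineK//.
  by rewrite fin_numElt (lt_le_trans (ltNyr _) up) (le_lt_trans dn (ltry _)).
move=> h1 h2 xi1 xi2 bd.
move=> /(is_mu_integral_measure_integral mu_sm)[mh1 [n1 [i1 e1]]] /(is_mu_integral_measure_integral mu_sm)[mh2 [n2 [i2 e2]]].
pose q y := h1 y - h2 y.
move=> bd0 hq hh.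
have [t [Nt [rt nt ct mt ht]]] := measure_integralB sm i1 i2.
have mq : measurable_fun setT q by exact: measurable_funB.
pose psi M := [seq (q (dyadic_pt R p.1 M p.2), @dyadic R p.1 M p.2) | p <- dyadic_level M M].
have rpsi M : srep (psi M).
  by rewrite /psi; elim: (dyadic_level M M) => //= p l IH; apply: srepI => //; exact: measurable_dyadic.
(* The factor is bd + 1 because [integral_approx] asks for positive errors and bd may be 0. *)
have hpsi M y : box M y -> `|sfun (psi M) y - q y| <= (bd + 1) * r ^+ M.
  move=> /(@box_dyadic R M M)[b [k [kM dk]]].
  rewrite /sfun big_map (sum_lev1 (fun p => q (dyadic_pt R p.1 M p.2)) kM dk)/=.
  apply: le_trans (hh _ _) _; rewrite distrC; apply: (@le_trans _ _ (bd * r ^+ M)).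
    apply: ler_wpM2l => //; rewrite -pow2_powR; apply: ge0_ler_powR; rewrite ?nnegrE ?invr_ge0 ?exprn_ge0//.
      by lra.
    exact: dyadic_dist.
  by apply: ler_wpM2r; [rewrite exprn_ge0// ltW|rewrite lerDl].
have delim : (bd + 1) * r ^+ M @[M --> \oo] --> 0.
  by apply: (@cvg_geometric _ (bd + 1) r); rewrite ger0_norm// ltW.
have depos M : 0 < (bd + 1) * r ^+ M by rewrite mulr_gt0 ?exprn_gt0// ltr_wpDl.
have app e := @integral_approx _ _ _ P _ _ _ _ t Nt q sm rt nt mq ct mt ht psi (@box R)
  (fun M => (bd + 1) * r ^+ M) e rpsi (@measurable_box R) (@decr_box R) depos delim hpsi.
have psib : {ae P, forall w, forall M, `|sint (fun A => mu A) (psi M) (box M) w| <= bd * K w}.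
  apply: filterS2 dK tel => w hK htel M.
  have -> : sint (fun A => mu A) (psi M) (box M) w =
      \sum_(p <- dyadic_level M M) q (dyadic_pt R p.1 M p.2) * mu (dyadic p.1 M p.2) w.
    rewrite /sint big_map !big_seq; apply: eq_bigr => -[b k]; rewrite mem_dyadic_level => kM /=.
    by rewrite setIidr//; exact: dyadic_box.
  apply: le_trans (htel q bd M hq _) _; last exact: ler_wpM2l.
  move=> b n k; apply: le_trans (hh _ _) _; apply: ler_wpM2l => //.
  rewrite -pow2_powR; apply: ge0_ler_powR; rewrite ?nnegrE ?invr_ge0 ?exprn_ge0//.
    by lra.
  exact: dyadic_pt_parent.
pose X w := n1 setT w - n2 setT w.
have mX : measurable_fun setT X by exact: mt.
(* The excess over the bound. Where it reaches e, the integral is at distance at least e from every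
   approximation, since these are at most bd * K; this has small probability for large M. *)
pose Y w := Num.max 0 (`|X w| - bd * K w).
have mY : measurable_fun setT Y.
  apply: measurable_maxr => //; apply: measurable_funB; first exact: measurableT_comp.
  exact: measurable_funM.
have : {ae P, forall w, Y w = 0}.
  apply: small_ae0 => // e e0; have [M /(_ M (leqnn _)) hM] := app e e0.
  apply: le_trans hM; apply: le_pr_ae; first exact: measurable_norm_ge.
    by apply: measurable_norm_ge; apply: measurable_funB; [exact: mX|exact: (measurable_sint sm (rpsi M) (@measurable_box R M))].
  apply: filterS psib => w /(_ M) hw /=; rewrite -/(X w) /Y ger0_norm ?le_max ?lexx//.
  rewrite ?le_max; move=> /orP[|]; first by rewrite leNgt e0.
  set S := sint _ _ _ _ in hw *.
  by have := ler_normB (X w - S) (- S); rewrite opprK subrK normrN; move: hw; lra.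
apply: filterS3 e1 e2 => w <- <- h; rewrite -/(X w).
have : `|X w| - bd * K w <= 0 by rewrite -h /Y le_max lexx orbT.
rewrite subr_le0 => /le_trans; apply; apply: ler_wpM2l => //.
by rewrite le_max lexx orbT.
Qed.

End integral_bound.

(** * The heat kernel *)

Section heat_kernel.
Variable R : realType.
Implicit Types s t x y z : R.

(** The square root of a nonpositive number and the inverse of 0 are both 0, so time integrals may
    include the endpoint s = t. *)
Lemma heat_kernel_le0 t x : t <= 0 -> heat_kernel t x = 0.
Proof.
move=> t0; rewrite /heat_kernel ler0_sqrtr ?mulr0 ?invr0 ?mul0r//.
by rewrite mulr_ge0_le0// pi_ge0.
Qed.

Lemma heat_kernel_ge0 t x : 0 <= heat_kernel t x.
Proof. by rewrite /heat_kernel mulr_ge0 ?expR_ge0// invr_ge0 mulr_ge0// sqrtr_ge0. Qed.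

Lemma pi_ge1 : 1 <= pi :> R.
Proof. by have := @pi_ge2 R; lra. Qed.

Lemma powRNhalf t : 0 < t -> t `^ (- (1 / 2)) = (Num.sqrt t)^-1.
Proof. by move=> t0; rewrite powRN div1r powR12_sqrt// ltW. Qed.

Lemma sqrt_pi_ge t : 0 < t -> (2 * Num.sqrt (pi * t))^-1 <= (Num.sqrt t)^-1.
Proof.
move=> t0; have st : 0 < Num.sqrt t by rewrite sqrtr_gt0.
have h : Num.sqrt t <= 2 * Num.sqrt (pi * t).
  rewrite sqrtrM ?pi_ge0//; have : 1 <= Num.sqrt pi :> R.
    by rewrite -[X in X <= _]sqrtr1; apply: ler_wsqrtr; exact: pi_ge1.
  by move=> h; rewrite mulrA ler_peMl ?(ltW st)//; lra.
by rewrite lef_pV2// posrE (lt_le_trans st h).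
Qed.

Lemma heat_kernel_le t x : heat_kernel t x <= t `^ (- (1 / 2)).
Proof.
have [t0|t0] := leP t 0; first by rewrite heat_kernel_le0// powR_ge0.
rewrite powRNhalf// /heat_kernel; apply: le_trans (sqrt_pi_ge t0).
apply: ler_piMr; first by rewrite invr_ge0 mulr_ge0// sqrtr_ge0.
by rewrite -[leRHS]expR0 ler_expR oppr_le0 divr_ge0 ?sqr_ge0// mulr_ge0// ltW.
Qed.

(** Let A = |a| <= B = |b|. If B - A >= 1 the trivial bound 1 suffices. Otherwise the difference is
    at most exp(-A^2) (B - A) (B + A), where B + A <= 2 (1 + A^2) and exp(-A^2) (1 + A^2) <= 1. *)
Lemma expR_sqr_lip (a b : R) : `|expR (- a ^+ 2) - expR (- b ^+ 2)| <= 2 * `|a - b|.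
Proof.
wlog ab : a b / `|a| <= `|b|.
  move=> h; have [/h//|/ltW/h] := leP `|a| `|b|.
  by rewrite distrC [`|b - a|]distrC.
have e1 : expR (- b ^+ 2) <= expR (- a ^+ 2).
  by rewrite ler_expR lerN2 -[leLHS]real_normK ?num_real// -[leRHS]real_normK ?num_real// ler_sqr ?nnegrE.
rewrite ger0_norm ?subr_ge0//.
have e2 : expR (- a ^+ 2) <= 1 by rewrite -[leRHS]expR0 ler_expR oppr_le0 sqr_ge0.
have e3 := expR_ge0 (- b ^+ 2).
have hd : `|b| - `|a| <= `|a - b|.
  by rewrite distrC; apply: le_trans (lerB_dist _ _).
have [d1|d1] := leP 1 (`|b| - `|a|); first by lra.
set A := `|a| in ab hd d1; set B := `|b| in ab hd d1.
have A0 : 0 <= A by exact: normr_ge0.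
have aE : a ^+ 2 = A ^+ 2 by rewrite real_normK// num_real.
have bE : b ^+ 2 = B ^+ 2 by rewrite real_normK// num_real.
have h1 : expR (- a ^+ 2) - expR (- b ^+ 2) <= expR (- a ^+ 2) * (B ^+ 2 - A ^+ 2).
  have -> : - b ^+ 2 = - a ^+ 2 + (A ^+ 2 - B ^+ 2) by rewrite aE bE; ring.
  rewrite expRD -{1}[expR (- a ^+ 2)]mulr1 -mulrBr ler_pM2l ?expR_gt0//.
  by have := expR_ge1Dx (A ^+ 2 - B ^+ 2); lra.
apply: le_trans h1 _.
have h2 : expR (- a ^+ 2) * (1 + A ^+ 2) <= 1.
  rewrite expRN ler_pdivrMl ?expR_gt0// mulr1 aE; exact: expR_ge1Dx.
have h3 : B + A <= 2 * (1 + A ^+ 2).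
  have := sqr_ge0 (A - 1 / 2); rewrite sqrrB; move: d1; lra.
have -> : B ^+ 2 - A ^+ 2 = (B - A) * (B + A) by ring.
apply: (@le_trans _ _ (expR (- a ^+ 2) * ((B - A) * (2 * (1 + A ^+ 2))))).
  by rewrite ler_pM2l ?expR_gt0// ler_wpM2l// subr_ge0.
have -> : expR (- a ^+ 2) * ((B - A) * (2 * (1 + A ^+ 2))) =
   2 * (B - A) * (expR (- a ^+ 2) * (1 + A ^+ 2)) by ring.
apply: le_trans (ler_wpM2l _ h2) _; first by rewrite mulr_ge0// subr_ge0.
by rewrite mulr1 ler_pM2l.
Qed.

Lemma expR_sqr_holder (be a b : R) : 0 < be -> be <= 1 ->
  `|expR (- a ^+ 2) - expR (- b ^+ 2)| <= 2 * `|a - b| `^ be.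
Proof.
move=> be0 be1.
have e1 x : expR (- x ^+ 2) <= 1 by rewrite -[leRHS]expR0 ler_expR oppr_le0 sqr_ge0.
have [d1|d1] := leP 1 `|a - b|.
  have : 1 <= `|a - b| `^ be.
    by rewrite -[leLHS](@powRr0 _ `|a - b|) ler_powR// ltW.
  have := e1 a; have := e1 b; have := expR_ge0 (- a ^+ 2); have := expR_ge0 (- b ^+ 2).
  by move=> ? ? ? ? ?; rewrite ler_norml; apply/andP; split; lra.
apply: le_trans (expR_sqr_lip a b) _; rewrite ler_pM2l//.
have [->|ab0] := eqVneq `|a - b| 0; first by rewrite powR_ge0.
rewrite -[leLHS](powRr1 (normr_ge0 _)); apply: ger_powR => //.
by rewrite lt_neqAle eq_sym ab0 normr_ge0 ltW.
Qed.

(** Each power of the space increment costs half a power of t. The resulting singularity of order (1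
    + be) / 2 is still integrable in time when be < 1. *)
Lemma heat_kernel_holder be t x y : 0 < be -> be <= 1 ->
  `|heat_kernel t x - heat_kernel t y| <= 2 * `|x - y| `^ be * t `^ (- ((1 + be) / 2)).
Proof.
move=> be0 be1; have [t0|t0] := leP t 0.
  by rewrite !heat_kernel_le0// subrr normr0 !mulr_ge0 ?powR_ge0.
have st : 0 < Num.sqrt t by rewrite sqrtr_gt0.
have E z : z ^+ 2 / (4 * t) = (z / (2 * Num.sqrt t)) ^+ 2.
  rewrite expr_div_n exprMn sqr_sqrtr ?ltW//; congr (_ / (_ * _)); ring.
rewrite /heat_kernel !E -mulrBr normrM ger0_norm ?invr_ge0 ?mulr_ge0 ?sqrtr_ge0//.
set a := x / _; set b := y / _.
have ab : `|a - b| <= `|x - y| * t `^ (- (1 / 2)).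
  rewrite -mulrBl normrM powRNhalf//; apply: ler_wpM2l => //.
  by rewrite normfV gtr0_norm ?mulr_gt0// lef_pV2 ?posrE ?mulr_gt0//; lra.
have h1 : `|expR (- a ^+ 2) - expR (- b ^+ 2)| <= 2 * (`|x - y| `^ be * t `^ (- (1 / 2) * be)).
  apply: le_trans (expR_sqr_holder a b be0 be1) _; rewrite ler_pM2l// powRrM -powRM ?powR_ge0//.
  apply: ge0_ler_powR => //; rewrite ?nnegrE ?mulr_ge0 ?powR_ge0//; exact: ltW.
have hp : 0 <= (2 * Num.sqrt (pi * t))^-1 by rewrite invr_ge0 mulr_ge0// sqrtr_ge0.
apply: le_trans (ler_pM hp (normr_ge0 _) (sqrt_pi_ge t0) h1) _.
rewrite -powRNhalf// (_ : - ((1 + be) / 2) = - (1 / 2) + - (1 / 2) * be); last by field.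
rewrite powRD; last by apply/implyP => _; rewrite gt_eqF.
by rewrite le_eqVlt; apply/orP; left; apply/eqP; ring.
Qed.

(* In v = 1/t the function v exp(-k v) increases up to 1/k and decreases after. *)
Lemma heat_kernel_quasiconcave a b c x : 0 < a -> a < b -> b < c ->
  Num.min (heat_kernel a x) (heat_kernel c x) <= heat_kernel b x.
Proof.
move=> a0 ab bc; have b0 := lt_trans a0 ab; have c0 := lt_trans b0 bc.
pose k := x ^+ 2 / 2; have k0 : 0 <= k by rewrite divr_ge0 ?sqr_ge0.
have sq t : 0 < t -> heat_kernel t x ^+ 2 = (4 * pi)^-1 * (t^-1 * expR (- (k / t))).
  move=> t0; rewrite /heat_kernel exprMn exprVn exprMn sqr_sqrtr; last first.
    by rewrite mulr_ge0 ?pi_ge0 ?ltW.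
  rewrite -expRM_natl (_ : 2 * - (x ^+ 2 / (4 * t)) = - (k / t)); last first.
    by rewrite /k; field; rewrite gt_eqF.
  rewrite mulrA; congr (_ * _); rewrite -invfM; congr (_^-1); ring.
have mono t : 0 < t -> (t^-1 - b^-1) * b <= k * (t^-1 - b^-1) ->
    heat_kernel t x <= heat_kernel b x.
  move=> t0 h; rewrite -ler_sqr ?nnegrE ?heat_kernel_ge0// !sq//.
  rewrite ler_pM2l ?invr_gt0 ?mulr_gt0 ?pi_gt0//.
  have tE : t^-1 = b^-1 * (1 + (t^-1 - b^-1) * b) by field; rewrite !gt_eqF.
  rewrite [X in X * _ <= _]tE -mulrA ler_pM2l ?invr_gt0//.
  have -> : - (k / b) = k * (t^-1 - b^-1) + - (k / t) by field; rewrite !gt_eqF.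
  rewrite expRD; apply: ler_wpM2r; first exact: expR_ge0.
  by apply: le_trans (expR_ge1Dx _); rewrite lerD2l.
rewrite ge_min; have [kb|bk] := leP k b; apply/orP; [right|left]; apply: mono => //.
  rewrite mulrC; apply: ler_wnM2r => //.
  by rewrite subr_le0 lef_pV2 ?posrE// ltW.
rewrite mulrC; apply: ler_wpM2r; last exact: ltW.
by rewrite subr_ge0 lef_pV2 ?posrE// ltW.
Qed.

Lemma heat_kernel_normal t x y : 0 < t ->
  heat_kernel t (x - y) = normal_pdf x (Num.sqrt (2 * t)) y.
Proof.
move=> t0; have s0 : 0 < Num.sqrt (2 * t) by rewrite sqrtr_gt0 mulr_gt0.
rewrite normal_pdfE ?gt_eqF// /normal_peak /normal_fun /heat_kernel.
rewrite sqr_sqrtr ?mulr_ge0 ?(ltW t0)//.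
congr (_^-1 * expR _); last by field; rewrite gt_eqF.
have -> : 2 * t * pi *+ 2 = 2 ^+ 2 * (pi * t) by rewrite -mulr_natl; ring.
by rewrite [RHS]sqrtrM ?sqr_ge0// sqrtr_sqr ger0_norm.
Qed.

Lemma measurable_invr : measurable_fun setT (fun x : R => x^-1).
Proof.
apply: (eq_measurable_fun (fun x => if x == 0 then 0 else if 0 < x then x `^ (-1) else - ((- x) `^ (-1)))).
  move=> x _; case: eqP => [->|/eqP x0]; first by rewrite invr0.
  case: ifPn => [x1|]; first by rewrite powR_inv1// ltW.
  by rewrite -leNgt => x1; rewrite powR_inv1 ?oppr_ge0// invrN opprK.
apply: measurable_fun_ifT.
- exact: measurable_fun_eqr.
- exact: measurable_cst.
apply: measurable_fun_ifT.
- exact: measurable_fun_ltr.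
- exact: measurable_powR.
apply: measurableT_comp => //.
have mN : measurable_fun setT (fun x : R => - x) by exact: measurableT_comp.
exact: (measurableT_comp (@measurable_powR R (- 1)) mN).
Qed.

Lemma measurable_heat_kernel : measurable_fun setT (fun z : R * R => heat_kernel z.1 z.2).
Proof.
apply: measurable_funM.
  apply: (measurableT_comp measurable_invr); apply: measurable_funM => //.
  have ms : measurable_fun setT (Num.sqrt : R -> R) by apply: continuous_measurable_fun; exact: sqrt_continuous.
  by apply: (measurableT_comp ms); apply: measurable_funM.
apply: (measurableT_comp (@measurable_expR R)); apply: measurableT_comp => //.
apply: measurable_funM; first exact: measurable_funX.
by apply: (measurableT_comp measurable_invr); apply: measurable_funM.
Qed.

End heat_kernel.

(** * Oscillatory integrals in time *)

Section ftc_helper.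
Variable R : realType.
Local Notation mu := (@lebesgue_measure R).

Lemma derivable_continuous_pt (f : R -> R) s : derivable f s 1 -> {for s, continuous f}.
Proof. by move=> /derivable1_diffP; exact: differentiable_continuous. Qed.

Lemma FTC_derive (f F : R -> R) (a b : R) : a < b ->
  (forall s, a <= s <= b -> is_derive s 1 F (f s)) ->
  (forall s, a <= s <= b -> derivable f s 1) ->
  (\int[mu]_(s in `[a, b]) (f s)%:E = (F b - F a)%:E)%E.
Proof.
move=> ab dF df; rewrite EFinB; apply: continuous_FTC2 => //.
- apply: continuous_in_subspaceT => s /set_mem /=; rewrite in_itv /= => /df.
  exact: derivable_continuous_pt.
- have cF s : a <= s <= b -> {for s, continuous F}.
    by move=> /dF h; apply: derivable_continuous_pt; exact: ex_derive.
  split.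
  + move=> s; rewrite in_itv /= => /andP[/ltW h1 /ltW h2].
    have h := dF s (_ : a <= s <= b); rewrite h1 h2 in h.
    by have := h isT => {}h; exact: ex_derive.
  + by apply: cvg_at_right_filter; apply: cF; rewrite lexx ltW.
  + by apply: cvg_at_left_filter; apply: cF; rewrite lexx ltW.
- move=> s; rewrite in_itv /= => /andP[/ltW h1 /ltW h2].
  have h : is_derive s 1 F (f s) by apply: dF; rewrite h1 h2.
  by rewrite derive1E derive_val.
Qed.

Lemma is_derive_pow_sub (k t s : R) : s < t ->
  is_derive s 1 (fun s => (t - s) `^ k) (- (k * (t - s) `^ (k - 1))).
Proof.
move=> st; have ts : 0 < t - s by rewrite subr_gt0.
have h1 : is_derive s 1 (fun s : R => t - s) (-1).
  by apply: is_derive_eq; ring.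
have h2 := @is_derive1_powR R k _ ts.
have := @is_derive1_comp R (fun x => x `^ k) (fun s => t - s) s _ _ h2 h1.
by move=> h; apply: is_derive_eq; rewrite ?mulrN1.
Qed.

(* At [s = t] the integrand has the junk value 0. *)
Lemma integral_pow_sub (k c t : R) : 0 < k -> k < 1 -> c < t ->
  (\int[mu]_(s in `[c, t]) ((t - s) `^ (- k))%:E <= ((t - c) `^ (1 - k) / (1 - k))%:E)%E.
Proof.
move=> k0 k1 ct; pose f s := (t - s) `^ (- k).
have mf : measurable_fun setT f.
  by apply: (measurableT_comp (@measurable_powR R (- k))); exact: measurable_funB.
have k1' : 0 < 1 - k by rewrite subr_gt0.
rewrite -integral_itv_bndo_bndc; last by apply/measurable_EFinP; apply: measurable_funTS.
(* The fundamental theorem is applied on [c, a n], away from the singularity, before monotone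
   convergence; denominators starting at 2 keep c < a n. *)
pose a n : R := t - (t - c) / n.+2%:R.
have tc0 : 0 < t - c by rewrite subr_gt0.
have an n : c < a n < t.
  rewrite /a; apply/andP; split; last by rewrite gtrBl divr_gt0.
  by rewrite ltrBrDl -ltrBrDr ltr_pdivrMr// ltr_pMr// ltr1n.
have U : \bigcup_n `[c, a n]%classic = `[c, t[%classic.
  apply/seteqP; split => s /=.
    move=> [n _ /=]; rewrite !in_itv /= => /andP[-> /le_lt_trans]; apply.
    by case/andP: (an n).
  rewrite in_itv /= => /andP[cs st].
  have ts : 0 < t - s by rewrite subr_gt0.
  exists (Num.trunc ((t - c) / (t - s))) => //=; rewrite in_itv /= cs /= /a.
  rewrite lerBrDl -lerBrDr ler_pdivrMr// mulrC -ler_pdivrMr//.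
  apply: ltW; apply: lt_trans (truncnS_gt _) _; by rewrite ltr_nat.
have nd : {homo (fun n => `[c, a n]%classic) : n m / (n <= m)%N >-> (n <= m)%O}.
  move=> n m nm; apply/subsetPset => s /=; rewrite !in_itv /= => /andP[-> /= /le_trans]; apply.
  rewrite /a lerD2l lerN2 ler_pM2l// lef_pV2 ?posrE ?ltr0n// ler_nat !ltnS//.
have cv : (\int[mu]_(s in `[c, a n]) (f s)%:E)%E @[n --> \oo] -->
    (\int[mu]_(s in \bigcup_n `[c, a n]%classic) (f s)%:E)%E.
  apply: ge0_nondecreasing_set_cvg_integral => //.
    by move=> n; apply/measurable_EFinP; exact: measurable_funTS.
  by move=> n s _; rewrite lee_fin powR_ge0.
rewrite U in cv; rewrite -(cvg_lim _ cv)//.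
apply: lime_le; first by apply/cvg_ex; eexists; exact: cv.
apply: nearW => n; have /andP[can ant] := an n.
pose F s := - ((1 - k)^-1 * (t - s) `^ (1 - k)).
have dF s : c <= s <= a n -> is_derive s 1 F (f s).
  move=> /andP[_ sa]; have st : s < t by apply: le_lt_trans ant.
  have h := @is_derive_pow_sub (1 - k) t s st.
  apply: is_derive_eq.
  rewrite /f /GRing.scale /= mulrN opprK mulrA mulVf ?mul1r ?gt_eqF//.
  by congr (_ `^ _); ring.
have df s : c <= s <= a n -> derivable f s 1.
  move=> /andP[_ sa]; have st : s < t by apply: le_lt_trans ant.
  by have h := @is_derive_pow_sub (- k) t s st; exact: ex_derive.
rewrite (FTC_derive can dF df) lee_fin /F opprK.
have h : 0 <= (1 - k)^-1 * (t - a n) `^ (1 - k).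
  by rewrite mulr_ge0 ?powR_ge0// invr_ge0 ltW.
by rewrite addrC [X in _ <= X]mulrC gerBl.
Qed.

End ftc_helper.

Section levels.
Variable R : realType.
Local Notation mu := (@lebesgue_measure R).

Lemma staircase (n : nat) (v : R) : 0 <= v -> v <= n%:R ->
  v <= \sum_(i < n) (i%:R < v)%R%:R <= v + 1.
Proof.
elim: n => [|n IH] v0 vn; first by rewrite big_ord0 vn/= addr_ge0.
rewrite big_ord_recr/=; have [nv|vn'] := ltP n%:R v; last by rewrite addr0 IH.
rewrite (eq_bigr (fun=> 1)); last first.
  by move=> i _; rewrite (lt_trans _ nv)// ltr_nat.
by rewrite sumr_const card_ord natr1 vn/= -natr1 lerD2r ltW.
Qed.

Lemma fine_itv (a b : R) : a <= b -> fine (mu `[a, b]%classic) = b - a.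
Proof.
move=> ab; rewrite lebesgue_measure_itv /= lte_fin; case: ltP => // ba.
by rewrite (_ : b = a) ?subrr//; apply/eqP; rewrite eq_le ab ba.
Qed.

Lemma bounded_integrable (a b M : R) (h : R -> R) : measurable_fun `[a, b] h ->
  (forall s, a <= s <= b -> `|h s| <= M) -> mu.-integrable `[a, b] (EFin \o h).
Proof.
move=> mh hM; apply: measurable_bounded_integrable => //.
  have : (mu `[a, b]%classic < +oo)%E; last exact.
  by rewrite lebesgue_measure_itv /=; case: ifP => //; rewrite -EFinD ltry.
exists M; split => //; first exact: num_real.
move=> x Mx s /=; rewrite in_itv /= => /hM /le_trans; apply; exact: ltW.
Qed.

(** A superlevel set may or may not contain its ends. Closing it adds at most two points, a null
    set. *)
Lemma interval_integral_bound (a b E M : R) (h : R -> R) (S : set R) : 0 <= E ->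
  measurable_fun `[a, b] h -> (forall s, a <= s <= b -> `|h s| <= M) ->
  (forall c e, a <= c -> c <= e -> e <= b -> `|\int[mu]_(s in `[c, e]) h s| <= E) ->
  is_interval S -> S `<=` `[a, b]%classic -> `|\int[mu]_(s in S) h s| <= E.
Proof.
move=> E0 mh hM hE iS Sab.
have [S0|/set0P[x0 Sx0]] := eqVneq S set0.
  by rewrite S0 Rintegral_set0 normr0.
have int_h : mu.-integrable `[a, b] (EFin \o h) by exact: bounded_integrable hM.
have hs : has_sup S.
  by split; [exists x0|exists b => y /Sab /=; rewrite in_itv => /andP[]].
have hi : has_inf S.
  by split; [exists x0|exists a => y /Sab /=; rewrite in_itv => /andP[]].
have ai : a <= inf S by apply: lb_le_inf; [exists x0|move=> y /Sab /=; rewrite in_itv => /andP[]].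
have sb : sup S <= b by apply: ge_sup; [exists x0|move=> y /Sab /=; rewrite in_itv => /andP[]].
have iss : inf S <= sup S.
  apply: (@le_trans _ _ x0); [exact: inf_lbound hi.2 _ Sx0|exact: sup_ubound hs.2 _ Sx0].
have sub : S `<=` `[inf S, sup S]%classic.
  move=> y Sy /=; rewrite in_itv /=; apply/andP.
  by split; [exact: inf_lbound hi.2 _ Sy|exact: sup_ubound hs.2 _ Sy].
have sub2 : `]inf S, sup S[%classic `<=` S.
  move=> y /=; rewrite in_itv /= => /andP[iy ys].
  have [u Su uy] := inf_lt hi.1 iy; have [v Sv yv] := sup_gt hs.1 ys.
  by apply: (iS u v) => //; rewrite (ltW uy) (ltW yv).
have icl : mu.-integrable `[inf S, sup S] (EFin \o h).
  apply: integrableS int_h => // y /=; rewrite !in_itv /= => /andP[h1 h2].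
  by rewrite (le_trans ai h1) (le_trans h2 sb).
rewrite (_ : \int[mu]_(s in S) h s = \int[mu]_(s in `[inf S, sup S]) h s); first exact: hE.
have mS : measurable S.
  have [b1 [b2 ->]] : exists b1 b2 : itv_bound R, S = [set` Interval b1 b2].
    by have /is_intervalP -> := iS; case: (Rhull S) => b1 b2; exists b1, b2.
  exact: measurable_itv.
have mD : measurable (`[inf S, sup S]%classic `\` S) by exact: measurableD.
have EU : S `|` (`[inf S, sup S]%classic `\` S) = `[inf S, sup S]%classic by rewrite setDUK.
rewrite -EU; rewrite -EU in icl.
rewrite Rintegral_setU//.
- rewrite [X in _ = _ + X](_ : _ = 0) ?addr0//.
  have z : mu (`[inf S, sup S]%classic `\` S) = 0%E.
    apply/eqP; rewrite eq_le measure_ge0 andbT.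
    apply: (@le_trans _ _ (mu ([set inf S] `|` [set sup S]))).
      apply: le_measure; rewrite ?inE//; first exact: measurableU.
      move=> y [/=]; rewrite in_itv /= => /andP[h1 h2] nS.
      have [->|ni] := eqVneq y (inf S); [by left|].
      have [->|ns] := eqVneq y (sup S); [by right|].
      exfalso; apply: nS; apply: sub2 => /=; rewrite in_itv /= !lt_neqAle h1 h2 ns.
      by rewrite eq_sym ni.
    apply: le_trans (measureU2 _ _ _) _ => //.
    by rewrite -[leRHS]adde0; apply: leeD; rewrite le_eqVlt; apply/orP; left; apply/eqP; exact: lebesgue_measure_set1.
  rewrite /Rintegral (_ : (\int[mu]_(s in _) _)%E = 0%E)//.
  apply: null_set_integral => //.
  apply: measurable_funS (measurable_int _ icl) => //; exact: measurableU.
- by apply/disj_setPS; rewrite setDIK.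
Qed.

(* Approximating f by n staircase levels, each superlevel set contributes at most E. *)
Lemma quasiconcave_integral_bound (a b La E M : R) (f h : R -> R) :
  a <= b -> 0 < La -> 0 <= E ->
  measurable_fun `[a, b] f -> measurable_fun `[a, b] h ->
  (forall s, a <= s <= b -> 0 <= f s <= La) -> (forall s, a <= s <= b -> `|h s| <= M) ->
  (forall c, is_interval [set s | a <= s <= b /\ c < f s]) ->
  (forall c e, a <= c -> c <= e -> e <= b -> `|\int[mu]_(s in `[c, e]) h s| <= E) ->
  `|\int[mu]_(s in `[a, b]) (f s * h s)| <= La * E.
Proof.
move=> ab La0 E0 mf mh hf hM hi hE.
have M0 : 0 <= M by apply: le_trans (hM a _); rewrite ?lexx.
have mD : measurable `[a, b]%classic by [].
have sub s : `[a, b]%classic s = (a <= s <= b) by rewrite /= in_itv.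
suff key n : `|\int[mu]_(s in `[a, b]) (f s * h s)| <= La * E + La / n.+1%:R * M * (b - a).
  apply/ler_addgt0Pr => e e0.
  pose n := Num.trunc (La * M * (b - a) / e).
  apply: le_trans (key n) _; rewrite lerD2l.
  have -> : La / n.+1%:R * M * (b - a) = La * M * (b - a) / n.+1%:R.
    by move: (n.+1%:R^-1) => i; ring.
  rewrite ler_pdivrMr ?ltr0n// -ler_pdivrMl// mulrC.
  by apply: ltW; exact: truncnS_gt.
pose A (i : nat) := [set s | a <= s <= b /\ La / n.+1%:R * i%:R < f s].
have mA i : measurable (A i).
  have [b1 [b2 ->]] : exists b1 b2 : itv_bound R, A i = [set` Interval b1 b2].
    have iA : is_interval (A i) by exact: hi.
    by have /is_intervalP -> := iA; case: (Rhull _) => b1 b2; exists b1, b2.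
  exact: measurable_itv.
have Asub i : A i `<=` `[a, b]%classic by move=> s [+ _]; rewrite sub.
pose fn s := La / n.+1%:R * \sum_(i < n.+1) (\1_(A i) s : R).
have ln0 : 0 < La / n.+1%:R by rewrite divr_gt0.
have hfn s : a <= s <= b -> `|f s - fn s| <= La / n.+1%:R.
  move=> sab; have /andP[f0 fL] := hf s sab.
  have fv : f s = La / n.+1%:R * (f s / (La / n.+1%:R)) by field; rewrite gt_eqF//= gt_eqF.
  set v := f s / _ in fv.
  have v0 : 0 <= v by rewrite divr_ge0// ltW.
  have vn : v <= n.+1%:R.
    by rewrite /v ler_pdivrMr// mulrC -mulrA mulVf ?mulr1 ?pnatr_eq0.
  have -> : fn s = La / n.+1%:R * \sum_(i < n.+1) (i%:R < v)%R%:R.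
    congr (_ * _); apply: eq_bigr => i _; rewrite indicE; congr (nat_of_bool _)%:R.
    rewrite /v ltr_pdivlMr// mulrC; apply/idP/idP; first by rewrite inE => -[].
    by move=> h'; rewrite inE.
  rewrite {1}fv -mulrBr normrM (gtr0_norm ln0); apply: ler_piMr; first exact: ltW.
  by have /andP[h1 h2] := staircase v0 vn; rewrite ler_norml; apply/andP; split; lra.
have mfn : measurable_fun setT fn.
  by apply: measurable_funM => //; apply: measurable_sum => i; exact: measurable_indic.
have fn0 s : 0 <= fn s by rewrite mulr_ge0 ?sumr_ge0// ltW.
have fnLa s : fn s <= La.
  rewrite /fn mulrAC ler_pdivrMr// ler_pM2l//.
  apply: (@le_trans _ _ (\sum_(i < n.+1) 1)); last by rewrite sumr_const card_ord.
  by apply: ler_sum => i _; rewrite indicE lern1 leq_b1.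
have i1 : mu.-integrable `[a, b] (EFin \o (fun s => (f s - fn s) * h s)).
  apply: (@bounded_integrable _ _ (La / n.+1%:R * M)).
    apply: measurable_funM => //; apply: measurable_funB => //; exact: measurable_funTS.
  by move=> s sab; rewrite normrM ler_pM ?hfn ?hM.
have ih : mu.-integrable `[a, b] (EFin \o h) by exact: bounded_integrable hM.
have iA i : mu.-integrable `[a, b] (EFin \o (fun s => \1_(A i) s * h s)).
  apply: (@bounded_integrable _ _ M).
    by apply: measurable_funM => //; exact: measurable_indic.
  move=> s sab; rewrite normrM -[leRHS]mul1r ler_pM ?hM//.
  by rewrite ger0_norm// indicE lern1 leq_b1.
have i2 : mu.-integrable `[a, b] (EFin \o (fun s => fn s * h s)).
  apply: (@bounded_integrable _ _ (La * M)).
    by apply: measurable_funM => //; exact: measurable_funTS.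
  by move=> s sab; rewrite normrM ler_pM ?hM// ger0_norm.
have -> : \int[mu]_(s in `[a, b]) (f s * h s) =
    \int[mu]_(s in `[a, b]) (fn s * h s) + \int[mu]_(s in `[a, b]) ((f s - fn s) * h s).
  rewrite -RintegralD//; apply: eq_Rintegral => s _; ring.
apply: le_trans (ler_normD _ _) _; apply: lerD.
  have IA i : `|\int[mu]_(s in `[a, b]) (\1_(A i) s * h s)| <= E.
    have -> : \int[mu]_(s in `[a, b]) (\1_(A i) s * h s) = \int[mu]_(s in A i) h s.
      rewrite -[X in \int[mu]_(s in X) h s](setIidr (Asub i)) [RHS]Rintegral_mkcondr.
      apply: eq_Rintegral => s _; rewrite patchE indicE.
      by case: ifP => _; rewrite ?mul1r ?mul0r.
    exact: (interval_integral_bound E0 mh hM hE (hi _) (Asub i)).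
  have sumI (k : nat) : mu.-integrable `[a, b] (EFin \o (fun s => (\sum_(i < k) (\1_(A i) s : R)) * h s)) /\
      `|\int[mu]_(s in `[a, b]) ((\sum_(i < k) (\1_(A i) s : R)) * h s)| <= k%:R * E.
    elim: k => [|k [I1 I2]].
      have e0 : (fun s => (\sum_(i < 0) (\1_(A i) s : R)) * h s) = cst 0.
        by apply/funext => s; rewrite big_ord0 mul0r.
      rewrite e0; split; first exact: integrable0.
      by rewrite Rintegral_cst// mul0r normr0 mul0r.
    have ek : (fun s => (\sum_(i < k.+1) (\1_(A i) s : R)) * h s) =
        (fun s => (\sum_(i < k) (\1_(A i) s : R)) * h s + \1_(A k) s * h s).
      by apply/funext => s; rewrite big_ord_recr/= mulrDl.
    rewrite ek; split.
      pose u1 s : R := (\sum_(i < k) (\1_(A i) s : R)) * h s.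
      pose u2 s : R := \1_(A k) s * h s.
      rewrite (_ : EFin \o _ = ((EFin \o u1) \+ (EFin \o u2))%E).
        by apply: integrableD => //; exact: iA.
      by apply/funext => s /=; rewrite EFinD.
    rewrite RintegralD//; apply: le_trans (ler_normD _ _) _.
    by rewrite -natr1 mulrDl mul1r lerD.
  have [I1 I2] := sumI n.+1.
  rewrite (_ : \int[mu]_(s in `[a, b]) (fn s * h s) = La / n.+1%:R *
     \int[mu]_(s in `[a, b]) ((\sum_(i < n.+1) (\1_(A i) s : R)) * h s)).
    rewrite normrM (gtr0_norm ln0); apply: le_trans (ler_wpM2l (ltW ln0) I2) _.
    by rewrite mulrA -[La / _ * _]mulrA mulVf ?mulr1 ?pnatr_eq0.
  by rewrite -RintegralZl//; apply: eq_Rintegral => s _; rewrite mulrA.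
apply: le_trans (le_normr_Rintegral _ _) _ => //.
apply: (@le_trans _ _ (\int[mu]_(s in `[a, b]) (La / n.+1%:R * M))).
  apply: le_Rintegral => //.
  - have := integrable_norm i1; exact.
  - by apply: (@bounded_integrable _ _ `|La / n.+1%:R * M|).
  - by move=> s; rewrite sub => sab; rewrite normrM ler_pM ?hfn ?hM.
rewrite Rintegral_cst//; rewrite (_ : fine _ = b - a)//; exact: fine_itv.
Qed.

End levels.

(** * The noise coefficient *)

Section scaling.
Variable R : realType.
Local Notation mu := (@lebesgue_measure R).

Lemma lebesgue_measure_scale (e : R) (A : set R) : 0 < e -> measurable A ->
  pushforward mu (fun s : R => s / e : measurableTypeR R) A = (e%:E * mu A)%E.
Proof.
move=> e0 mA; have e0' : 0 <= e^-1 by rewrite invr_ge0 ltW.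
have mphi : measurable_fun setT (fun s : R => s / e : measurableTypeR R).
  exact: measurable_funM.
have h : mu A = pushforward (mscale (NngNum e0') mu) (fun s : R => s / e : measurableTypeR R) A.
  apply: lebesgue_measure_unique => // _ [[a b]] _ <-.
  rewrite /mscale /= /pushforward.
  have -> : (fun s : R => s / e : measurableTypeR R) @^-1` `]a, b]%classic = `]a * e, b * e]%classic.
    apply/seteqP; split => s /=; rewrite !in_itv /=;
      by rewrite ltr_pdivlMr// ler_pdivrMr.
  rewrite [RHS](_ : _ = ((e^-1)%:E * mu `](a * e)%R, (b * e)%R]%classic)%E)//.
  rewrite !lebesgue_measure_itv /= !lte_fin ltr_pM2r//.
  case: ifP => _; last by rewrite mule0.
  by rewrite -!EFinD -EFinM; congr EFin; field; rewrite gt_eqF.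
by rewrite h /pushforward /mscale /= muleA -EFinM divff ?mul1e// gt_eqF.
Qed.

(** Nonnegative integrands are treated through the image measure; a bounded f is reduced to them by
    adding M, and the integrals of the constant cancel. *)
Lemma Rintegral_scale (f : R -> R) (e r M : R) : 0 < e -> 0 <= r ->
  measurable_fun `[0, r / e] f -> (forall s, 0 <= s <= r / e -> `|f s| <= M) ->
  \int[mu]_(s in `[0, r]) f (s / e) = e * \int[mu]_(s in `[0, r / e]) f s.
Proof.
move=> e0 r0 mf fM.
have mphi : measurable_fun setT (fun s : measurableTypeR R => (s : R) / e : measurableTypeR R).
  exact: measurable_funM.
have ge0 (g : R -> R) : measurable_fun `[0, r / e] g -> (forall s, 0 <= s <= r / e -> 0 <= g s) ->
    \int[mu]_(s in `[0, r]) g (s / e) = e * \int[mu]_(s in `[0, r / e]) g s.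
  move=> mg g0; rewrite /Rintegral.
  have gin s : `[0, r / e]%classic s -> (0 <= (g s)%:E)%E.
    by rewrite /= in_itv /= lee_fin => /g0.
  have E1 := @ge0_integral_pushforward _ _ _ (measurableTypeR R) R _ mphi mu `[0, r / e]%classic (EFin \o g)
    (measurable_itv _) (_ : measurable_fun _ _) (_ : {in _, _}).
  have {}E1 := E1 ((measurable_EFinP _ _).2 mg) (fun s hs => gin s (set_mem hs)).
  have E2 : (fun s : R => s / e : measurableTypeR R) @^-1` `[0, r / e]%classic = `[0, r]%classic.
    apply/seteqP; split => s /=; rewrite !in_itv /= ler_pM2r ?invr_gt0//.
      by move=> /andP[h ->]; rewrite andbT -(pmulr_lge0 _ (_ : 0 < e^-1)) ?invr_gt0.
    by move=> /andP[h ->]; rewrite andbT divr_ge0// ltW.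
  rewrite E2 in E1; rewrite -[in LHS]E1.
  rewrite [X in fine X = _](@eq_measure_integral _ _ _ _ (mscale (NngNum (ltW e0)) mu)); last first.
    move=> A mA _; exact: lebesgue_measure_scale.
  rewrite ge0_integral_mscale//=; last exact/measurable_EFinP.
  have [i|i] := boolP (\int[mu]_(s in `[0%R, (r / e)%R]) (g s)%:E \is a fin_num)%E.
    by rewrite fineM.
  have gb : (0 <= \int[mu]_(s in `[0%R, (r / e)%R]) (g s)%:E)%E.
    by apply: integral_ge0 => s; exact: gin.
  have -> : (\int[mu]_(s in `[0%R, (r / e)%R]) (g s)%:E = +oo)%E.
    by move: gb i; case: (integral _ _ _).
  by rewrite /= mulr0 mulry gtr0_sg// mul1e.
have M0 : 0 <= M.
  by apply: le_trans (fM 0 _); rewrite ?normr_ge0// lexx divr_ge0// ltW.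
have mfe : measurable_fun `[0, r] (fun s => f (s / e)).
  apply: (measurable_comp (F := `[0, r / e]%classic)) => //.
    move=> _ /= [s + <-]; rewrite !in_itv /= => /andP[s0 sr].
    by rewrite divr_ge0 ?(ltW e0)//= ler_pM2r ?invr_gt0.
  exact: measurable_funTS.
have h1 := ge0 (fun s => f s + M).
have {}h1 : \int[mu]_(s in `[0, r]) (f (s / e) + M) = e * \int[mu]_(s in `[0, r / e]) (f s + M).
  apply: h1; first by apply: measurable_funD.
  by move=> s /fM; rewrite ler_norml => /andP[h _]; lra.
have re0 : 0 <= r / e by rewrite divr_ge0// ltW.
have ic (b : R) : mu.-integrable `[0, b] (EFin \o cst M).
  by apply: (@bounded_integrable _ _ _ `|M|).
rewrite RintegralD// in h1; last first.
  apply: (@bounded_integrable _ _ _ M) => // s /andP[s0 sr]; apply: fM.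
  by rewrite divr_ge0 ?(ltW e0)//= ler_pM2r ?invr_gt0.
rewrite RintegralD// in h1; last exact: bounded_integrable fM.
rewrite !Rintegral_cst// mulrDr in h1.
move: h1; rewrite (_ : fine _ = r - 0); last exact: fine_itv.
rewrite (_ : fine _ = r / e - 0); last exact: fine_itv.
rewrite !subr0 (_ : e * (M * (r / e)) = M * r); last by field; rewrite gt_eqF.
exact: addIr.
Qed.

Lemma pow_dominated (u : R -> R) (A k c t : R) : 0 <= A -> 0 < k -> k < 1 -> c < t ->
  measurable_fun `[c, t] u -> (forall s, c <= s <= t -> `|u s| <= A * (t - s) `^ (- k)) ->
  mu.-integrable `[c, t] (EFin \o u) /\
  `|\int[mu]_(s in `[c, t]) u s| <= A * ((t - c) `^ (1 - k) / (1 - k)).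
Proof.
move=> A0 k0 k1 ct mu_u hu; pose g s := (t - s) `^ (- k).
have mg : measurable_fun setT g.
  by apply: (measurableT_comp (@measurable_powR R (- k))); exact: measurable_funB.
have hg := integral_pow_sub k0 k1 ct.
have g0 s : (0 <= (g s)%:E)%E by rewrite lee_fin powR_ge0.
have ig : mu.-integrable `[c, t] (EFin \o g).
  apply/integrableP; split; first by apply/measurable_EFinP; exact: measurable_funTS.
  apply: le_lt_trans (ltry ((t - c) `^ (1 - k) / (1 - k))); apply: le_trans hg.
  rewrite le_eqVlt; apply/orP; left; apply/eqP/eq_integral => s _ /=.
  by rewrite ger0_norm ?powR_ge0.
have iAg : mu.-integrable `[c, t] (EFin \o (fun s => A * g s)).
  rewrite (_ : EFin \o _ = (fun s => A%:E * (EFin \o g) s)%E); last by apply/funext => s /=; rewrite EFinM.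
  exact: integrableZl.
have iu : mu.-integrable `[c, t] (EFin \o u).
  apply: (le_integrable _ _ _ iAg) => //; first exact/measurable_EFinP.
  move=> s /=; rewrite in_itv /= => /hu h; rewrite lee_fin [leRHS]ger0_norm//.
  by rewrite mulr_ge0 ?powR_ge0.
split=> //; apply: le_trans (le_normr_Rintegral _ iu) _ => //.
apply: (@le_trans _ _ (\int[mu]_(s in `[c, t]) (A * g s))).
  by apply: le_Rintegral => //; exact: (integrable_norm iu).
rewrite RintegralZl//; apply: ler_wpM2l => //.
rewrite -lee_fin fineK//; exact: integrable_fin_num.
Qed.

End scaling.

(** * Size and regularity of the difference of the two noise coefficients *)

Section coefficients.
Variable R : realType.
Local Notation mu := (@lebesgue_measure R).
Variables (sigma : R -> R -> R) (sigma_bar : R -> R) (Ms be L MG : R).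
Hypothesis sigma_meas : measurable_fun [set z : R * R | 0 <= z.1]
  (fun z : R * R => sigma z.1 z.2).
Hypothesis sigma_bnd : forall s y : R, 0 <= s -> `|sigma s y| <= Ms.
Hypothesis be_bounds : 1 / 2 < be < 1.
Hypothesis sigma_holder : forall s y1 y2 : R, 0 <= s ->
  `|sigma s y1 - sigma s y2| <= L * `|y1 - y2| `^ be.
Hypothesis G_bnd : forall r y : R, 0 <= r ->
  `| \int[mu]_(s in `[0, r]) (sigma s y - sigma_bar y) | <= MG.

Let Ms0 : 0 <= Ms. Proof. exact: le_trans (sigma_bnd 0 (lexx 0)). Qed.
Let MG0 : 0 <= MG. Proof. exact: le_trans (G_bnd 0 (lexx 0)). Qed.
Let L0 : 0 <= L.
Proof. by have := sigma_holder 1 0 (lexx 0); rewrite subr0 normr1 powR1 mulr1; exact: le_trans. Qed.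

Lemma measurable_sigma_section y : measurable_fun [set s : R | 0 <= s] (sigma ^~ y).
Proof.
have mF : measurable [set z : R * R | 0 <= z.1].
  rewrite (_ : [set z | _] = `[0, +oo[%classic `*` setT); first exact: measurableX.
  by apply/seteqP; split => z /=; rewrite in_itv /= andbT => // -[].
have sF : [set (s, y) | s in [set s : R | 0 <= s]] `<=` [set z : R * R | 0 <= z.1].
  by move=> _ [s s0 <-].
have mg : measurable_fun [set s : R | 0 <= s] (fun s : R => (s, y)).
  by apply: measurable_funTS; exact: measurable_pair2.
exact: (measurable_comp mF sF sigma_meas mg).
Qed.

Lemma measurable_sigma_itv (y r : R) : measurable_fun `[0, r] (sigma ^~ y).
Proof.
apply: measurable_funS (measurable_sigma_section y).
  rewrite (_ : [set s : R | _] = `[0, +oo[%classic) //.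
  by apply/seteqP; split => z /=; rewrite in_itv /= andbT.
by move=> s /=; rewrite in_itv /= => /andP[].
Qed.

Lemma integrable_sigma (y r : R) : mu.-integrable `[0, r] (EFin \o sigma ^~ y).
Proof.
apply: (@bounded_integrable _ _ _ Ms); first exact: measurable_sigma_itv.
by move=> s /andP[s0 _]; exact: sigma_bnd.
Qed.

Let icst (r c : R) : mu.-integrable `[0, r] (EFin \o cst c).
Proof. by apply: (@bounded_integrable _ _ _ `|c|). Qed.

(** The subtracted term is the bounded function G. Dividing by a large r therefore transfers to
    [sigma_bar] every bound on [sigma] that is uniform in time. *)
Lemma mean_sigma (y r : R) : 0 < r -> r * sigma_bar y =
  \int[mu]_(s in `[0, r]) sigma s y - \int[mu]_(s in `[0, r]) (sigma s y - sigma_bar y).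
Proof.
move=> r0; rewrite RintegralB//; [|exact: integrable_sigma|exact: icst].
rewrite opprB addrC subrK Rintegral_cst// mulrC; congr (_ * _).
by rewrite -[LHS]subr0; apply/esym/fine_itv; exact: ltW.
Qed.

Lemma small_ratio (a e : R) : 0 <= a -> 0 < e -> exists2 r, 0 < r & a / r <= e.
Proof.
move=> a0 e0; exists ((a + 1) / e); first by rewrite divr_gt0// ltr_wpDl.
have a1 : 0 < a + 1 by rewrite ltr_wpDl.
rewrite invf_div mulrA ler_pdivrMr// mulrC; apply: ler_wpM2l; first exact: ltW.
by rewrite lerDl.
Qed.

Lemma norm_Rintegral_le (u : R -> R) (r M : R) : 0 <= r ->
  measurable_fun `[0, r] u -> (forall s, 0 <= s <= r -> `|u s| <= M) ->
  `|\int[mu]_(s in `[0, r]) u s| <= M * r.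
Proof.
move=> r0 mu_u hu; have iu := bounded_integrable mu_u hu.
apply: le_trans (le_normr_Rintegral _ iu) _ => //.
apply: (@le_trans _ _ (\int[mu]_(s in `[0, r]) M)).
  by apply: le_Rintegral => //; [exact: (integrable_norm iu)|exact: icst].
by rewrite Rintegral_cst// (_ : fine _ = r - 0) ?subr0// -[RHS]subr0; exact: fine_itv.
Qed.

Lemma sigma_bar_bnd y : `|sigma_bar y| <= Ms.
Proof.
apply/ler_addgt0Pr => e e0; have [r r0 hr] := small_ratio MG0 e0.
have h : `|r * sigma_bar y| <= Ms * r + MG.
  rewrite mean_sigma//; apply: le_trans (ler_normB _ _) _; apply: lerD; last exact: G_bnd (ltW r0).
  apply: norm_Rintegral_le; [exact: ltW|exact: measurable_sigma_itv|].
  by move=> s /andP[s0 _]; exact: sigma_bnd.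
rewrite normrM (gtr0_norm r0) in h; rewrite -(ler_pM2l r0); apply: le_trans h _.
by rewrite mulrDr [r * Ms]mulrC lerD2l -ler_pdivrMl// mulrC.
Qed.

Lemma sigma_bar_holder y1 y2 : `|sigma_bar y1 - sigma_bar y2| <= L * `|y1 - y2| `^ be.
Proof.
apply/ler_addgt0Pr => e e0; have [r r0 hr] := small_ratio (mulr_ge0 (ler0n R 2) MG0) e0.
have h : `|r * (sigma_bar y1 - sigma_bar y2)| <= L * `|y1 - y2| `^ be * r + 2 * MG.
  rewrite mulrBr !mean_sigma//.
  set g1 := \int[mu]_(s in _) (_ - _); set g2 := \int[mu]_(s in _) (_ - _).
  set a1 := \int[mu]_(s in _) _; set a2 := \int[mu]_(s in _) _.
  have -> : a1 - g1 - (a2 - g2) = (a1 - a2) + (g2 - g1) by ring.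
  have hg : `|g2 - g1| <= 2 * MG.
    apply: le_trans (ler_normB _ _) _; rewrite mulr_natl mulr2n; apply: lerD; exact: G_bnd (ltW r0).
  apply: le_trans (ler_normD _ _) _; apply: lerD => //.
  rewrite /a1 /a2 -RintegralB//; [|exact: integrable_sigma..].
  apply: norm_Rintegral_le; [exact: ltW| |].
    by apply: measurable_funB; exact: measurable_sigma_itv.
  by move=> s /andP[s0 _]; exact: sigma_holder.
rewrite normrM (gtr0_norm r0) in h; rewrite -(ler_pM2l r0); apply: le_trans h _.
by rewrite mulrDr [r * (L * _)]mulrC lerD2l -ler_pdivrMl// mulrC.
Qed.

Section fixed_eps.
Variables (eps : R).
Hypothesis eps0 : 0 < eps.

Definition dev (s y : R) := sigma (s / eps) y - sigma_bar y.

Lemma dev_bnd s y : 0 <= s -> `|dev s y| <= 2 * Ms.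
Proof.
move=> s0; apply: le_trans (ler_normB _ _) _; rewrite mulr_natl mulr2n; apply: lerD.
  by apply: sigma_bnd; rewrite divr_ge0// ltW.
exact: sigma_bar_bnd.
Qed.

Lemma dev_holder s y1 y2 : 0 <= s -> `|dev s y1 - dev s y2| <= 2 * L * `|y1 - y2| `^ be.
Proof.
move=> s0; rewrite /dev.
have -> : sigma (s / eps) y1 - sigma_bar y1 - (sigma (s / eps) y2 - sigma_bar y2) =
  (sigma (s / eps) y1 - sigma (s / eps) y2) - (sigma_bar y1 - sigma_bar y2) by ring.
apply: le_trans (ler_normB _ _) _; rewrite -mulrA mulr_natl mulr2n; apply: lerD.
  by apply: sigma_holder; rewrite divr_ge0// ltW.
exact: sigma_bar_holder.
Qed.

Lemma measurable_sigma_eps (y t : R) : measurable_fun `[0, t] (fun s => sigma (s / eps) y).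
Proof.
have mF : measurable [set s : R | 0 <= s].
  rewrite (_ : [set s : R | _] = `[0, +oo[%classic) //.
  by apply/seteqP; split => z /=; rewrite in_itv /= andbT.
have sF : [set s / eps | s in `[0, t]] `<=` [set s : R | 0 <= s].
  by move=> _ [s /= + <-]; rewrite in_itv /= => /andP[s0 _]; rewrite divr_ge0// ltW.
have mg : measurable_fun `[0, t] (fun s : R => s / eps).
  by apply: measurable_funTS; exact: measurable_funM.
exact: (measurable_comp mF sF (measurable_sigma_section y) mg).
Qed.

Lemma measurable_dev (y t : R) : measurable_fun `[0, t] (dev ^~ y).
Proof. by apply: measurable_funB => //; exact: measurable_sigma_eps. Qed.

(** The substitution s = eps s' turns the primitive at r into eps G(r / eps); an interval [c, e]
    takes the difference of two such values. *)
Lemma dev_integral (y c e : R) : 0 <= c -> c <= e ->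
  `|\int[mu]_(s in `[c, e]) dev s y| <= 2 * (eps * MG).
Proof.
move=> c0 ce; have e0 : 0 <= e by exact: le_trans ce.
have id r : mu.-integrable `[0, r] (EFin \o dev ^~ y).
  apply: (@bounded_integrable _ _ _ (2 * Ms)); first exact: measurable_dev.
  by move=> s /andP[s0 _]; exact: dev_bnd.
have H r : 0 <= r -> `|\int[mu]_(s in `[0, r]) dev s y| <= eps * MG.
  move=> r0; rewrite (@Rintegral_scale _ (fun s => sigma s y - sigma_bar y) eps r (2 * Ms))//.
  - rewrite normrM (gtr0_norm eps0); apply: ler_wpM2l; first exact: ltW.
    by apply: G_bnd; rewrite divr_ge0// ltW.
  - by apply: measurable_funB => //; exact: measurable_sigma_itv.
  - move=> s /andP[s0 _]; apply: le_trans (ler_normB _ _) _; rewrite mulr_natl mulr2n.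
    by apply: lerD; [exact: sigma_bnd|exact: sigma_bar_bnd].
rewrite -(@Rintegral_itv_obnd_cbnd _ c (BRight e)); last first.
  apply: integrableS (id e) => // s /=; rewrite !in_itv /= => /andP[cs ->].
  by rewrite (le_trans c0 (ltW cs)).
rewrite -(@Rintegral_itvB _ _ (BLeft 0) (BRight e) c)//.
apply: le_trans (ler_normB _ _) _; rewrite mulr_natl mulr2n.
by apply: lerD; exact: H.
Qed.

Lemma measurable_heat_section (t z : R) : measurable_fun setT (fun s : R => heat_kernel (t - s) z).
Proof.
have mg : measurable_fun setT (fun s : R => (t - s, z)).
  by apply: measurable_fun_pair => //; exact: measurable_funB.
exact: (measurableT_comp (@measurable_heat_kernel R) mg).
Qed.

Lemma heat_dominated (u : R -> R) (t c z A : R) : 0 <= A -> 0 <= c -> c < t ->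
  measurable_fun `[0, t] u -> (forall s, c <= s <= t -> `|u s| <= A) ->
  mu.-integrable `[c, t] (EFin \o (fun s => heat_kernel (t - s) z * u s)) /\
  `|\int[mu]_(s in `[c, t]) (heat_kernel (t - s) z * u s)| <= 2 * A * Num.sqrt (t - c).
Proof.
move=> A0 c0 ct mu_u hu.
have tc : 0 < t - c by rewrite subr_gt0.
have -> : 2 * A * Num.sqrt (t - c) = A * ((t - c) `^ (1 - 1 / 2) / (1 - 1 / 2)).
  have -> : 1 - 1 / 2 = 2^-1 :> R by field.
  by rewrite powR12_sqrt ?(ltW tc)//; field.
apply: pow_dominated => //; [lra| |].
  apply: measurable_funM; first by apply: measurable_funTS; exact: measurable_heat_section.
  apply: measurable_funS mu_u => // s /=; rewrite !in_itv /= => /andP[cs ->].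
  by rewrite (le_trans c0 cs).
move=> s hs; rewrite normrM mulrC; apply: ler_pM => //; first exact: hu.
by rewrite ger0_norm ?heat_kernel_ge0//; exact: heat_kernel_le.
Qed.

Definition coef (t x y : R) := \int[mu]_(s in `[0, t]) (heat_kernel (t - s) (x - y) * dev s y).

Lemma coefE (t x y : R) : 0 < t ->
  \int[mu]_(s in `[0, t]) (heat_kernel (t - s) (x - y) * sigma (s / eps) y) -
  \int[mu]_(s in `[0, t]) (heat_kernel (t - s) (x - y) * sigma_bar y) = coef t x y.
Proof.
move=> t0; rewrite /coef -RintegralB//.
- by apply: eq_Rintegral => s _; rewrite mulrBr.
- apply: (proj1 (@heat_dominated _ t 0 (x - y) Ms _ _ _ _ _)) => //; first exact: measurable_sigma_eps.
  by move=> s /andP[s0 _]; apply: sigma_bnd; rewrite divr_ge0// ltW.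
- apply: (proj1 (@heat_dominated (cst (sigma_bar y)) t 0 (x - y) Ms _ _ _ _ _)) => //.
  by move=> s _; exact: sigma_bar_bnd.
Qed.

Lemma heat_level_interval (t b z c : R) : b < t ->
  is_interval [set s | 0 <= s <= b /\ c < heat_kernel (t - s) z].
Proof.
move=> bt s1 s2 [/andP[s10 s1b] h1] [/andP[s20 s2b] h2] s /andP[ss1 ss2].
split; first by rewrite (le_trans s10 ss1) (le_trans ss2 s2b).
move: ss1; rewrite le_eqVlt => /orP[/eqP <-//|ss1].
move: ss2; rewrite le_eqVlt => /orP[/eqP ->//|ss2].
have a0 : 0 < t - s2 by rewrite subr_gt0; exact: le_lt_trans bt.
have ab : t - s2 < t - s by rewrite ltrD2l ltrN2.
have bc : t - s < t - s1 by rewrite ltrD2l ltrN2.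
apply: lt_le_trans (heat_kernel_quasiconcave z a0 ab bc).
by rewrite lt_min h1 h2.
Qed.

(** On the last stretch of length eps the kernel singularity alone gives 4 Ms sqrt eps. Before it
    the kernel is at most eps^(-1/2) and the integrals of [dev] are at most 2 eps MG, so
    quasiconcavity gives 2 MG sqrt eps. For t <= eps the first estimate covers everything. *)
Lemma coef_small (t x y : R) : 0 < t -> `|coef t x y| <= (4 * Ms + 2 * MG) * Num.sqrt eps.
Proof.
move=> t0; have M20 : 0 <= 2 * Ms by rewrite mulr_ge0.
have dM c s : 0 <= c -> c <= s <= t -> `|dev s y| <= 2 * Ms.
  by move=> c0 /andP[cs _]; apply: dev_bnd; exact: le_trans cs.
have [et|te] := ltP eps t; last first.
  have [_ h] := @heat_dominated (dev ^~ y) t 0 (x - y) (2 * Ms) M20 (lexx 0) t0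
     (@measurable_dev y t) (fun s => @dM 0 s (lexx 0)).
  apply: le_trans h _; rewrite subr0 mulrA -natrM; apply: ler_pM; rewrite ?sqrtr_ge0 ?mulr_ge0//.
    by rewrite lerDl mulr_ge0.
  by rewrite ler_wsqrtr.
have te0 : 0 < t - eps by rewrite subr_gt0.
have [int_all _] := @heat_dominated (dev ^~ y) t 0 (x - y) (2 * Ms) M20 (lexx 0) t0
     (@measurable_dev y t) (fun s => @dM 0 s (lexx 0)).
have tet : t - eps < t by rewrite gtrBl.
have [_ h2] := @heat_dominated (dev ^~ y) t (t - eps) (x - y) (2 * Ms) M20 (ltW te0) tet
     (@measurable_dev y t) (fun s => @dM _ s (ltW te0)).
rewrite /coef.
have -> : \int[mu]_(s in `[0, t]) (heat_kernel (t - s) (x - y) * dev s y) =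
  \int[mu]_(s in `[0, t - eps]) (heat_kernel (t - s) (x - y) * dev s y) +
  \int[mu]_(s in `[t - eps, t]) (heat_kernel (t - s) (x - y) * dev s y).
  rewrite -(@Rintegral_itv_obnd_cbnd _ (t - eps) (BRight t)); last first.
    apply: integrableS int_all => // s /=; rewrite !in_itv /= => /andP[cs ->].
    by rewrite (le_trans (ltW te0) (ltW cs)).
  rewrite -(@Rintegral_itvB _ _ (BLeft 0) (BRight t) (t - eps))//; first by rewrite [RHS]addrC subrK.
    by rewrite bnd_simp ltW.
  by rewrite bnd_simp ltW.
apply: le_trans (ler_normD _ _) _; rewrite mulrDl addrC; apply: lerD.
  by move: h2; rewrite subKr mulrA -natrM.
have se : 0 < Num.sqrt eps by rewrite sqrtr_gt0.
have -> : 2 * MG * Num.sqrt eps = (Num.sqrt eps)^-1 * (2 * (eps * MG)).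
  have e2 : eps = Num.sqrt eps ^+ 2 by rewrite sqr_sqrtr// ltW.
  rewrite [X in _ = _ * (2 * (X * _))]e2; move: se; generalize (Num.sqrt eps) => s0 s0_gt0.
  by field; rewrite gt_eqF.
apply: (@quasiconcave_integral_bound R 0 (t - eps) _ _ (2 * Ms)).
- exact: ltW.
- by rewrite invr_gt0.
- by rewrite mulr_ge0// mulr_ge0// ltW.
- by apply: measurable_funTS; exact: measurable_heat_section.
- exact: measurable_dev.
- move=> s /andP[s0 ste]; rewrite heat_kernel_ge0 /=.
  have ets : eps <= t - s by rewrite lerBrDl -lerBrDr.
  have ts : 0 < t - s by exact: lt_le_trans ets.
  apply: le_trans (heat_kernel_le _ _) _; rewrite powRNhalf// lef_pV2 ?posrE ?sqrtr_gt0//.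
  by rewrite ler_wsqrtr.
- by move=> s /andP[s0 _]; exact: dev_bnd.
- by move=> c; exact: heat_level_interval.
- by move=> c e c0 ce _; exact: dev_integral.
Qed.

(** The increment is split into an increment of the kernel times [dev], and the kernel times an
    increment of [dev]. Oscillation in time is not exploited, so the constant is free of eps. *)
Lemma coef_holder (T t x y z : R) : 0 < t <= T ->
  `|coef t x y - coef t x z| <=
    (8 * Ms * (T `^ ((1 - be) / 2) / (1 - be)) + 4 * L * Num.sqrt T) * `|y - z| `^ be.
Proof.
move=> /andP[t0 tT]; have /andP[be1 be2] := be_bounds.
have be0 : 0 < be by lra.
have dbe : 0 <= `|y - z| `^ be by exact: powR_ge0.
have M20 : 0 <= 2 * Ms by rewrite mulr_ge0.
have dM w s : 0 <= s <= t -> `|dev s w| <= 2 * Ms by move=> /andP[s0 _]; exact: dev_bnd.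
have [i1 _] := @heat_dominated (dev ^~ y) t 0 (x - y) (2 * Ms) M20 (lexx 0) t0
     (@measurable_dev y t) (dM y).
have [i2 _] := @heat_dominated (dev ^~ z) t 0 (x - z) (2 * Ms) M20 (lexx 0) t0
     (@measurable_dev z t) (dM z).
pose u1 s := (heat_kernel (t - s) (x - y) - heat_kernel (t - s) (x - z)) * dev s y.
pose u2 s := heat_kernel (t - s) (x - z) * (dev s y - dev s z).
have [j2 h2] := @heat_dominated (fun s => dev s y - dev s z) t 0 (x - z) (2 * L * `|y - z| `^ be)
  (mulr_ge0 (mulr_ge0 (ler0n R 2) L0) dbe) (lexx 0) t0
  (measurable_funB (@measurable_dev y t) (@measurable_dev z t))
  (fun s hs => dev_holder y z (proj1 (andP hs))).
have [j1 h1] : mu.-integrable `[0, t] (EFin \o u1) /\ `|\int[mu]_(s in `[0, t]) u1 s| <=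
    2 * `|y - z| `^ be * (2 * Ms) * ((t - 0) `^ (1 - (1 + be) / 2) / (1 - (1 + be) / 2)).
  apply: pow_dominated => //; [by rewrite !mulr_ge0|lra|lra| |].
    apply: measurable_funM; last exact: measurable_dev.
    by apply: measurable_funB; apply: measurable_funTS; exact: measurable_heat_section.
  move=> s hs; rewrite /u1 normrM mulrAC; apply: ler_pM => //; last exact: dM.
  have := @heat_kernel_holder R be (t - s) (x - y) (x - z) be0 (ltW be2).
  by rewrite (_ : x - y - (x - z) = z - y) 1?[`|z - y|]distrC//; ring.
have -> : coef t x y - coef t x z = \int[mu]_(s in `[0, t]) u1 s + \int[mu]_(s in `[0, t]) u2 s.
  rewrite /coef -RintegralB// -RintegralD//; apply: eq_Rintegral => s _; rewrite /u1 /u2; ring.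
apply: le_trans (ler_normD _ _) _; rewrite mulrDl; apply: lerD.
  apply: le_trans h1 _; rewrite subr0.
  have e1 : 1 - (1 + be) / 2 = (1 - be) / 2 by field.
  rewrite e1; have b0 : 0 < 1 - be by rewrite subr_gt0.
  have hT : t `^ ((1 - be) / 2) <= T `^ ((1 - be) / 2).
    by apply: ge0_ler_powR; rewrite ?nnegrE ?divr_ge0 ?(ltW b0) ?(ltW t0)// (le_trans (ltW t0)).
  have -> : 2 * `|y - z| `^ be * (2 * Ms) * (t `^ ((1 - be) / 2) / ((1 - be) / 2)) =
     t `^ ((1 - be) / 2) * (8 * Ms / (1 - be) * `|y - z| `^ be) by field; rewrite gt_eqF.
  have -> : 8 * Ms * (T `^ ((1 - be) / 2) / (1 - be)) * `|y - z| `^ be =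
     T `^ ((1 - be) / 2) * (8 * Ms / (1 - be) * `|y - z| `^ be) by field; rewrite gt_eqF.
  by apply: ler_wpM2r => //; rewrite mulr_ge0// divr_ge0 ?mulr_ge0// ltW.
apply: le_trans h2 _; rewrite subr0.
have -> : 2 * (2 * L * `|y - z| `^ be) * Num.sqrt t = 4 * L * `|y - z| `^ be * Num.sqrt t by ring.
have -> : 4 * L * Num.sqrt T * `|y - z| `^ be = 4 * L * `|y - z| `^ be * Num.sqrt T by ring.
by apply: ler_wpM2l; rewrite ?mulr_ge0// ler_wsqrtr.
Qed.

Lemma coef_le (T t x y : R) : 0 < t <= T -> `|coef t x y| <= 4 * Ms * Num.sqrt T.
Proof.
move=> /andP[t0 tT]; have M20 : 0 <= 2 * Ms by rewrite mulr_ge0.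
have dM s : 0 <= s <= t -> `|dev s y| <= 2 * Ms by move=> /andP[s0 _]; exact: dev_bnd.
have [_ h] := @heat_dominated (dev ^~ y) t 0 (x - y) (2 * Ms) M20 (lexx 0) t0
   (@measurable_dev y t) dM.
apply: le_trans h _; rewrite subr0 mulrA -natrM; apply: ler_wpM2l; first by rewrite mulr_ge0.
by rewrite ler_wsqrtr.
Qed.

(** A sum dominating each estimate; the factor 2 is for the difference of two values of [coef], and
    the summand 1 ensures positivity. *)
Definition coef_cst T := 1 + 2 * (4 * Ms * Num.sqrt T + (4 * Ms + 2 * MG)) +
  (8 * Ms * (T `^ ((1 - be) / 2) / (1 - be)) + 4 * L * Num.sqrt T).

Lemma coef_cst_ge T : [/\ 1 <= coef_cst T,
  2 * (4 * Ms * Num.sqrt T + (4 * Ms + 2 * MG)) <= coef_cst T &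
  8 * Ms * (T `^ ((1 - be) / 2) / (1 - be)) + 4 * L * Num.sqrt T <= coef_cst T].
Proof.
have /andP[be1 be2] := be_bounds.
have h1 : 0 <= 8 * Ms * (T `^ ((1 - be) / 2) / (1 - be)) + 4 * L * Num.sqrt T.
  have b0 : 0 <= 1 - be by rewrite subr_ge0 ltW.
  by rewrite addr_ge0// !mulr_ge0// ?sqrtr_ge0// ?powR_ge0// invr_ge0.
have h2 : 0 <= 2 * (4 * Ms * Num.sqrt T + (4 * Ms + 2 * MG)).
  by rewrite mulr_ge0// !addr_ge0 ?mulr_ge0 ?sqrtr_ge0.
by rewrite /coef_cst; split; lra.
Qed.

(** An increment a satisfies both a <= C rho and a <= C |y - z|^be; write a as a^(1 - th) a^th and
    use one bound in each factor. The cap of rho at 1 handles large eps and gives rho <= rho^(1 -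
    th). *)
Lemma coef_interpolation (T t x th : R) : 0 < t <= T -> 0 < th < 1 ->
  let bd := coef_cst T * Num.min 1 (Num.sqrt eps) `^ (1 - th) in
  (forall y, `|coef t x y| <= bd) /\
  (forall y z, `|coef t x y - coef t x z| <= bd * `|y - z| `^ (be * th)).
Proof.
move=> tT /andP[th0 th1]; have [c1 c2 c3] := coef_cst_ge T.
set C := coef_cst T; set rho := Num.min _ _ => /=.
have C0 : 0 <= C by exact: le_trans c1.
have se : 0 < Num.sqrt eps by rewrite sqrtr_gt0.
have rho0 : 0 < rho by rewrite lt_min ltr01.
have rho1 : rho <= 1 by rewrite ge_min lexx.
have cb y : 2 * `|coef t x y| <= C * rho.
  apply: le_trans (ler_wpM2r (ltW rho0) c2); rewrite -[leRHS]mulrA ler_pM2l//.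
  have a0 : 0 <= 4 * Ms * Num.sqrt T by rewrite !mulr_ge0 ?sqrtr_ge0.
  have b0 : 0 <= 4 * Ms + 2 * MG by rewrite addr_ge0 ?mulr_ge0.
  rewrite /rho; case: (leP 1 (Num.sqrt eps)) => _.
    by rewrite mulr1; apply: le_trans (coef_le x y tT) _; rewrite lerDl.
  apply: le_trans (coef_small x y (proj1 (andP tT))) _; apply: ler_wpM2r; first exact: ltW.
  by rewrite lerDr.
have rr : rho <= rho `^ (1 - th).
  by apply: ger1_powR; [rewrite rho0 rho1|lra].
split=> [y|y z].
  apply: le_trans (ler_wpM2l C0 rr); apply: le_trans (cb y).
  by rewrite ler_peMl// ler1n.
set a := `|_ - _|; have a0 : 0 <= a by exact: normr_ge0.
have aA : a <= C * rho.
  apply: le_trans (ler_normB _ _) _; have := cb y; have := cb z; lra.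
have aB : a <= C * `|y - z| `^ be.
  apply: le_trans (coef_holder _ _ _ tT) _; apply: ler_wpM2r => //; exact: powR_ge0.
have -> : a = a `^ (1 - th) * a `^ th.
  by rewrite -powRD ?subrK ?powRr1//; apply/implyP; rewrite oner_eq0.
have d0 : 0 <= `|y - z| `^ be by exact: powR_ge0.
have -> : C * rho `^ (1 - th) * `|y - z| `^ (be * th) =
    (C * rho) `^ (1 - th) * (C * `|y - z| `^ be) `^ th.
  rewrite !powRM// ?(ltW rho0)// -powRrM -[X in X * _ * _](powRr1 C0).
  have {1}-> : 1 = (1 - th) + th by rewrite subrK.
  rewrite powRD; last by apply/implyP; rewrite subrK oner_eq0.
  by rewrite mulrACA !mulrA.
apply: ler_pM; rewrite ?powR_ge0//; apply: ge0_ler_powR => //;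
  by rewrite ?nnegrE ?mulr_ge0 ?(ltW rho0)// ?subr_ge0 ltW.
Qed.

End fixed_eps.
End coefficients.

(** * The drift term *)

Lemma ae_eq0_integral d (T : measurableType d) (R : realType)
    (m : {measure set T -> \bar R}) (f : T -> \bar R) :
  measurable_fun setT f -> (forall x, 0 <= f x)%E -> (\int[m]_x f x = 0)%E ->
  {ae m, forall x, f x = 0%E}.
Proof.
move=> mf f0 h; have := proj1 (@ae_eq_integral_abs _ _ _ m _ measurableT f mf).
have -> : (\int[m]_x `|f x|)%E = (\int[m]_x f x)%E.
  by apply: eq_integral => x _; rewrite gee0_abs.
by move=> /(_ h); apply: filterS => x /(_ I).
Qed.

Section null_sections.
Context d1 d2 (T1 : measurableType d1) (T2 : measurableType d2) (R : realType).

Lemma ae_not_null d (T : measurableType d)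
    (m : {measure set T -> \bar R}) (A : set T) :
  measurable A -> m A = 0%E -> {ae m, forall x, ~ A x}.
Proof. by move=> mA A0; exists A; split=> // x /= /contrapT. Qed.

Variables (m1 : {sigma_finite_measure set T1 -> \bar R})
  (m2 : {sigma_finite_measure set T2 -> \bar R}).

(** By Tonelli the integrals of the measures of the sections agree in both orders; one of them is
    0. *)
Lemma null_xsection_ysection (A : set (T1 * T2)) : measurable A ->
  (forall x, m2 (xsection A x) = 0%E) -> {ae m2, forall y, m1 (ysection A y) = 0%E}.
Proof.
move=> mA A0; apply: (@ae_eq0_integral _ T2 R m2 (m1 \o ysection A)) => //; first exact: measurable_fun_ysection.
have := indic_fubini_tonelli m1 m2 mA.
rewrite indic_fubini_tonelli_FE// indic_fubini_tonelli_GE// => <-.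
by apply: integral0_eq => x _ /=.
Qed.

End null_sections.

(** Estimates on solutions hold almost surely for each fixed (s, y), whereas the drift at one w
    involves almost all (s, y). Two applications of Tonelli exchange w first with y, then with s. *)
Lemma ae_ae_section d1 d2 d3 (T1 : measurableType d1) (T2 : measurableType d2)
    (T3 : measurableType d3) (R : realType)
    (m1 : {sigma_finite_measure set T1 -> \bar R})
    (m2 : {sigma_finite_measure set T2 -> \bar R})
    (m3 : {sigma_finite_measure set T3 -> \bar R}) (A : set (T1 * T3 * T2)) :
  measurable A -> (forall s y, m3 [set w | A (s, w, y)] = 0%E) ->
  {ae m3, forall w, {ae m1, forall s, {ae m2, forall y, ~ A (s, w, y)}}}.
Proof.
move=> mA A0; pose phi := m2 \o xsection A.
have mphi : measurable_fun setT phi by exact: measurable_fun_xsection.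
pose B := [set z | phi z != 0%E].
have mB : measurable B.
  rewrite (_ : B = setT `&` phi @^-1` [set~ 0%E]).
    by apply: mphi => //; exact: measurableC.
  by rewrite setTI; apply/seteqP; split => z /= /eqP.
have B0 s : m3 (xsection B s) = 0%E.
  apply: measure_negligible; first exact: measurable_xsection.
  pose As := [set z : T2 * T3 | A (s, z.2, z.1)].
  have mAs : measurable As.
    have mg : measurable_fun setT (fun z : T2 * T3 => (s, z.2, z.1)).
      by apply: measurable_fun_pair => //; exact: measurable_fun_pair.
    by rewrite -[As]setTI; exact: mg.
  have h y : m3 (xsection As y) = 0%E.
    rewrite -[RHS](A0 s y); congr (m3 _); apply/seteqP.
    by split => w; rewrite /xsection /= inE.
  apply: negligibleS (null_xsection_ysection m2 mAs h) => w.
  rewrite /xsection /= inE /B /= => /eqP hw hn; apply: hw; rewrite -[RHS]hn.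
  by congr (m2 _); apply/seteqP; split => y; rewrite /xsection /ysection /= !inE.
have := null_xsection_ysection m1 mB B0; apply: filterS => w hw.
have mBw : measurable (ysection B w) by exact: measurable_ysection.
have := ae_not_null mBw hw; apply: filterS => s.
rewrite /ysection /= inE => /negP; rewrite negbK => /eqP hs.
have mAsw : measurable (xsection A (s, w)) by exact: measurable_xsection.
by have := ae_not_null mAsw hs; apply: filterS => y; rewrite /xsection /= inE.
Qed.

Section drift.
Variable R : realType.
Local Notation mu := (@lebesgue_measure R).

#[local] Instance lebesgue_ae_filter : Filter (almost_everywhere mu).
Proof. exact: ae_filter_ringOfSetsType. Qed.

Lemma integrable_heat_kernel (t x : R) : 0 < t ->
  mu.-integrable setT (fun y : R => (heat_kernel t (x - y))%:E) /\
  \int[mu]_(y in setT) heat_kernel t (x - y) = 1.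
Proof.
move=> t0; have E : (fun y => (heat_kernel t (x - y))%:E) = (fun y => (normal_pdf x (Num.sqrt (2 * t)) y)%:E).
  by apply/funext => y; rewrite heat_kernel_normal.
have i1 : (\int[mu]_y (heat_kernel t (x - y))%:E)%E = 1%E.
  by rewrite E; exact: integral_normal_pdf.
split; last by rewrite /Rintegral i1.
rewrite E; exact: integrable_normal_pdf.
Qed.

Lemma heat_average_le (t x M : R) (a : R -> R) : 0 < t -> 0 <= M -> measurable_fun setT a ->
  {ae mu, forall y, `|a y| <= M} ->
  mu.-integrable setT (fun y : R => (heat_kernel t (x - y) * a y)%:E) /\
  `|\int[mu]_(y in setT) (heat_kernel t (x - y) * a y)| <= M.
Proof.
move=> t0 M0 ma aM; have [ip p1] := integrable_heat_kernel x t0.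
have mp : measurable_fun setT (fun y : R => heat_kernel t (x - y)).
  by apply/measurable_EFinP; exact: measurable_int ip.
have mpa : measurable_fun setT (fun y : R => heat_kernel t (x - y) * a y) by exact: measurable_funM.
have ipM : mu.-integrable setT (fun y : R => (heat_kernel t (x - y) * M)%:E).
  rewrite (_ : (fun y => _) = (fun y => M%:E * (heat_kernel t (x - y))%:E)%E).
    exact: integrableZl.
  by apply/funext => y; rewrite -EFinM mulrC.
have le : (\int[mu]_y `|(heat_kernel t (x - y) * a y)%:E| <= \int[mu]_y (heat_kernel t (x - y) * M)%:E)%E.
  apply: ae_ge0_le_integral => //.
  - by apply: measurableT_comp => //; exact/measurable_EFinP.
  - by move=> y _; rewrite lee_fin mulr_ge0 ?heat_kernel_ge0.
  - exact: measurable_int ipM.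
  - move: aM; apply: filterS => y ay _; rewrite lee_fin normrM ger0_norm ?heat_kernel_ge0//.
    by apply: ler_wpM2l => //; exact: heat_kernel_ge0.
have pM : \int[mu]_(y in setT) (heat_kernel t (x - y) * M) = M.
  by rewrite RintegralZr// p1 mul1r.
have ipa : mu.-integrable setT (fun y : R => (heat_kernel t (x - y) * a y)%:E).
  apply/integrableP; split; first exact/measurable_EFinP.
  apply: le_lt_trans le _; rewrite -ge0_fin_numE; first exact: integrable_fin_num.
  by apply: integral_ge0 => y _; rewrite lee_fin mulr_ge0 ?heat_kernel_ge0.
split=> //; apply: le_trans (le_normr_Rintegral _ ipa) _ => //.
rewrite -[leRHS]pM; apply: fine_le => //; last first.
  exact: integrable_fin_num.
apply: integrable_fin_num => //; exact: (integrable_norm ipa).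
Qed.

Lemma measurable_heat_average (t x : R) (a : R * R -> R) : measurable_fun setT a ->
  measurable_fun setT (fun s : R => \int[mu]_(y in setT) (heat_kernel (t - s) (x - y) * a (s, y))).
Proof.
move=> ma; pose H (z : R * R) := (heat_kernel (t - z.1) (x - z.2) * a z)%:E.
have mH : measurable_fun setT H.
  apply/measurable_EFinP; apply: measurable_funM => //.
  have mg : measurable_fun setT (fun z : R * R => (t - z.1, x - z.2)).
    by apply: measurable_fun_pair; apply: measurable_funB => //.
  exact: (measurableT_comp (@measurable_heat_kernel R) mg).
apply: (measurableT_comp (f := fine)); first exact: fine_measurable.
rewrite (_ : (fun s => _) = (fun s => fubini_F mu H^\+ s - fubini_F mu H^\- s)%E); last first.
  by apply/funext => s; rewrite integralE; congr (_ - _)%E; rewrite /fubini_F; apply: eq_integral => y _; rewrite ?funeposE ?funenegE.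
apply: emeasurable_funB; apply: measurable_fun_fubini_tonelli_F => //.
- exact: measurable_funepos.
- exact: measurable_funeneg.
Qed.

Lemma integral_expR_le (lam t : R) : 0 < lam -> 0 <= t ->
  (\int[mu]_(s in `[0%R, t]) (expR (lam * s))%:E <= (lam^-1 * expR (lam * t))%:E)%E.
Proof.
move=> l0; rewrite le_eqVlt => /orP[/eqP <-|t0].
  by rewrite set_itv1 integral_set1 lee_fin mulr_ge0 ?expR_ge0// invr_ge0 ltW.
pose E s := expR (lam * s).
have h1 (s : R) : is_derive s 1 (fun s : R => lam * s) lam by apply: is_derive_eq; rewrite scaler1.
have h2 (s : R) : is_derive s 1 E (lam * expR (lam * s)).
  have h := @is_derive1_comp R expR (fun s => lam * s) s _ _ (is_derive_expR _) (h1 s).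
  by apply: is_derive_eq; rewrite mulrC.
have h3 (s : R) : is_derive s 1 (fun s => lam^-1 * E s) (E s).
  have h := h2 s; apply: is_derive_eq.
  by rewrite -[LHS]/(lam^-1 * (lam * E s)) mulrA mulVf ?mul1r// gt_eqF.
rewrite (@FTC_derive R E (fun s => lam^-1 * E s) 0 t)//.
by rewrite lee_fin lerBlDr lerDl mulr_ge0 ?expR_ge0// invr_ge0 ltW.
Qed.

(** The exponential weight makes the Gronwall argument close on the whole of [0, T] at once:
    integrating it in time gains the factor 1 / lam. *)
Lemma drift_bound (a1 a2 : R * R -> R) (M c lam t x : R) :
  measurable_fun setT a1 -> measurable_fun setT a2 ->
  (forall z, `|a1 z| <= M) -> (forall z, `|a2 z| <= M) ->
  0 < lam -> 0 < t -> 0 <= c ->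
  {ae mu, forall s, 0 <= s <= t -> {ae mu, forall y, `|a1 (s, y) - a2 (s, y)| <= c * expR (lam * s)}} ->
  `|\int[mu]_(s in `[0, t]) (\int[mu]_(y in setT) (heat_kernel (t - s) (x - y) * a1 (s, y))) -
    \int[mu]_(s in `[0, t]) (\int[mu]_(y in setT) (heat_kernel (t - s) (x - y) * a2 (s, y)))|
  <= c * (lam^-1 * expR (lam * t)).
Proof.
move=> m1 m2 b1 b2 l0 t0 c0 h.
have M0 : 0 <= M by apply: le_trans (b1 (0, 0)).
pose k (a : R * R -> R) s := \int[mu]_(y in setT) (heat_kernel (t - s) (x - y) * a (s, y)).
have sec (a : R * R -> R) s : measurable_fun setT a -> measurable_fun setT (fun y => a (s, y)).
  by move=> ma; apply: (measurableT_comp ma); exact: measurable_pair1.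
(* The kernel has mass 1 for s < t only; at s = t it is identically 0, and the bounds below hold
   there as well. *)
have kt (a : R * R -> R) : k a t = 0.
  rewrite /k (_ : (fun y => _) = cst 0); first by rewrite /Rintegral integral0.
  by apply/funext => y; rewrite subrr heat_kernel_le0// mul0r.
have kM (a : R * R -> R) s : measurable_fun setT a -> (forall z, `|a z| <= M) ->
    0 <= s <= t -> `|k a s| <= M.
  move=> ma ba /andP[s0]; rewrite le_eqVlt => /orP[/eqP ->|st]; first by rewrite kt normr0.
  apply: (proj2 (@heat_average_le (t - s) x M (fun y => a (s, y)) _ M0 (sec _ _ ma) _)).
    by rewrite subr_gt0.
  exact: nearW.
have mk (a : R * R -> R) : measurable_fun setT a -> measurable_fun setT (k a).
  exact: measurable_heat_average.
have ik (a : R * R -> R) : measurable_fun setT a -> (forall z, `|a z| <= M) ->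
    mu.-integrable `[0, t] (EFin \o k a).
  move=> ma ba; apply: (@bounded_integrable _ _ _ M); last by move=> s; exact: kM.
  by apply: measurable_funTS; exact: mk.
have i12 : mu.-integrable `[0, t] (EFin \o (k a1 \- k a2)).
  apply: (@bounded_integrable _ _ _ (M + M)).
    by apply: measurable_funTS; apply: measurable_funB; exact: mk.
  by move=> s hs; apply: le_trans (ler_normB _ _) _; apply: lerD; exact: kM.
rewrite -RintegralB//; [|exact: ik..].
apply: le_trans (le_normr_Rintegral _ i12) _ => //.
have le : (\int[mu]_(s in `[0%R, t]) `|(k a1 s - k a2 s)%:E| <= \int[mu]_(s in `[0%R, t]) (c%:E * (expR (lam * s))%:E))%E.
  have mE : measurable_fun setT (fun s : R => expR (lam * s)).
    by apply: measurableT_comp => //; exact: measurable_funM.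
  apply: ae_ge0_le_integral => //.
  - apply: measurableT_comp => //; apply/measurable_EFinP.
    by apply: measurable_funTS; apply: measurable_funB; exact: mk.
  - by move=> s _; rewrite -EFinM lee_fin mulr_ge0 ?expR_ge0.
  - apply/measurable_EFinP; apply: measurable_funTS.
    by apply: measurable_funM.
  move: h; apply: filterS => s hs; rewrite /= in_itv /= => s0t.
  rewrite -EFinM lee_fin; have cE : 0 <= c * expR (lam * s) by rewrite mulr_ge0 ?expR_ge0.
  case/andP: (s0t) => s0; rewrite le_eqVlt => /orP[/eqP st|st].
    by rewrite st !kt subr0 normr0 -st.
  have ts : 0 < t - s by rewrite subr_gt0.
  rewrite /k -RintegralB//.
  - have := proj2 (@heat_average_le (t - s) x _ (fun y => a1 (s, y) - a2 (s, y)) ts cE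
      (measurable_funB (sec _ _ m1) (sec _ _ m2)) (hs s0t)).
    apply: le_trans; rewrite le_eqVlt; apply/orP; left; apply/eqP; congr (`|_|).
    by apply: eq_Rintegral => y _; rewrite mulrBr.
  - apply: (proj1 (@heat_average_le (t - s) x M (fun y => a1 (s, y)) ts M0 (sec _ _ m1) _)).
    exact: nearW.
  - apply: (proj1 (@heat_average_le (t - s) x M (fun y => a2 (s, y)) ts M0 (sec _ _ m2) _)).
    exact: nearW.
rewrite -lee_fin fineK; last exact: (integrable_fin_num _ (integrable_norm i12)).
apply: le_trans le _; rewrite ge0_integralZl//.
- by rewrite EFinM; apply: lee_wpmul2l; [rewrite lee_fin|exact: (integral_expR_le l0 (ltW t0))].
- apply/measurable_EFinP; apply: measurable_funTS.
  by apply: measurableT_comp => //; exact: measurable_funM.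
Qed.

End drift.

(** * Gronwall's lemma *)

Section gronwall.
Context d (Omega : measurableType d) (R : realType) (P : probability Omega R).
Local Notation mu := (@lebesgue_measure R).
Local Notation uncurried u := (fun z : R * R * Omega => u z.1.1 z.1.2 z.2).
Variables (T : R) (f : R -> R -> R) (M L : R) (u v : R -> R -> Omega -> R) (b : Omega -> R).
Hypothesis f_meas : measurable_fun setT (fun z : R * R => f z.1 z.2).
Hypothesis f_bnd : forall y z, `|f y z| <= M.
Hypothesis f_lip : forall y z1 z2, `|f y z1 - f y z2| <= L * `|z1 - z2|.
Hypothesis u_meas : measurable_fun (`[0, T] `*` setT `*` setT) (uncurried u).
Hypothesis v_meas : measurable_fun (`[0, T] `*` setT `*` setT) (uncurried v).
Hypothesis uv0 : forall x, {ae P, forall w, u 0 x w = v 0 x w}.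
Hypothesis b_meas : measurable_fun setT b.
Hypothesis b_ge0 : forall w, 0 <= b w.

Let drift (u : R -> R -> Omega -> R) (t x : R) (w : Omega) :=
  \int[mu]_(s in `[0, t])
     (\int[mu]_(y in setT) (heat_kernel (t - s) (x - y) * f y (u s y w))).

Hypothesis uv_drift : forall t x, 0 < t <= T ->
  {ae P, forall w, `|(u t x w - v t x w) - (drift u t x w - drift v t x w)| <= b w}.

Let D := `[0, T] `*` [set: R] `*` [set: Omega].
Let mD : measurable D. Proof. by apply: measurableX => //; exact: measurableX. Qed.
(** Extension by 0 outside [0, T], so that measurability and its sections are available on the whole
    space. *)
Let total (u : R -> R -> Omega -> R) : R * R * Omega -> R := uncurried u \_ D.
(** Chosen for lam >= 1, which absorbs the starting constant, and L / lam <= 1/2, which makes the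
    iteration contract by one half. *)
Let lam := 2 * L + 1.

Let L0 : 0 <= L.
Proof. by have := f_lip 0 1 0; rewrite subr0 normr1 mulr1; exact: le_trans. Qed.
Let M0 : 0 <= M. Proof. exact: le_trans (f_bnd 0 0). Qed.
Let lam0 : 0 < lam. Proof. by rewrite ltr_wpDl// mulr_ge0. Qed.

Let measurable_total (u' : R -> R -> Omega -> R) :
  measurable_fun D (uncurried u') -> measurable_fun setT (total u').
Proof. by move=> mu'; exact/(measurable_restrictT _ mD). Qed.

Let totalE (u' : R -> R -> Omega -> R) s y w : 0 <= s <= T -> total u' (s, y, w) = u' s y w.
Proof. by move=> sT; rewrite /total /patch mem_set// /D /= in_itv. Qed.

Let driftE (u' : R -> R -> Omega -> R) t x w : t <= T -> drift u' t x w =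
  \int[mu]_(s in `[0, t])
     (\int[mu]_(y in setT) (heat_kernel (t - s) (x - y) * f y (total u' (s, y, w)))).
Proof.
move=> tT; apply: eq_Rintegral => s; rewrite inE /= in_itv /= => /andP[s0 st].
by apply: eq_Rintegral => y _; rewrite totalE// s0 (le_trans st).
Qed.

Lemma drift_step (t x c : R) (w : Omega) : 0 < t <= T -> 0 <= c ->
  `|(u t x w - v t x w) - (drift u t x w - drift v t x w)| <= b w ->
  {ae mu, forall s, 0 <= s <= t ->
    {ae mu, forall y, `|f y (total u (s, y, w)) - f y (total v (s, y, w))| <= c * expR (lam * s)}} ->
  `|u t x w - v t x w| <= (b w + c * lam^-1) * expR (lam * t).
Proof.
move=> /andP[t0 tT] c0 hb h.
have mf (u' : R -> R -> Omega -> R) : measurable_fun D (uncurried u') ->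
    measurable_fun setT (fun z : R * R => f z.2 (total u' (z, w))).
  move=> mu'; have m1 : measurable_fun setT (fun z : R * R => total u' (z, w)).
    by apply: (measurableT_comp (measurable_total mu')); exact: measurable_pair2.
  have m2 : measurable_fun setT (fun z : R * R => (z.2, total u' (z, w))).
    exact: measurable_fun_pair.
  exact: (measurableT_comp f_meas m2).
have bnd (u' : R -> R -> Omega -> R) (z : R * R) : `|f z.2 (total u' (z, w))| <= M by [].
have := @drift_bound R (fun z => f z.2 (total u (z, w))) (fun z => f z.2 (total v (z, w)))
  M c lam t x (mf _ u_meas) (mf _ v_meas) (bnd u) (bnd v) lam0 t0 c0 h.
rewrite -driftE// -driftE// => hd.
have -> : u t x w - v t x w = ((u t x w - v t x w) - (drift u t x w - drift v t x w)) +
  (drift u t x w - drift v t x w) by ring.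
apply: le_trans (ler_normD _ _) _; rewrite mulrDl; apply: lerD.
  apply: le_trans hb _; apply: ler_peMr => //.
  by rewrite -expR0 ler_expR mulr_ge0// ltW.
by rewrite -mulrA.
Qed.

Let dominated (c : Omega -> R) := forall t x, 0 <= t <= T ->
  {ae P, forall w, `|u t x w - v t x w| <= c w * expR (lam * t)}.

(** Boundedness of [f] starts the iteration with a finite bound, although nothing is known yet about
    the size of the solutions. *)
Lemma dominated_start : dominated (fun w => b w + 2 * M).
Proof.
move=> t x /andP[]; rewrite le_eqVlt => /orP[/eqP <- _|t0 tT].
  move: (uv0 x); apply: filterS => w ->.
  by rewrite subrr normr0 mulr_ge0 ?expR_ge0// addr_ge0// mulr_ge0.
have tT' : 0 < t <= T by rewrite t0.
move: (uv_drift x tT'); apply: filterS => w hw.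
have M20 : 0 <= 2 * M by rewrite mulr_ge0.
apply: le_trans (drift_step tT' M20 hw _) _.
  apply: nearW => s /andP[s0 _]; apply: nearW => y.
  apply: (@le_trans _ _ (2 * M)).
    by rewrite mulr_natl mulr2n; apply: le_trans (ler_normB _ _) _; exact: lerD.
  apply: ler_peMr => //; by rewrite -expR0 ler_expR mulr_ge0// ltW.
apply: ler_wpM2r; first exact: expR_ge0.
rewrite lerD2l; apply: ler_piMr => //.
by rewrite invf_le1// /lam lerDr mulr_ge0.
Qed.

(** The previous bound holds almost surely at each (s, y); [ae_ae_section] gives it for almost every
    w at almost all (s, y). The Lipschitz constant then enters through L / lam <= 1/2. *)
Lemma dominated_step (c : Omega -> R) : measurable_fun setT c -> (forall w, 0 <= c w) ->
  dominated c -> dominated (fun w => b w + c w / 2).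
Proof.
move=> mc c0 hc t x /andP[]; rewrite le_eqVlt => /orP[/eqP <- _|t0 tT].
  move: (uv0 x); apply: filterS => w ->.
  by rewrite subrr normr0 mulr_ge0 ?expR_ge0// addr_ge0// divr_ge0.
have tT' : 0 < t <= T by rewrite t0.
pose bad := [set z : R * Omega * R | c z.1.2 * expR (lam * z.1.1) <
  `|total u (z.1.1, z.2, z.1.2) - total v (z.1.1, z.2, z.1.2)|].
have mbad : measurable bad.
  rewrite (_ : bad = [set z | c z.1.2 * expR (lam * z.1.1) -
      `|total u (z.1.1, z.2, z.1.2) - total v (z.1.1, z.2, z.1.2)| < 0]).
    have m11 : measurable_fun setT (fun z : R * Omega * R => z.1.1).
      by apply: (measurableT_comp measurable_fst); exact: measurable_fst.
    have m12 : measurable_fun setT (fun z : R * Omega * R => z.1.2).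
      by apply: (measurableT_comp measurable_snd); exact: measurable_fst.
    have mg : measurable_fun setT (fun z : R * Omega * R => (z.1.1, z.2, z.1.2)).
      by apply: measurable_fun_pair => //; exact: measurable_fun_pair.
    apply: measurable_lt; apply: measurable_funB.
      apply: measurable_funM; first exact: (measurableT_comp mc m12).
      by apply: measurableT_comp => //; exact: measurable_funM.
    apply: measurableT_comp => //; apply: measurable_funB.
      exact: (measurableT_comp (measurable_total u_meas) mg).
    exact: (measurableT_comp (measurable_total v_meas) mg).
  by apply/seteqP; split => z /=; rewrite subr_lt0.
have bad0 s y : P [set w | bad (s, w, y)] = 0%E.
  have [sT|sT] := boolP (0 <= s <= T).
    apply: measure_negligible.
      have mg : measurable_fun setT (fun w : Omega => (s, w, y)) by exact: measurable_fun_pair.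
      by rewrite -[[set w | _]]setTI; exact: mg.
    apply: negligibleS (hc s y sT) => w; rewrite /bad /= !totalE// => h1 h2.
    by move: h1; rewrite ltNge h2.
  rewrite (_ : [set w | _] = set0) ?measure0//; apply/seteqP; split => // w.
  have nD : ~ D (s, y, w) by rewrite /D /= in_itv /= => -[[]] h; move: sT; rewrite h.
  rewrite /bad /= /total /patch memNset// subrr normr0.
  by rewrite ltNge mulr_ge0 ?expR_ge0.
have := ae_ae_section mu mu mbad bad0.
move: (uv_drift x tT'); apply: filterS2 => w hw hn.
have cL0 : 0 <= c w * L by rewrite mulr_ge0.
apply: le_trans (drift_step tT' cL0 hw _) _.
  move: hn; apply: filterS => s hs _; move: hs; apply: filterS => y /negP; rewrite -leNgt => h.
  apply: le_trans (f_lip _ _ _) _.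
  by rewrite mulrAC [leRHS]mulrC; apply: ler_wpM2l.
apply: ler_wpM2r; first exact: expR_ge0.
rewrite lerD2l -mulrA; apply: ler_wpM2l => //.
rewrite ler_pdivrMr// /lam; lra.
Qed.

(** The map c -> b + c / 2 has the fixed point 2 b. Iterating it from 2 b + 2 M, which is above the
    starting bound, gives 2 b + 2 M / 2^n. *)
Lemma gronwall (t x : R) : 0 <= t <= T ->
  {ae P, forall w, `|u t x w - v t x w| <= 2 * b w * expR ((2 * L + 1) * T)}.
Proof.
move=> tT; pose c n w := 2 * b w + 2 * M / 2 ^+ n.
have c0 n w : 0 <= c n w by rewrite addr_ge0 ?mulr_ge0// invr_ge0 exprn_ge0.
have mc n : measurable_fun setT (c n).
  by apply: measurable_funD => //; exact: measurable_funM.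
have H n : dominated (c n).
  elim: n => [|n IH] s y sT.
    move: (dominated_start y sT); apply: filterS => w h; apply: le_trans h _.
    apply: ler_wpM2r; first exact: expR_ge0.
    by rewrite /c expr0 divr1 lerD2r mulr_natl mulr2n lerDl.
  move: (dominated_step (mc n) (c0 n) IH y sT); apply: filterS => w h; apply: le_trans h _.
  apply: ler_wpM2r; first exact: expR_ge0.
  rewrite le_eqVlt; apply/orP; left; apply/eqP; rewrite /c exprSr.
  have : (2 : R) ^+ n != 0 by rewrite expf_neq0.
  by generalize ((2 : R) ^+ n) => q q0; field.
have : {ae P, forall w, forall n, `|u t x w - v t x w| <= c n w * expR (lam * t)}.
  by apply/ae_foralln => n; exact: H.
apply: filterS => w h; apply: (@le_trans _ _ (2 * b w * expR (lam * t))).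
  have eE : 0 < expR (lam * t) by exact: expR_gt0.
  rewrite -ler_pdivrMr//; apply/ler_addgt0Pr => e e0.
  have [n hn] : exists n : nat, 2 * M / e < n%:R.
    by exists (Num.trunc (2 * M / e)).+1; exact: truncnS_gt.
  have := h n; rewrite -ler_pdivrMr// => h'; apply: le_trans h' _.
  rewrite /c lerD2l ler_pdivrMr ?exprn_gt0// -ler_pdivrMl// mulrC.
  apply: le_trans (ltW hn) _; rewrite -natrX ler_nat; apply: ltnW; exact: ltn_expl.
apply: ler_wpM2l; first by rewrite mulr_ge0.
by rewrite ler_expR ler_wpM2l ?(ltW lam0)//; case/andP: tT.
Qed.

End gronwall.

(** * Rate of convergence and choice of versions *)

Lemma rv_of_measurable d (Omega : measurableType d) (R : realType) (P : probability Omega R)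
    (X : Omega -> R) : measurable_fun setT X -> exists Y : {RV P >-> R}, Y = X :> (Omega -> R).
Proof.
move=> mX; pose m := isMeasurableFun.Build _ _ _ _ X mX.
by pose Y : {RV P >-> R} := HB.pack X m; exists Y.
Qed.

(** For eps >= 1 the capped factor is 1 and eps^(-g) <= 1; for eps <= 1 the product is eps^(c / 2 -
    g) with a nonnegative exponent. *)
Lemma rate_le (R : realType) (eps g c : R) : 0 < eps -> 0 <= g -> 2 * g <= c ->
  eps `^ (- g) * Num.min 1 (Num.sqrt eps) `^ c <= 1.
Proof.
move=> e0 g0 gc; case: (leP 1 (Num.sqrt eps)) => h.
  rewrite powR1 mulr1 powRN invf_le1 ?powR_gt0//.
  have e1 : 1 <= eps.
    rewrite leNgt; apply/negP => e1; move: h; rewrite leNgt => /negP; apply.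
    by rewrite -sqrtr1 ltr_sqrt.
  by have := ler_powR e1 g0; rewrite powRr0.
have e1 : eps <= 1.
  by rewrite leNgt; apply/negP => e1; move: h; rewrite -sqrtr1 ltr_sqrt// ltNge (ltW e1).
rewrite -powR12_sqrt ?(ltW e0)// -powRrM -powRD; last by apply/implyP => _; rewrite gt_eqF.
have e01 : 0 < eps <= 1 by rewrite e0.
have ex : 0 <= - g + 2^-1 * c by move: gc; lra.
by have := ger_powR e01 ex; rewrite powRr0.
Qed.

(** Countably many interpolation parameters, decreasing to a, reach every exponent below the
    critical one. This lets one choice of versions serve all [gamma1]. *)
Lemma geometric_exponent (R : realType) (a g : R) : a < 1 -> g < 1 / 2 * (1 - a) ->
  exists n : nat, 2 * g <= 1 - (a + (1 - a) / n.+2%:R).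
Proof.
move=> a1 ga; have d0 : 0 < (1 - a) - 2 * g by move: a1 ga; lra.
exists (Num.trunc ((1 - a) / ((1 - a) - 2 * g))).
set n := Num.trunc _; have hn : (1 - a) / ((1 - a) - 2 * g) < n.+1%:R by exact: truncnS_gt.
have n0 : 0 < n.+2%:R :> R by rewrite ltr0n.
have hn2 : n.+1%:R <= n.+2%:R :> R by rewrite ler_nat.
suff : (1 - a) / n.+2%:R <= (1 - a) - 2 * g by generalize ((1 - a) / n.+2%:R) => q; lra.
rewrite ler_pdivrMr// mulrC -ler_pdivrMr//; exact: le_trans (ltW hn) hn2.
Qed.

Section averaging.
Context d (Omega : measurableType d) (R : realType) (P : probability Omega R).
Variables (T : R) (mu : set R -> {RV P >-> R}) (u0 : R -> Omega -> R) (f : R -> R -> R).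
Variables (sigma : R -> R -> R) (be tau : R) (sigma_bar : R -> R).
Variables (u : R -> R -> R -> Omega -> R) (u_bar : R -> R -> Omega -> R).
Hypothesis mu_sm : stochastic_measure mu.
Hypothesis f_meas : measurable_fun setT (fun z : R * R => f z.1 z.2).
Hypothesis f_bnd : exists M : R, forall y z : R, `|f y z| <= M.
Hypothesis f_lip : exists L : R, forall y1 y2 z1 z2,
  `|f y1 z1 - f y2 z2| <= L * (`|y1 - y2| + `|z1 - z2|).
Hypothesis sigma_meas : measurable_fun [set z : R * R | 0 <= z.1]
  (fun z : R * R => sigma z.1 z.2).
Hypothesis sigma_bnd : exists M : R, forall s y : R, 0 <= s -> `|sigma s y| <= M.
Hypothesis be_bounds : 1 / 2 < be < 1.
Hypothesis sigma_holder : exists L : R, forall s y1 y2 : R, 0 <= s ->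
  `|sigma s y1 - sigma s y2| <= L * `|y1 - y2| `^ be.
Hypothesis tau_ge1 : 1 <= tau.
Hypothesis tau_int : mu_integrable mu (fun y => `|y| `^ tau).
Hypothesis G_bnd : exists M : R, forall r y : R, 0 <= r ->
  `| \int[lebesgue_measure]_(s in `[0, r]) (sigma s y - sigma_bar y) | <= M.
Hypothesis u_sol : forall eps : R, 0 < eps ->
  is_solution mu T u0 f (fun s y => sigma (s / eps) y) (u eps).
Hypothesis u_bar_sol : is_solution mu T u0 f (fun _ y => sigma_bar y) u_bar.

Lemma averaging_rate (th : R) : 1 / (2 * be) < th < 1 ->
  exists K : Omega -> R, [/\ measurable_fun setT K, forall w, 0 <= K w &
    forall eps t x : R, 0 < eps -> 0 <= t <= T -> {ae P, forall w,
      `|u eps t x w - u_bar t x w| <= K w * Num.min 1 (Num.sqrt eps) `^ (1 - th)}].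
Proof.
move=> /andP[th0 th1]; have /andP[be1 be2] := be_bounds.
have be0 : 0 < be by lra.
have al : 1 / 2 < be * th.
  by move: th0; rewrite ltr_pdivrMr ?mulr_gt0//; lra.
have th01 : 0 < th < 1 by rewrite th1 andbT (le_lt_trans _ th0)// divr_ge0// mulr_ge0// ltW.
have [K [mK K0] hK] := mu_integral_bound mu_sm tau_ge1 tau_int al.
have [M fM] := f_bnd; have [L fL] := f_lip; have [Ms sM] := sigma_bnd.
have [Ls sL] := sigma_holder; have [MG GM] := G_bnd.
have fL' y z1 z2 : `|f y z1 - f y z2| <= L * `|z1 - z2|.
  by have := fL y y z1 z2; rewrite subrr normr0 add0r.
have [C1 _ _] := coef_cst_ge sM be_bounds sL GM T.
set C := coef_cst _ _ _ _ _ in C1; have C0 : 0 <= C by exact: le_trans C1.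
exists (fun w => 2 * C * expR ((2 * L + 1) * T) * K w); split.
- exact: measurable_funM.
- by move=> w; rewrite !mulr_ge0 ?expR_ge0.
move=> eps t x e0 tT; pose bd := C * Num.min 1 (Num.sqrt eps) `^ (1 - th).
have bd0 : 0 <= bd by rewrite mulr_ge0 ?powR_ge0.
have [mu_eps i0 h] := u_sol e0; have [mu_bar j0 k] := u_bar_sol.
have b0 w : 0 <= bd * K w by rewrite mulr_ge0.
have mb : measurable_fun setT (fun w => bd * K w) by exact: measurable_funM.
have uv0 y : {ae P, forall w, u eps 0 y w = u_bar 0 y w}.
  by move: (i0 y) (j0 y); apply: filterS2 => w -> ->.
have H := gronwall f_meas fM fL' mu_eps mu_bar uv0 mb b0 _ x tT.
(* In the second goal the initial terms of the two equations are the same, so what remains once the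
   drifts are subtracted is the difference of the noise integrals. *)
apply: filterS (H _) => [w hw|s y sT].
  apply: le_trans hw _; rewrite /bd le_eqVlt; apply/orP; left; apply/eqP.
  by generalize (expR ((2 * L + 1) * T)) => E; ring.
have [xi1 I1 E1] := h s y sT; have [xi2 I2 E2] := k s y sT.
have s0 : 0 < s by case/andP: sT.
have [q1 q2] := coef_interpolation sigma_meas sM be_bounds sL GM e0 y sT th01.
have qE z := coefE sigma_meas sM GM e0 y z s0.
have : {ae P, forall w, `|xi1 w - xi2 w| <= bd * K w}.
  apply: (hK _ _ xi1 xi2 bd I1 I2 bd0) => [z|z1 z2]; rewrite !qE; first exact: q1.
  exact: q2.
move: E1 E2; apply: filterS3 => w -> ->; apply: le_trans.
by rewrite le_eqVlt; apply/orP; left; apply/eqP; congr (`|_|); ring.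
Qed.

Lemma measurable_solution sg v (t x : R) : is_solution mu T u0 f sg v -> 0 <= t <= T ->
  measurable_fun setT (v t x).
Proof.
move=> [mv _ _] tT.
have mD : measurable (`[0, T] `*` [set: R] `*` [set: Omega]).
  by apply: measurableX => //; exact: measurableX.
have sD : [set (t, x, w) | w in [set: Omega]] `<=` `[0, T] `*` setT `*` setT.
  by move=> _ [w _ <-] /=; rewrite in_itv.
have mg : measurable_fun setT (fun w : Omega => (t, x, w)) by exact: measurable_fun_pair.
exact: (measurable_comp mD sD mv mg).
Qed.

(** The redefinition is made for each (eps, t, x) separately, so the uncountably many null sets
    never have to be united, and the bounds then hold for every w. Countability in n makes the event
    [G] measurable and of full probability. *)
Lemma averaging_versions (rate : nat -> R -> R) (K : nat -> Omega -> R) :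
  (forall n, measurable_fun setT (K n)) -> (forall n w, 0 <= K n w) ->
  (forall n eps, 0 <= rate n eps) ->
  (forall n (eps t x : R), 0 < eps -> 0 <= t <= T ->
    {ae P, forall w, `|u eps t x w - u_bar t x w| <= K n w * rate n eps}) ->
  forall eps t x, 0 < eps -> 0 <= t <= T -> exists Y : {RV P >-> R},
    {ae P, forall w, Y w = u eps t x w} /\
    forall n w, `|Y w - u_bar t x w| <= K n w * rate n eps.
Proof.
move=> mK K0 r0 hK eps t x e0 tT; have mu_eps := measurable_solution x (u_sol e0) tT.
have mu_bar := measurable_solution x u_bar_sol tT.
pose G := [set w | forall n, `|u eps t x w - u_bar t x w| <= K n w * rate n eps].
have mG : measurable G.
  rewrite (_ : G = \bigcap_n [set w | 0 <= K n w * rate n eps - `|u eps t x w - u_bar t x w|]).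
    apply: bigcapT_measurable => n; apply: measurable_ge; apply: measurable_funB.
      exact: measurable_funM.
    by apply: measurableT_comp => //; exact: measurable_funB.
  by apply/seteqP; split => w h n; [move=> _|]; have := h n; rewrite /= subr_ge0//; exact.
pose X w := u_bar t x w + \1_G w * (u eps t x w - u_bar t x w).
have mX : measurable_fun setT X.
  apply: measurable_funD => //; apply: measurable_funM; last exact: measurable_funB.
  exact: measurable_indic.
have [Y YX] := rv_of_measurable P mX; exists Y; rewrite YX /X; split.
  have : {ae P, forall w, forall n, `|u eps t x w - u_bar t x w| <= K n w * rate n eps}.
    by apply/ae_foralln => n; exact: hK.
  by apply: filterS => w h; rewrite indicE mem_set// mul1r addrC subrK.
move=> n w; rewrite addrAC subrr add0r indicE; case: (boolP (w \in G)) => wG.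
  by rewrite mul1r; move: wG; rewrite inE; exact.
by rewrite mul0r normr0 mulr_ge0.
Qed.

End averaging.

Theorem theorem1 (R : realType) (d : measure_display) (Omega : measurableType d)
  (P : probability Omega R) (P_complete : measure_is_complete P)
  (T : R) (T_gt0 : 0 < T)
  (mu : set R -> {RV P >-> R}) (mu_sm : stochastic_measure mu)
  (* (1) *)
  (u0 : R -> Omega -> R)
  (u0_meas : measurable_fun setT (fun z : R * Omega => u0 z.1 z.2))
  (C : {RV P >-> R}) (C_gt0 : forall w, 0 < C w)
  (beta_u0 : R) (beta_u0_ge : 1 / 6 <= beta_u0)
  (u0_bnd : forall y w, `|u0 y w| <= C w)
  (u0_holder : forall y1 y2 w,
     `|u0 y1 w - u0 y2 w| <= C w * `|y1 - y2| `^ beta_u0)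
  (* (2) *)
  (f : R -> R -> R)
  (f_meas : measurable_fun setT (fun z : R * R => f z.1 z.2))
  (f_bnd : exists M : R, forall y z : R, `|f y z| <= M)
  (f_lip : exists L : R, forall y1 y2 z1 z2,
     `|f y1 z1 - f y2 z2| <= L * (`|y1 - y2| + `|z1 - z2|))
  (* (3) *)
  (sigma : R -> R -> R)
  (sigma_meas : measurable_fun [set z : R * R | 0 <= z.1]
     (fun z : R * R => sigma z.1 z.2))
  (sigma_bnd : exists M : R, forall s y : R, 0 <= s -> `|sigma s y| <= M)
  (beta_sigma : R) (beta_sigma_bounds : 1 / 2 < beta_sigma < 1)
  (sigma_holder : exists L : R, forall s y1 y2 : R, 0 <= s ->
     `|sigma s y1 - sigma s y2| <= L * `|y1 - y2| `^ beta_sigma)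
  (* (4) *)
  (tau : R) (tau_gt : 5 / 2 < tau)
  (tau_int : mu_integrable mu (fun y => `|y| `^ tau))
  (* (5) *)
  (sigma_bar : R -> R)
  (sigma_bar_lim : forall y,
     t^-1 * (\int[lebesgue_measure]_(s in `[0, t]) sigma s y) @[t --> +oo]
       --> sigma_bar y)
  (G_bnd : exists M : R, forall r y : R, 0 <= r ->
     `| \int[lebesgue_measure]_(s in `[0, r]) (sigma s y - sigma_bar y) | <= M)
  (u : R -> R -> R -> Omega -> R)
  (u_sol : forall eps : R, 0 < eps ->
     is_solution mu T u0 f (fun s y => sigma (s / eps) y) (u eps))
  (u_bar : R -> R -> Omega -> R)
  (u_bar_sol : is_solution mu T u0 f (fun _ y => sigma_bar y) u_bar) :
  exists (v : R -> R -> R -> {RV P >-> R}) (v_bar : R -> R -> {RV P >-> R}),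
    [/\ forall eps t x : R, 0 < eps -> 0 <= t <= T ->
          {ae P, forall w, v eps t x w = u eps t x w},
        forall t x : R, 0 <= t <= T -> {ae P, forall w, v_bar t x w = u_bar t x w}
      & forall gamma1 : R, 0 <= gamma1 < 1 / 2 * (1 - 1 / (2 * beta_sigma)) ->
          {ae P, forall w,
            (ereal_sup [set (z.1.1 `^ (- gamma1)
                              * `|v z.1.1 z.1.2 z.2 w - v_bar z.1.2 z.2 w|)%R%:E
                       | z in [set z : R * R * R |
                                 (0 < z.1.1)%R /\ (0 <= z.1.2 <= T)%R]] < +oo)%E}].
Proof.
have tau1 : 1 <= tau by move: tau_gt; lra.
have /andP[be1 be2] := beta_sigma_bounds.
have be0 : 0 < beta_sigma by lra.
pose a := 1 / (2 * beta_sigma).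
have a1 : a < 1 by rewrite /a ltr_pdivrMr ?mulr_gt0//; lra.
(* Denominators starting at 2 keep [th n] strictly below 1. *)
pose th n := a + (1 - a) / n.+2%:R.
have th_bnd n : 1 / (2 * beta_sigma) < th n < 1.
  have q0 : 0 < (1 - a) / n.+2%:R by rewrite divr_gt0// subr_gt0.
  have q1 : (1 - a) / n.+2%:R < 1 - a by rewrite ltr_pdivrMr// ltr_pMr ?subr_gt0// ltr1n.
  by rewrite -/a /th ltrDl q0 /=; move: q1; generalize ((1 - a) / n.+2%:R) => q; lra.
have [K HK] := choice (fun n => averaging_rate mu_sm f_meas f_bnd f_lip sigma_meas
  sigma_bnd beta_sigma_bounds sigma_holder tau1 tau_int G_bnd u_sol u_bar_sol (th_bnd n)).
pose rate n (eps : R) := Num.min 1 (Num.sqrt eps) `^ (1 - th n).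
have V (z : R * R * R) : exists Y : {RV P >-> R}, 0 < z.1.1 -> 0 <= z.1.2 <= T ->
    {ae P, forall w, Y w = u z.1.1 z.1.2 z.2 w} /\
    forall n w, `|Y w - u_bar z.1.2 z.2 w| <= K n w * rate n z.1.1.
  have [/andP[h1 h2]|h] := boolP ((0 < z.1.1) && (0 <= z.1.2 <= T)); last first.
    (* Outside the parameter range any random variable will do as a value. *)
    by exists (mu set0) => h1 h2; move: h; rewrite h1 h2.
  have [||||Y HY] := @averaging_versions _ _ _ _ _ _ _ _ _ _ _ _ u_sol u_bar_sol rate K _ _ _ _ _ _ z.2 h1 h2.
  - by move=> n; have [] := HK n.
  - by move=> n; have [] := HK n.
  - by move=> n eps; exact: powR_ge0.
  - by move=> n; have [_ _] := HK n.
  by exists Y.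
have W (z : R * R) : exists Y : {RV P >-> R}, 0 <= z.1 <= T -> Y = u_bar z.1 z.2 :> (Omega -> R).
  have [h|h] := boolP (0 <= z.1 <= T); last by exists (mu set0).
  have [Y HY] := rv_of_measurable P (measurable_solution z.2 u_bar_sol h).
  by exists Y.
have [v Hv] := choice V; have [vb Hvb] := choice W.
exists (fun eps t x => v (eps, t, x)), (fun t x => vb (t, x)); split.
- by move=> eps t x e0 tT; have [] := Hv (eps, t, x) e0 tT.
- by move=> t x tT; apply: nearW => w; rewrite (Hvb (t, x)).
move=> g /andP[g0 ga]; have [n gn] := geometric_exponent a1 ga.
(* For the chosen versions the bound holds at every w, and [K n w] dominates the supremum over all
   parameters. *)
apply: nearW => w; apply: (@le_lt_trans _ _ (K n w)%:E); last exact: ltry.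
apply: ge_ereal_sup => _ [[[eps t] x] /= [e0 tT] <-]; rewrite lee_fin.
rewrite (Hvb (t, x))//; have [_ h] := Hv (eps, t, x) e0 tT.
have [_ K0 _] := HK n.
apply: (@le_trans _ _ (eps `^ (- g) * (K n w * rate n eps))).
  by apply: ler_wpM2l; [exact: powR_ge0|exact: h].
rewrite mulrCA; apply: ler_piMr => //; exact: rate_le.
Qed.
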